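(* Let $\Omega\subset\mathbb{R}^n$, $n\ge2$, be a uniform domain, let $m$ be an integer with $0<m<n$, and let $0<\delta<1$. Then the classes of standard and smooth kernels coincide: $K_\Omega^{-m}(\delta)=\mathcal{K}_\Omega^{-m}(\delta)$. As a consequence, if $K\in K_{\mathbb{R}^n}^{-m}(\delta)$ and $a,b\in\mathbb{N}_0^n$ satisfy $|a|+|b|=m$, then $\partial_x^a\partial_y^bK:\mathbb{R}^n\times\mathbb{R}^n\setminus\{(x,x)\}\to\mathbb{C}$ is a Calderón–Zygmund kernel.
   Context: A domain $\Omega\subset\mathbb{R}^n$ is $c$-uniform ($c\ge1$) if every pair of distinct $x,y\in\Omega$ can be joined by a continuum $E\subset\Omega$ containing $x,y$ with $\operatorname{diam}(E)\le c|x-y|$ and $\min\{|z-x|,|z-y|\}\le c\operatorname{dist}(z,\partial\Omega)$ for $z\in E$; it is uniform if it is $c$-uniform for some $c$. Difference operators: for $\ell\in\mathbb{N}$, $h\in\mathbb{R}^n$, $D\subset\mathbb{R}^n$, $f:D\to\mathbb{C}$, set $\Delta_h^\ell(f,D,y)=\sum_{k=0}^\ell(-1)^{\ell+k}\binom{\ell}{k}f(y+kh)$ if $\{y,y+h,\dots,y+\ell h\}\subset D$, and $0$ otherwise. Standard kernels $K_\Omega^{-m}(\delta)$: continuous $K:\Omega\times\Omega\setminus\{(x,x)\}\to\mathbb{C}$ such that for some $C_K$: $|K(x,y)|\le C_K|x-y|^{m-n}$ for $x,y\in\Omega$, and $$\sup_{|h|\le\operatorname{diam}(B)}\frac{1}{|B|^{1+(m+\delta)/n}}\int_B|\Delta_h^{m+1}(K(x,\cdot),B,y)|\,dy\le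 C_K|x-y^B|^{-n-\delta}$$ whenever $x\in\Omega$ and $B\subset\subset\Omega$ is a ball centered at $y^B$ with $C_K\operatorname{diam}(B)\le|x-y^B|$; the same estimate is required with $K(x,\cdot)$ replaced by $K(\cdot,x)$. Smooth kernels $\mathcal{K}_\Omega^{-m}(\delta)$: $K\in C^m(\Omega\times\Omega\setminus\{(x,x)\})$ with $|\partial_x^a\partial_y^bK(x,y)|\le C_K|x-y|^{m-n-|a|-|b|}$ for $|a|+|b|\le m$, and for $|a|+|b|=m$, $|\partial_x^a\partial_y^bK(x,y+h)-\partial_x^a\partial_y^bK(x,y)|\le C_K|h|^\delta|x-y|^{-n-\delta}$ when $x,y,y+h\in\Omega$, $|h|\le|x-y|/2$, and likewise with increment in $x$. A Calderón–Zygmund kernel is $K$ on $\mathbb{R}^n\times\mathbb{R}^n\setminus\{(x,x)\}$ such that $K$ and $K^t(x,y)=K(y,x)$ satisfy, for some $\delta'\in(0,1]$, $|K(x,y)|\le C|x-y|^{-n}$ and $|K(x,y+h)-K(x,y)|\le C|h|^{\delta'}|x-y|^{-n-\delta'}$ for $|h|\le|x-y|/2$. *)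

(* Defs.v *)
From HB Require Import structures.
From mathcomp Require Import all_boot all_order all_algebra.
From mathcomp Require Import all_classical all_reals all_analysis.
Set Implicit Arguments. Unset Strict Implicit. Unset Printing Implicit Defensive.
Import Order.TTheory GRing.Theory Num.Theory.
Import numFieldNormedType.Exports.
Local Open Scope classical_set_scope.
Local Open Scope ring_scope.

Section Defs.
Variable R : realType.

(* Euclidean norm on R^k = 'rV[R]_k (for k = 2 this is the complex modulus,
   complex numbers being represented as 'rV[R]_2). *)
Definition enorm (k : nat) (v : 'rV[R]_k) : R := Num.sqrt (\sum_i v 0 i ^+ 2).
Definition edist (k : nat) (x y : 'rV[R]_k) : R := enorm (x - y).

Variable n : nat.
Local Notation V := 'rV[R]_n.
(* complex values represented as 'rV[R]_2 *)
Local Notation W := 'rV[R]_2.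

(* diameter (extended real, +oo if unbounded, -oo if empty) *)
Definition diam (E : set V) : \bar R :=
  ereal_sup [set e | exists a b, E a /\ E b /\ e = (edist a b)%:E].

Definition bdry (O : set V) : set V := closure O `\` interior O.

(* dist(z, boundary O), +oo if the boundary is empty *)
Definition dist_bd (O : set V) (z : V) : \bar R :=
  ereal_inf [set e | exists w, bdry O w /\ e = (edist z w)%:E].

Definition domain (O : set V) : Prop := open O /\ connected O /\ O !=set0.

Definition c_uniform (c : R) (O : set V) : Prop :=
  domain O /\
  forall x y, O x -> O y -> x != y ->
    exists E : set V, [/\ E `<=` O, compact E, connected E, E x & E y] /\
      (diam E <= (c * edist x y)%:E)%E /\
      forall z, E z ->
        ((Num.min (edist z x) (edist z y))%:E <= c%:E * dist_bd O z)%E.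

Definition uniform_domain (O : set V) : Prop :=
  exists c : R, 1 <= c /\ c_uniform c O.

Definition Delta (l : nat) (h : V) (f : V -> W) (D : set V) (y : V) : W :=
  if `[< forall k : nat, (k <= l)%N -> D (y + k%:R *: h) >] then
    \sum_(k < l.+1) (((-1) ^+ (l + k) * ('C(l, k))%:R) *: f (y + k%:R *: h))
  else 0.

(* n-dimensional Lebesgue integral of a nonnegative function, as an iterated
   integral of one-dimensional Lebesgue integrals (Tonelli). *)
Fixpoint iint (k : nat) (F : (nat -> R) -> \bar R) : \bar R :=
  match k with
  | 0 => F (fun _ => 0)
  | k'.+1 => (\int[lebesgue_measure]_t
                iint k' (fun v => F (fun j => if j == k' then t else v j)))%E
  end.

Definition Rn_integral_on (B : set V) (g : V -> \bar R) : \bar R :=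
  iint n (fun v => let y := \row_i v i in
                   if `[< B y >] then g y else 0%E).

Definition volume (B : set V) : \bar R := Rn_integral_on B (fun _ => 1%E).

Definition eball (c : V) (r : R) : set V := [set y | edist y c < r].

Definition cc (B O : set V) : Prop := compact (closure B) /\ closure B `<=` O.

Definition offdiag (O : set V) : set (V * V) :=
  [set p | O p.1 /\ O p.2 /\ p.1 != p.2].

Definition ball_est (O : set V) (m : nat) (d C : R) (G : V -> V -> W) : Prop :=
  forall (x c : V) (r : R), O x -> 0 < r -> cc (eball c r) O ->
    (C%:E * diam (eball c r) <= (edist x c)%:E)%E ->
    (ereal_sup [set e | exists h : V, (enorm h)%:E <= diam (eball c r) /\
        e = ((fine (volume (eball c r)) `^ (1 + (m%:R + d) / n%:R))^-1)%:E *
            Rn_integral_on (eball c r)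
              (fun y => (enorm (Delta m.+1 h (G x) (eball c r) y))%:E)]
    <= (C * (edist x c `^ (- (n%:R + d))))%:E)%E.

(* standard kernels K_O^{-m}(d).  (Requiring C >= 1 is harmless: the
   conditions are monotone in C; it only guarantees x is not in B.) *)
Definition std_kernel (O : set V) (m : nat) (d : R) (K : V -> V -> W) : Prop :=
  {within offdiag O, continuous (fun p : V * V => K p.1 p.2)} /\
  exists C : R, 1 <= C /\
    (forall x y, O x -> O y -> x != y ->
       enorm (K x y) <= C * (edist x y `^ (m%:R - n%:R))) /\
    ball_est O m d C K /\ ball_est O m d C (fun x y => K y x).

Definition unitv (i : 'I_n) : V := delta_mx 0 i.
Definition dX (i : 'I_n) (K : V -> V -> W) : V -> V -> W :=
  fun x y => 'D_(unitv i) (fun x' => K x' y) x.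
Definition dY (i : 'I_n) (K : V -> V -> W) : V -> V -> W :=
  fun x y => 'D_(unitv i) (K x) y.

Definition dXa (a : 'I_n -> nat) (K : V -> V -> W) : V -> V -> W :=
  foldr (fun i K' => iter (a i) (dX i) K') K (enum 'I_n).
Definition dYa (b : 'I_n -> nat) (K : V -> V -> W) : V -> V -> W :=
  foldr (fun i K' => iter (b i) (dY i) K') K (enum 'I_n).
Definition mabs (a : 'I_n -> nat) : nat := (\sum_i a i)%N.

Fixpoint Ck_on (U : set (V * V)) (k : nat) (K : V -> V -> W) : Prop :=
  {within U, continuous (fun p : V * V => K p.1 p.2)} /\
  match k with
  | 0 => True
  | k'.+1 =>
    (forall i p, U p -> derivable (fun x => K x p.2) p.1 (unitv i) /\
                        derivable (K p.1) p.2 (unitv i)) /\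
    (forall i, Ck_on U k' (dX i K) /\ Ck_on U k' (dY i K))
  end.

Definition smooth_kernel (O : set V) (m : nat) (d : R) (K : V -> V -> W) : Prop :=
  Ck_on (offdiag O) m K /\
  exists C : R,
    (forall (a b : 'I_n -> nat) x y, (mabs a + mabs b <= m)%N ->
       O x -> O y -> x != y ->
       enorm (dXa a (dYa b K) x y)
         <= C * (edist x y `^ (m%:R - n%:R - (mabs a)%:R - (mabs b)%:R))) /\
    (forall (a b : 'I_n -> nat) x y h, (mabs a + mabs b = m)%N ->
       O x -> O y -> O (y + h) -> enorm h <= edist x y / 2 ->
       enorm (dXa a (dYa b K) x (y + h) - dXa a (dYa b K) x y)
         <= C * (enorm h `^ d) * (edist x y `^ (- (n%:R + d)))) /\
    (forall (a b : 'I_n -> nat) x y h, (mabs a + mabs b = m)%N ->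
       O x -> O (x + h) -> O y -> enorm h <= edist x y / 2 ->
       enorm (dXa a (dYa b K) (x + h) y - dXa a (dYa b K) x y)
         <= C * (enorm h `^ d) * (edist x y `^ (- (n%:R + d)))).

Definition CZ_est (d' C : R) (K : V -> V -> W) : Prop :=
  (forall x y, x != y -> enorm (K x y) <= C * (edist x y `^ (- n%:R))) /\
  (forall x y h, x != y -> enorm h <= edist x y / 2 ->
     enorm (K x (y + h) - K x y)
       <= C * (enorm h `^ d') * (edist x y `^ (- (n%:R + d')))).

Definition CZ_kernel (K : V -> V -> W) : Prop :=
  exists d' C : R, 0 < d' <= 1 /\ CZ_est d' C K /\ CZ_est d' C (fun x y => K y x).

End Defs.

(* Main.v *)
(* From standard to smooth kernels. Telescoping the ball estimate over dyadic
   steps, and comparing differences with different steps, bounds the pure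
   (m+1)-fold differences of K(x, .) and K(., y) pointwise; Kemperman's identity
   extends this to distinct steps. Hence (2m+1)-fold differences of K on
   R^n x R^n, each step moving x alone or y alone, have the expected size, and
   descending induction gives the same for q-fold differences: doubling all
   steps multiplies a difference by 2^q up to (q+1)-fold differences, and in a
   uniform domain a pair can be moved, through boundedly many short steps, to
   one with twice as much room, until the steps are comparable with |x - y|
   where the size estimate of K applies. Dividing by the step and letting it
   tend to 0 produces derivatives satisfying the analogous bounds, m times. The
   Hoelder estimate for the derivatives of order m reaches the boundary by
   approaching (x, y) along pairs whose room shrinks geometrically.

   From smooth to standard kernels. Following a fine staircase along a segment
   writes an (m+1)-fold difference as a sum of differences with coordinate steps.
   These can be reordered freely, so the mean value inequality applied one
   coordinate at a time bounds them by the oscillation of one of the given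
   derivatives of order m; the symmetry of mixed derivatives is not needed.

   On row vectors `|.| is the sup norm; Euclidean norms appear only in the first
   and last estimates. *)

(* The ball estimate averages over base points with the step fixed, whereas a pointwise bound fixes
   the base point. To pass from one to the other, differences with two independent steps are
   compared, each step also serving as a displacement of the base point of the other. The number
   2m+1 comes from the pigeonhole principle: among 2m+1 steps that each move one variable, m+1 move
   the same one. The delicate point of the descent is that, for q at most m, dividing a difference
   with doubled steps by 2^q reproduces exactly the scaling of [phi], so nothing is gained. The
   errors of all doublings can be summed only because (q+1)-fold differences carry an extra factor
   (t / |x - y|)^d or better. Near the boundary there is no room for steps comparable with |x - y|;
   this is why the pair moves inwards while the steps double. Room is measured in multiples [Lam] of
   the step, and these multiples may grow from one stage to the next. *)
Require Import Defs.
From HB Require Import structures.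
From mathcomp Require Import all_boot all_order all_algebra.
From mathcomp Require Import all_classical all_reals all_analysis.
From mathcomp Require Import measurable_realfun.
From mathcomp Require Import ring lra.
Set Implicit Arguments. Unset Strict Implicit. Unset Printing Implicit Defensive.
Import Order.TTheory GRing.Theory Num.Theory.
Import numFieldNormedType.Exports.
Import Defs.
Local Open Scope classical_set_scope.
Local Open Scope ring_scope.

(** * Linear combinations *)

Section LinearExpressions.
Variables (R : comPzRingType) (V : lmodType R).

Inductive lexpr :=
  | LVar of nat | LZero | LAdd of lexpr & lexpr | LOpp of lexpr
  | LScale of R & lexpr.

Fixpoint leval (env : seq V) (e : lexpr) : V :=
  match e with
  | LVar i => nth 0 env i
  | LZero => 0
  | LAdd a b => leval env a + leval env b
  | LOpp a => - leval env a
  | LScale c a => c *: leval env a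
  end.

(** [Nat.eqb] lets [simpl] evaluate the coefficients on numerals, so that only ring identities
    remain. *)
Fixpoint lcoef (e : lexpr) (i : nat) : R :=
  match e with
  | LVar j => if Nat.eqb i j then 1 else 0
  | LZero => 0
  | LAdd a b => lcoef a i + lcoef b i
  | LOpp a => - lcoef a i
  | LScale c a => c * lcoef a i
  end.

Lemma levalE env e : leval env e = \sum_(i < size env) lcoef e i *: nth 0 env i.
Proof.
elim: e => /= [j||a -> b ->|a ->|c a ->].
- have [js|js] := leqP (size env) j.
    rewrite nth_default // big1 // => i _.
      case: PeanoNat.Nat.eqb_spec => [ij|_]; last by rewrite scale0r.
    by move: js; rewrite -ij leqNgt ltn_ord.
  rewrite (bigD1 (Ordinal js)) //= PeanoNat.Nat.eqb_refl scale1r big1 ?addr0 //.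
  move=> i /eqP ij; case: PeanoNat.Nat.eqb_spec => [e|_]; rewrite ?scale0r //.
  by case: ij; apply: val_inj.
- by rewrite big1 // => i _; rewrite scale0r.
- by rewrite -big_split; apply: eq_bigr => i _; rewrite scalerDl.
- by rewrite -sumrN; apply: eq_bigr => i _; rewrite scaleNr.
- by rewrite scaler_sumr; apply: eq_bigr => i _; rewrite scalerA.
Qed.

(** A nested conjunction, which [repeat split] turns into one goal per atom. *)
Fixpoint lcoef_eq (e1 e2 : lexpr) (k : nat) : Prop :=
  if k is k'.+1 then lcoef e1 k' = lcoef e2 k' /\ lcoef_eq e1 e2 k' else True.

Lemma leval_eq env e1 e2 : lcoef_eq e1 e2 (size env) -> leval env e1 = leval env e2.
Proof.
move=> H; rewrite !levalE; apply: eq_bigr => -[i /=] + _.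
move: (size env) H => k; elim: k => //= k IH [H1 H2].
by rewrite ltnS leq_eqVlt => /orP[/eqP ->|/IH->] //; rewrite H1.
Qed.

End LinearExpressions.

(** The inner [match] runs [unify] while a term is being built; if it fails, the outer [match] moves
    on to its next branch. *)
Ltac lmem x env :=
  lazymatch env with
  | nil => constr:(false)
  | cons ?y ?env' => match constr:(Set) with
    | _ => let _ := match constr:(Set) with _ => unify x y end in constr:(true)
    | _ => lmem x env' end
  end.
Ltac ladd x env := let b := lmem x env in
  lazymatch b with true => env | false => constr:(cons x env) end.
Ltac latoms e env :=
  lazymatch e with
  | (?a + ?b)%R => let env := latoms a env in latoms b env
  | (- ?a)%R => latoms a env
  | (?c *: ?a)%R => latoms a env
  | 0%R => env
  | ?x => ladd x env
  end.
Ltac lidx x env :=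
  lazymatch env with
  | cons ?y ?env' =>
    match constr:(Set) with
    | _ => let _ := match constr:(Set) with _ => unify x y end in constr:(0%N)
    | _ => let k := lidx x env' in constr:(S k) end
  end.
Ltac lquote R e env :=
  lazymatch e with
  | (?a + ?b)%R => let p := lquote R a env in let q := lquote R b env in
      constr:(@LAdd R p q)
  | (- ?a)%R => let p := lquote R a env in constr:(@LOpp R p)
  | (?c *: ?a)%R => let p := lquote R a env in constr:(@LScale R c p)
  | 0%R => constr:(@LZero R)
  | ?x => let k := lidx x env in constr:(@LVar R k)
  end.

(* Proves equalities of linear combinations: the coefficients of each atom are
   compared with [ring]. *)
Ltac lmod R :=
  lazymatch goal with
  | |- @eq ?V ?a ?b =>
    let env := latoms a (@nil V) in let env := latoms b env in
    let p := lquote R a env in let q := lquote R b env in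
    apply: (@leval_eq R _ env p q); simpl; repeat split; ring
  end.

(** * Iterated differences *)

Section Differences.
Variables (R : realType) (V W : normedModType R).
Implicit Types (f g : V -> W) (l : seq V) (x h : V) (t B : R).

Definition D1 h f x : W := f (x + h) - f x.

Fixpoint Dl l f x : W :=
  if l is h :: l' then Dl l' f (x + h) - Dl l' f x else f x.

Lemma Dl_cat l1 l2 f x : Dl (l1 ++ l2) f x = Dl l1 (Dl l2 f) x.
Proof. by elim: l1 x => //= h l1 IH x; rewrite !IH. Qed.

Lemma DlB l f g x : Dl l (fun y => f y - g y) x = Dl l f x - Dl l g x.
Proof.
by elim: l x => //= h l IH x; rewrite !IH; lmod R.
Qed.

Lemma DlD l f g x : Dl l (fun y => f y + g y) x = Dl l f x + Dl l g x.
Proof. by elim: l x => //= h l IH x; rewrite !IH; lmod R. Qed.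

Lemma DlZ l c f x : Dl l (fun y => c *: f y) x = c *: Dl l f x.
Proof. by elim: l x => //= h l IH x; rewrite !IH scalerBr. Qed.

Lemma Dl_shift l f v x : Dl l (fun y => f (y + v)) x = Dl l f (x + v).
Proof. by elim: l x => //= h l IH x; rewrite !IH addrAC. Qed.

Lemma Dl_consr h l f x : Dl (h :: l) f x = Dl l (D1 h f) x.
Proof. by rewrite /= /D1 DlB Dl_shift. Qed.

Lemma Dl_swap h k l f x : Dl (h :: k :: l) f x = Dl (k :: h :: l) f x.
Proof.
by rewrite /= [x + h + k]addrAC; lmod R.
Qed.

Lemma Dl_perm l1 l2 f x : perm_eq l1 l2 -> Dl l1 f x = Dl l2 f x.
Proof.
have move_front l h x' : h \in l -> Dl l f x' = Dl (h :: rem h l) f x'.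
  elim: l x' => //= a l IH x'; rewrite inE; case: eqVneq => [->|] //= ha hl.
  rewrite !(IH _ hl); exact: (Dl_swap a h (rem h l) f x').
elim: l1 l2 x => [|h l1 IH] l2 x p12.
  by have := perm_size p12; case: l2 {p12}.
have hl2 : h \in l2 by rewrite -(perm_mem p12) mem_head.
rewrite (move_front _ _ _ hl2) /= !(IH (rem h l2)) //.
all: by rewrite -(perm_cons h); apply: perm_trans p12 (perm_to_rem hl2).
Qed.

Lemma Dl_has0 l f x : 0 \in l -> Dl l f x = 0.
Proof.
elim: l x => //= h l IH x; rewrite inE => /orP[/eqP <-|hl].
  by rewrite addr0 subrr.
by rewrite !IH // subrr.
Qed.

Lemma Dl_cst l (c : W) x : l != [::] -> Dl l (fun=> c) x = 0.
Proof.
case: l => // h l _; elim: l h x => [|k l IH] h x; first by rewrite /= subrr.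
transitivity (Dl (k :: l) (fun=> c) (x + h) - Dl (k :: l) (fun=> c) x) => //.
by rewrite !IH subrr.
Qed.

Lemma Dl_bound l f x t B : (forall h, h \in l -> `|h| <= t) ->
  (forall x', `|x' - x| <= (size l)%:R * t -> `|f x'| <= B) ->
  `|Dl l f x| <= 2 ^+ size l * B.
Proof.
elim: l x => /= [|h l IH] x lt fB.
  by rewrite expr0 mul1r fB // subrr normr0 mul0r.
have ht : `|h| <= t by apply: lt; rewrite mem_head.
have t0 : 0 <= t := le_trans (normr_ge0 _) ht.
have ll h' : h' \in l -> `|h'| <= t by move=> hl; apply: lt; rewrite inE hl orbT.
apply: le_trans (ler_normB _ _) _; rewrite exprS -mulrA mulr2n mulrDl mul1r.
apply: lerD; apply: IH => // x' x'x; apply: fB.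
  rewrite -natr1 mulrDl mul1r.
  by apply: le_trans (ler_distD (x + h) _ _) _; apply: lerD; rewrite // addrAC subrr add0r.
by apply: le_trans x'x _; rewrite ler_wpM2r // ler_nat.
Qed.

Lemma eq_Dl l f g x t : (forall h, h \in l -> `|h| <= t) ->
  (forall x', `|x' - x| <= (size l)%:R * t -> f x' = g x') -> Dl l f x = Dl l g x.
Proof.
move=> lt fg; apply/eqP; rewrite -subr_eq0 -normr_le0 -DlB.
rewrite -[leRHS](mulr0 (2 ^+ size l)); apply: (Dl_bound lt) => x' /fg ->.
by rewrite subrr normr0.
Qed.

Lemma D1_mul (N : nat) h f x :
  D1 (N%:R *: h) f x = \sum_(i < N) D1 h f (x + i%:R *: h).
Proof.
elim: N => [|N IH]; first by rewrite big_ord0 /D1 scale0r addr0 subrr.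
rewrite big_ord_recr /= -IH /D1 -natr1 scalerDl scale1r addrA.
by lmod R.
Qed.

Lemma Dl_sum l (N : nat) (F : nat -> V -> W) x :
  Dl l (fun y => \sum_(i < N) F i y) x = \sum_(i < N) Dl l (F i) x.
Proof.
elim: N => [|N IH].
  rewrite big_ord0; elim: l x => [x|h l /= IH x]; first by rewrite /= big_ord0.
  by rewrite !IH subrr.
under [in LHS]eq_fun do rewrite big_ord_recr /=.
by rewrite DlD IH big_ord_recr.
Qed.

(** A difference with step N h is the sum of N differences with step h at translated points; doing
    this for every step gives N^q terms. *)
Lemma Dl_scale (N : nat) l f x t B : (0 < N)%N ->
  (forall h, h \in l -> `|h| <= t) ->
  (forall x', `|x' - x| <= (size l * N)%:R * t -> `|Dl l f x'| <= B) ->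
  `|Dl [seq N%:R *: h | h <- l] f x| <= (N ^ size l)%:R * B.
Proof.
move=> N0; elim: l f x => /= [|h l IH] f x lt fB.
  by rewrite mul1r fB // subrr normr0 mul0n mul0r.
have ht : `|h| <= t by apply: lt; rewrite mem_head.
have t0 : 0 <= t := le_trans (normr_ge0 _) ht.
have ll h' : h' \in l -> `|h'| <= t by move=> hl; apply: lt; rewrite inE hl orbT.
set Nl := map _ _.
have -> : Dl Nl f (x + N%:R *: h) - Dl Nl f x = Dl ((N%:R *: h) :: Nl) f x by [].
rewrite Dl_consr; rewrite (_ : D1 _ f = fun y => \sum_(i < N) D1 h f (y + i%:R *: h)); last first.
  by apply/funext => y; rewrite D1_mul.
rewrite (Dl_sum _ _ (fun i y => D1 h f (y + i%:R *: h))); apply: le_trans (ler_norm_sum _ _ _) _.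
rewrite expnS natrM -mulrA.
suff : forall i : 'I_N, `|Dl Nl (fun y => D1 h f (y + i%:R *: h)) x| <= (N ^ size l)%:R * B.
  move=> H; apply: le_trans (ler_sum _ (fun i _ => H i)) _.
  by rewrite sumr_const card_ord -[leLHS]mulr_natl.
move=> i; rewrite Dl_shift; apply: IH => // x' x'x.
rewrite -Dl_consr; apply: fB.
apply: le_trans (ler_distD (x + i%:R *: h) _ _) _.
rewrite [x + _]addrC addrK mulSn natrD mulrDl [leLHS]addrC; apply: lerD => //.
  rewrite normrZ ger0_norm ?ler0n //; apply: ler_pM => //.
  by rewrite ler_nat ltnW.
by rewrite [X in _ - X]addrC.
Qed.

(** A doubled step satisfies Delta_{2h} = 2 Delta_h + Delta_h^2. Replacing one step at a time leaves
    errors that are (q+1)-fold differences in which one step of [l] is repeated. *)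
Lemma Dl_double l f x t B : (forall h, h \in l -> `|h| <= t) ->
  (forall h x', h \in l -> `|x' - x| <= (size l)%:R * t ->
     `|Dl (h :: l) f x'| <= B) ->
  `|Dl [seq 2%:R *: h | h <- l] f x - 2 ^+ size l *: Dl l f x|
    <= (size l)%:R * 2 ^+ size l * B.
Proof.
elim: l f x => /= [|h l IH] f x lt fB.
  by rewrite expr0 scale1r subrr normr0 !mul0r.
have ht : `|h| <= t by apply: lt; rewrite mem_head.
have t0 : 0 <= t := le_trans (normr_ge0 _) ht.
have ll h' : h' \in l -> `|h'| <= t by move=> hl; apply: lt; rewrite inE hl orbT.
set ml := map _ _; set q := size l.
have -> : Dl ml f (x + 2%:R *: h) - Dl ml f x
        = Dl ml (D1 h f) x + Dl ml (D1 h f) (x + h).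
  rewrite -!Dl_consr /=; have -> : x + 2%:R *: h = x + h + h by lmod R.
  by lmod R.
have IHg x' : `|x' - x| <= t ->
    `|Dl ml (D1 h f) x' - 2 ^+ q *: Dl l (D1 h f) x'| <= q%:R * 2 ^+ q * B.
  move=> x'x; apply: IH => // k z kl zx'.
  have -> : Dl l (D1 h f) (z + k) - Dl l (D1 h f) z = Dl (k :: h :: l) f z.
    by rewrite -!Dl_consr.
  apply: (fB k z); first by rewrite inE kl orbT.
  rewrite -natr1 mulrDl mul1r; apply: le_trans (ler_distD x' _ _) _.
  exact: lerD.
have e1 := IHg x; have e2 := IHg (x + h); rewrite addrAC subrr add0r in e2.
rewrite subrr normr0 in e1; have {}e1 := e1 t0; have {}e2 := e2 ht.
have e3 : `|Dl l (D1 h f) (x + h) - Dl l (D1 h f) x| <= B.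
  have := fB h x (mem_head _ _); rewrite -/(Dl l f (x + h) - _) subrr normr0.
  rewrite mulr_ge0 // => /(_ isT).
  by rewrite (_ : _ - _ - _ = Dl (h :: h :: l) f x) // Dl_consr.
have -> : Dl l f (x + h) - Dl l f x = Dl l (D1 h f) x by rewrite -Dl_consr.
set a := Dl ml _ x in e1 *; set b := Dl ml _ _ in e2 *.
set u := Dl l _ x in e1 e3 *; set v := Dl l _ _ in e2 e3.
have -> : a + b - 2 ^+ q.+1 *: u
    = (a - 2 ^+ q *: u) + (b - 2 ^+ q *: v) + 2 ^+ q *: (v - u).
  rewrite exprS mulr_natl mulr2n scalerDl scalerBr opprD !addrA; congr (_ - _).
  by rewrite subrK addrAC.
apply: le_trans (ler_normD _ _) _.
have -> : q.+1%:R * 2 ^+ q.+1 * B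
   = (q%:R * 2 ^+ q * B + q%:R * 2 ^+ q * B) + (2 ^+ q * B + 2 ^+ q * B).
  by rewrite -natr1 exprS; ring.
apply: lerD; first by apply: le_trans (ler_normD _ _) _; exact: lerD.
rewrite normrZ ger0_norm ?exprn_ge0 //.
have B0 : 0 <= B := le_trans (normr_ge0 _) e3.
by rewrite -[leLHS]addr0 lerD ?ler_wpM2l ?mulr_ge0 ?exprn_ge0.
Qed.

(** The coefficients of [Delta]; through [Dl_nseq] they identify [Delta] with [Dl]. *)
Definition altbin (r k : nat) : R := (-1) ^+ (r + k) * 'C(r, k)%:R.

Lemma Dl_nseq r h f x :
  Dl (nseq r h) f x = \sum_(k < r.+1) altbin r k *: f (x + k%:R *: h).
Proof.
elim: r x => [|r IH] x.
  by rewrite big_ord_recl big_ord0 /altbin bin0 /= mulr1 scale1r scale0r !addr0.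
rewrite /= !IH [X in _ - X]big_ord_recl big_ord_recr.
rewrite [in RHS]big_ord_recl [X in _ = _ + X]big_ord_recr /= /bump /=.
rewrite scale0r addr0 /altbin !bin0 !binn !addn0 !mulr1 add1n.
have -> : (r.+1 + r.+1)%N = (r + r).+2 by rewrite addnS.
have -> : (-1) ^+ (r + r).+2 = (-1) ^+ (r + r) :> R by rewrite !exprS; ring.
have e (k : nat) : x + h + k%:R *: h = x + k.+1%:R *: h.
  by rewrite -natr1 scalerDl scale1r [_ *: h + h]addrC addrA.
rewrite !e opprD addrCA; congr (_ + _).
  by rewrite exprS mulN1r scaleNr.
rewrite addrAC; congr (_ + _).
rewrite -sumrB; apply: eq_bigr => k _.
rewrite e -scalerBl; congr (_ *: _).
rewrite !add1n binS natrD !addnS !addSn !exprS; ring.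
Qed.

(* If [a_j = h_j] and [b_j = - h_j / j], the term of index [k >= 1] has a zero
   direction, so that only [Dl hs f x] survives. *)
Lemma kemperman_bound (cs : nat -> R) (r : nat) (l : seq (V * V)) f x y B ra rb :
  (forall x' y', `|x' - x| <= (size l)%:R * ra -> `|y' - y| <= (size l)%:R * rb ->
     `|\sum_(k < r) cs k *: f (x' + k%:R *: y')| <= B) ->
  (forall p, p \in l -> `|p.1| <= ra /\ `|p.2| <= rb) ->
  `|\sum_(k < r) cs k *: Dl [seq p.1 + k%:R *: p.2 | p <- l] f (x + k%:R *: y)|
    <= 2 ^+ size l * B.
Proof.
elim: l x y => /= [|[a b] l IH] x y fB lr.
  by rewrite expr0 mul1r; apply: fB; rewrite subrr normr0 mul0r.
have [/= ha hb] := lr _ (mem_head _ _).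
have ra0 : 0 <= ra := le_trans (normr_ge0 _) ha.
have rb0 : 0 <= rb := le_trans (normr_ge0 _) hb.
have ll p : p \in l -> `|p.1| <= ra /\ `|p.2| <= rb.
  by move=> pl; apply: lr; rewrite inE pl orbT.
have := IH (x + a) (y + b); have := IH x y.
set S1 := \sum_(k < r) _ => e1; set S2 := \sum_(k < r) _ => e2.
have -> : \sum_(k < r) cs k *: (Dl [seq p.1 + k%:R *: p.2 | p <- l] f
      (x + k%:R *: y + (a + k%:R *: b))
      - Dl [seq p.1 + k%:R *: p.2 | p <- l] f (x + k%:R *: y)) = S2 - S1.
  rewrite /S1 /S2 -sumrB; apply: eq_bigr => k _; rewrite -scalerBr.
  by congr (_ *: (Dl _ _ _ - _)); lmod R.
apply: le_trans (ler_normB _ _) _; rewrite exprS -mulrA mulr2n mulrDl mul1r.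
apply: lerD.
  apply: e2 => // x' y' hx hy; apply: fB.
    rewrite -natr1 mulrDl mul1r; apply: le_trans (ler_distD (x + a) _ _) _.
    by apply: lerD => //; rewrite addrAC subrr add0r.
  rewrite -natr1 mulrDl mul1r; apply: le_trans (ler_distD (y + b) _ _) _.
  by apply: lerD => //; rewrite addrAC subrr add0r.
apply: e1 => // x' y' hx hy; apply: fB.
  by apply: le_trans hx _; rewrite ler_wpM2r // ler_nat.
by apply: le_trans hy _; rewrite ler_wpM2r // ler_nat.
Qed.

(** Expanding every direction and summing over k first gives a signed sum over the 2^r subsets J of
    the steps. Each term is an r-fold difference with the single step - sum_J h_j / j, whose length
    is at most r t. *)
Lemma Dl_kemperman (hs : seq V) f x t B :
  (forall h, h \in hs -> `|h| <= t) ->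
  (forall x' u, `|x' - x| <= (size hs)%:R * t -> `|u| <= (size hs)%:R * t ->
     `|Dl (nseq (size hs) u) f x'| <= B) ->
  `|Dl hs f x| <= 2 ^+ size hs * B.
Proof.
move=> ht fB; set r := size hs.
pose l := [seq (nth 0 hs j, - (j.+1%:R)^-1 *: nth 0 hs j) | j <- iota 0 r].
have sl : size l = r by rewrite size_map size_iota.
have ln p : p \in l -> `|p.1| <= t /\ `|p.2| <= t.
  move=> /mapP[j]; rewrite mem_iota /= add0n => jr -> /=.
  have hj : `|nth 0 hs j| <= t by apply/ht/mem_nth.
  split=> //; rewrite normrZ normrN ger0_norm ?invr_ge0 // -[leRHS]mul1r.
  by rewrite ler_pM ?invr_ge0 // invf_le1 ?ler1n ?ltr0n.
have := @kemperman_bound (altbin r) r.+1 l f x 0 B t t.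
rewrite sl => H.
rewrite (_ : Dl hs f x = (-1) ^+ r *: \sum_(k < r.+1) altbin r k *:
   Dl [seq p.1 + k%:R *: p.2 | p <- l] f (x + k%:R *: 0)).
  rewrite normrZ normrX normrN1 expr1n mul1r; apply: H => // x' y' hx hy.
  by rewrite -Dl_nseq; apply: fB => //; rewrite -[y']subr0.
rewrite big_ord_recl big1 ?addr0 => [|k _].
  rewrite /altbin addn0 bin0 mulr1 scalerA -exprD addnn -mul2n exprM sqrrN expr1n expr1n.
  rewrite !scale1r scaler0 addr0; congr Dl.
  rewrite -map_comp /= -[LHS](mkseq_nth 0) /mkseq; apply: eq_map => j /=.
  by rewrite scale0r addr0.
(* The sum index is k+1 and directions are numbered from 0, so the direction that vanishes is the
   one at position k. *)
rewrite Dl_has0 ?scaler0 //; apply/mapP.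
exists (nth 0 hs k, - (k.+1%:R)^-1 *: nth 0 hs k).
  by apply/mapP; exists (k : nat); rewrite // mem_iota add0n /=.
by rewrite /= /bump /= add1n scalerA mulrN divff ?pnatr_eq0 // scaleN1r subrr.
Qed.

End Differences.

(** * Iterated integrals and averages *)

Section IteratedIntegral.
Variable R : realType.
Local Notation mu := (@lebesgue_measure R).
Implicit Types (F G : (nat -> R) -> \bar R).
Local Open Scope ereal_scope.

(** The comparison goes through the supremum over simple functions, because the integrand of
    [ball_est] is not shown to be measurable. *)
Lemma ge0_integral_le d (T : measurableType d) (m : {measure set T -> \bar R})
    (f g : T -> \bar R) :
  (forall x, 0 <= f x) -> (forall x, f x <= g x) ->
  \int[m]_x f x <= \int[m]_x g x.
Proof.
move=> f0 fg; have g0 x : 0 <= g x := le_trans (f0 x) (fg x).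
rewrite !ge0_integralTE //; apply: le_ereal_sup => _ [h hf <-].
by exists h => // x; apply: le_trans (hf x) (fg x).
Qed.

(** The image of Lebesgue measure under t -> c + s t, multiplied by s, agrees with Lebesgue measure
    on half-open intervals, hence on all measurable sets. *)
Lemma ge0_integral_affine (c s : R) (g : R -> \bar R) : (0 < s)%R ->
  measurable_fun [set: R] g -> (forall t, 0 <= g t) ->
  \int[mu]_t g t = s%:E * \int[mu]_t g (c + s * t)%R.
Proof.
move=> s0 mg g0.
pose phi : R -> measurableTypeR R := fun t => (c + s * t)%R.
have mphi : measurable_fun setT phi.
  by apply: measurable_funD => //; apply: measurable_funM.
have s0' : (0 <= s)%R := ltW s0.
pose nu : {measure set (measurableTypeR R) -> \bar R} :=
    mscale (NngNum s0') (measure_function_pushforward__canonical__measure_function_Measure mu mphi).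
have munu A : measurable A -> mu A = nu A.
  move: A; apply: (@lebesgue_measure_unique R nu) => _ [[a b] _ <-] /=.
  rewrite /nu /mscale /= /pushforward.
  have -> : phi @^-1` [set` `]a, b]%R] = [set` `](a - c) / s, (b - c) / s]%R].
    apply/seteqP; split => t; rewrite /phi /= !in_itv /= => /andP[h1 h2].
      by rewrite ltr_pdivrMr // ler_pdivlMr // ltrBlDl lerBrDl mulrC h1 h2.
    by move: h1 h2; rewrite ltr_pdivrMr // ler_pdivlMr // ltrBlDl lerBrDl mulrC => -> ->.
  rewrite !lebesgue_measure_itv /= !lte_fin ltr_pM2r ?invr_gt0 // ltrD2r.
  case: ifP => _; last by rewrite mule0.
  by rewrite -EFinM; congr EFin; field; rewrite gt_eqF.
have -> : \int[mu]_t g t = \int[nu]_t g t.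
  by apply: eq_measure_integral => A mA _; exact: (munu A mA).
rewrite ge0_integral_mscale //=; congr (_ * _).
by rewrite ge0_integral_pushforward // preimage_setT.
Qed.

(** The substitution made by [iint] at each of its stages. *)
Definition upd (v : nat -> R) (k : nat) (t : R) : nat -> R :=
  fun j => if j == k then t else v j.

(* Joint measurability in the variables of [S] and the coordinates, tested
   against all measurable families of points. *)
Definition Meas2 d (S : measurableType d) (F : S -> (nat -> R) -> \bar R) :=
  forall d' (S' : measurableType d') (p : S' -> S) (v : nat -> S' -> R),
    measurable_fun setT p -> (forall j, measurable_fun setT (v j)) ->
    measurable_fun setT (fun s => F (p s) (fun j => v j s)).

Definition Meas F := forall d (S : measurableType d) (v : nat -> S -> R),
  (forall j, measurable_fun setT (v j)) ->
  measurable_fun setT (fun s => F (fun j => v j s)).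

Definition MeasP (F : (nat -> R) -> (nat -> R) -> \bar R) :=
  forall d (S : measurableType d) (v w : nat -> S -> R),
  (forall j, measurable_fun setT (v j)) -> (forall j, measurable_fun setT (w j)) ->
  measurable_fun setT (fun s => F (fun j => v j s) (fun j => w j s)).

Lemma iint_ge0 k F : (forall v, 0 <= F v) -> 0 <= iint k F.
Proof.
elim: k F => [|k IH] F F0 //=; apply: integral_ge0 => t _; exact: IH.
Qed.

Lemma le_iint k F G : (forall v, 0 <= F v) -> (forall v, F v <= G v) ->
  iint k F <= iint k G.
Proof.
elim: k F G => [|k IH] F G F0 FG //=; apply: ge0_integral_le => t.
  exact: iint_ge0.
exact: IH.
Qed.

Lemma iint0 k : iint k (fun=> 0 : \bar R) = 0.
Proof.
by elim: k => //= k IH; rewrite -[RHS](integral0 mu setT); apply: eq_integral.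
Qed.

Lemma Meas2_upd d (S : measurableType d) (F : S -> (nat -> R) -> \bar R) k :
  Meas2 F -> Meas2 (fun (st : S * R) v => F st.1 (upd v k st.2)).
Proof.
move=> mF d' S' p v mp mv.
apply: (mF _ _ (fun s => (p s).1) (fun j s => if j == k then (p s).2 else v j s)).
  exact: measurableT_comp.
by move=> j; case: (j == k) => //; apply: measurableT_comp.
Qed.

Lemma measurable_iint k d (S : measurableType d) (F : S -> (nat -> R) -> \bar R) :
  (forall s v, 0 <= F s v) -> Meas2 F ->
  measurable_fun setT (fun s => iint k (F s)).
Proof.
elim: k d S F => [|k IH] d S F F0 mF /=.
  by apply: (mF _ _ id (fun _ _ => 0%R)).
apply: (@measurable_fun_fubini_tonelli_F _ _ S (measurableTypeR R) R mu
  (fun st => iint k (fun v => F st.1 (upd v k st.2)))).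
  by apply: (IH _ _ (fun (st : S * R) v => F st.1 (upd v k st.2))) => //; apply: Meas2_upd.
by move=> st; apply: iint_ge0 => v; apply: F0.
Qed.

Lemma Meas_upd F k : Meas F -> Meas2 (fun t v => F (upd v k t)).
Proof.
move=> mF d' S' p v mp mv.
apply: (mF _ _ (fun j s => if j == k then p s else v j s)).
by move=> j; case: (j == k).
Qed.

Lemma Meas2_Meas d (S : measurableType d) (F : S -> (nat -> R) -> \bar R) s :
  Meas2 F -> Meas (F s).
Proof. by move=> mF d' S' v mv; apply: (mF _ _ (fun=> s)). Qed.

Lemma Meas_upd1 F k t : Meas F -> Meas (fun v => F (upd v k t)).
Proof. by move=> /Meas_upd mF; exact: (Meas2_Meas t (mF k)). Qed.

Lemma iintD k F G : (forall v, 0 <= F v) -> (forall v, 0 <= G v) ->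
  Meas F -> Meas G -> iint k (fun v => F v + G v) = iint k F + iint k G.
Proof.
elim: k F G => [|k IH] F G F0 G0 mF mG //=.
rewrite -ge0_integralD //.
- by apply: eq_integral => t _; rewrite IH //; apply: Meas_upd1.
- by move=> t _; apply: iint_ge0.
- by apply: measurable_iint => //; apply: Meas_upd.
- by move=> t _; apply: iint_ge0.
- by apply: measurable_iint => //; apply: Meas_upd.
Qed.

Lemma iintZ k c F : (0 <= c)%R -> (forall v, 0 <= F v) -> Meas F ->
  iint k (fun v => c%:E * F v) = c%:E * iint k F.
Proof.
move=> c0; elim: k F => [|k IH] F F0 mF //=.
rewrite -ge0_integralZl_EFin //.
- by apply: eq_integral => t _; rewrite IH //; apply: Meas_upd1.
- by move=> t _; apply: iint_ge0.
- by apply: measurable_iint => //; apply: Meas_upd.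
Qed.

Lemma iint_integral_swap k (F : R -> (nat -> R) -> \bar R) :
  (forall t v, 0 <= F t v) -> Meas2 F ->
  \int[mu]_t iint k (F t) = iint k (fun v => \int[mu]_t F t v).
Proof.
elim: k F => [|k IH] F F0 mF //=.
rewrite (@fubini_tonelli _ _ (measurableTypeR R) (measurableTypeR R) R mu mu
  (fun p => iint k (fun v => F p.1 (upd v k p.2)))).
- apply: eq_integral => u _ /=; rewrite IH // => d S p v mp mv.
  apply: (mF _ _ p (fun j s => if j == k then u else v j s)) => //.
  by move=> j; case: (j == k).
- by apply: measurable_iint => //; apply: Meas2_upd.
- by move=> p; apply: iint_ge0.
Qed.

Lemma MeasP1 (F : (nat -> R) -> (nat -> R) -> \bar R) v : MeasP F -> Meas (F v).
Proof. by move=> mF d S w mw; apply: (mF _ _ (fun j _ => v j)). Qed.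

Lemma MeasP_iint k (F : (nat -> R) -> (nat -> R) -> \bar R) : (forall v w, 0 <= F v w) -> MeasP F ->
  Meas (fun v => iint k (F v)).
Proof.
move=> F0 mF d S v mv.
apply: (measurable_iint k (F := fun s w => F (fun j => v j s) w)) => //.
move=> d' S' p w mp mw; apply: (mF _ _ (fun j s => v j (p s)) w) => //.
by move=> j; apply: measurableT_comp.
Qed.

Lemma iint_swap k l (F : (nat -> R) -> (nat -> R) -> \bar R) : (forall v w, 0 <= F v w) -> MeasP F ->
  iint k (fun v => iint l (F v)) = iint l (fun w => iint k (F^~ w)).
Proof.
elim: k F => [|k IH] F F0 mF //=.
rewrite -iint_integral_swap.
- apply: eq_integral => t _; rewrite (IH (fun v => F (upd v k t))) //.
  move=> d S v w mv mw.
  apply: (mF _ _ (fun j s => if j == k then t else v j s) w) => //.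
  by move=> j; case: (j == k).
- by move=> t v; apply: iint_ge0.
- move=> d S p w mp mw.
  apply: (measurable_iint k (F := fun s v => F (upd v k (p s)) (fun j => w j s))) => //.
  move=> d' S' p' v mp' mv.
  apply: (mF _ _ (fun j s => if j == k then p (p' s) else v j s) (fun j s => w j (p' s))).
    by move=> j; case: (j == k) => //; apply: measurableT_comp.
  by move=> j; apply: measurableT_comp.
Qed.

Definition affine_upto (k : nat) (c : nat -> R) (s : R) (v : nat -> R) : nat -> R :=
  fun j => if (j < k)%N then (c j + s * v j)%R else v j.

Lemma Meas_affine k c s F : Meas F -> Meas (F \o affine_upto k c s).
Proof.
move=> mF d S v mv.
apply: (mF _ _ (fun j x => if (j < k)%N then (c j + s * v j x)%R else v j x)) => j.
case: (_ < _)%N => //; apply: measurable_funD => //; exact: measurable_funM.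
Qed.

Lemma iint_affine k c s F : (0 < s)%R -> (forall v, 0 <= F v) -> Meas F ->
  iint k F = (s ^+ k)%:E * iint k (F \o affine_upto k c s).
Proof.
move=> s0; elim: k F => [|k IH] F F0 mF /=.
  by rewrite expr0 mul1e; congr F; apply/funext => j.
rewrite (@ge0_integral_affine (c k) s) //; last 2 first.
- by apply: measurable_iint => //; apply: Meas_upd.
- by move=> t; apply: iint_ge0.
have e t : F \o affine_upto k.+1 c s \o (fun v => upd v k t)
    = (fun v => F (upd v k (c k + s * t)%R)) \o affine_upto k c s.
  apply/funext => v /=; congr F; apply/funext => j; rewrite /affine_upto /upd.
  by rewrite ltnS leq_eqVlt; case: eqVneq => [->|] //=.
have mT t : Meas (fun v => F (upd v k t)) by apply: Meas_upd1.
transitivity (s%:E * \int[mu]_t ((s ^+ k)%:E *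
    iint k (F \o affine_upto k.+1 c s \o (fun v => upd v k t)))).
  congr (_ * _); apply: eq_integral => t _; rewrite e -IH //.
rewrite ge0_integralZl_EFin ?exprn_ge0 ?ltW //; last 2 first.
- by move=> t _; apply: iint_ge0 => v; apply: F0.
- apply: (measurable_iint k (F := fun t v => F (affine_upto k.+1 c s (upd v k t)))) => //.
  exact: (Meas_upd k (Meas_affine k.+1 c s mF)).
by rewrite muleA -EFinM -exprS.
Qed.

Definition inbox (k : nat) (v : nat -> R) : bool := [forall j : 'I_k, (`|v j| <= 1)%R].

Lemma inboxS k v t : inbox k.+1 (upd v k t) = inbox k v && (`|t| <= 1)%R.
Proof.
apply/forallP/andP => [H|[/forallP H ht] j].
  split; last by have := H ord_max; rewrite /upd eqxx.
  apply/forallP => j; have := H (widen_ord (leqnSn k) j).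
  by rewrite /upd /= ltn_eqF.
rewrite /upd; case: eqVneq => // jk.
have jk' : (j < k)%N by rewrite ltn_neqAle jk -ltnS ltn_ord.
exact: (H (Ordinal jk')).
Qed.

Lemma iint_inbox k c : (0 <= c)%R ->
  iint k (fun v => if inbox k v then c%:E else 0) = (c * 2 ^+ k)%:E.
Proof.
elim: k c => [|k IH] c c0 /=.
  by rewrite expr0 mulr1; case: ifP => // /negP[]; apply/forallP => -[].
pose A := [set` `[(-1)%R, 1%R : R]].
have h t : iint k (fun v => if inbox k.+1 (upd v k t) then c%:E else 0)
   = (c * 2 ^+ k)%:E * (\1_A t)%:E.
  under [in LHS]eq_fun do rewrite inboxS.
  rewrite indicE /A /= [_ \in _]asboolb in_itv /= -ler_norml.
  case: (`|t| <= 1)%R; first by rewrite mule1 -IH //; under eq_fun do rewrite andbT.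
  by rewrite mule0 -[RHS](iint0 k); congr iint; apply/funext => v; rewrite andbF.
under eq_integral do rewrite h.
rewrite ge0_integralZl_EFin ?mulr_ge0 ?exprn_ge0 //; last first.
  by apply/measurable_EFinP; apply: measurable_indic; exact: measurable_itv.
rewrite integral_indic ?setIT //; last exact: measurable_itv.
rewrite -[X in _ * X]/(mu A) /A lebesgue_measure_itv /= lte_fin ifT ?(lt_trans (ltrN10 R)) //.
by rewrite -EFinB -EFinM opprK exprS; congr EFin; ring.
Qed.

Lemma measurable_forall d (S : measurableType d) k (b : 'I_k -> S -> bool) :
  (forall j, measurable_fun setT (b j)) ->
  measurable_fun setT (fun s => [forall j, b j s]).
Proof.
move=> mb.
have -> : (fun s => [forall j, b j s]) = (fun s => \big[andb/true]_(j < k) b j s).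
  apply/funext => s; rewrite big_all.
  by apply/forallP/allP => [H j _|H j]; [exact: H | apply: H; rewrite mem_index_enum].
elim: (index_enum _) => [|j l IH].
  by under eq_fun do rewrite big_nil; exact: measurable_cst.
by under eq_fun do rewrite big_cons; exact: measurable_and.
Qed.

Lemma measurable_inbox d (S : measurableType d) k (v : nat -> S -> R) :
  (forall j, measurable_fun setT (v j)) ->
  measurable_fun setT (fun s => inbox k (fun j => v j s)).
Proof.
move=> mv; apply: (measurable_forall (b := fun j s => (`|v j s| <= 1)%R)) => j.
by apply: measurable_fun_ler => //; exact: measurableT_comp.
Qed.

Lemma Meas_inbox k F : Meas F -> Meas (fun v => if inbox k v then F v else 0).
Proof.
move=> mF d S v mv; apply: measurable_fun_ifT => //; last exact: mF.
exact: measurable_inbox.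
Qed.

End IteratedIntegral.

(** * Measurability for row vectors given by their coordinates *)

Section BorelRows.
Variables (R : realType) (n : nat).
Local Notation V := 'rV[R]_n.

Definition measurable_rows d (S : measurableType d) (u : S -> V) :=
  forall i, measurable_fun setT (fun s => u s 0 i).

Lemma norm_coord (v : V) i : `|v 0 i| <= `|v|.
Proof.
by rewrite [leRHS]/Num.norm /= mx_normrE; apply/bigmax_geP; right; exists (0, i).
Qed.

Lemma norm_rV_le (v : V) r : 0 <= r -> (forall i, `|v 0 i| <= r) -> `|v| <= r.
Proof.
move=> r0 vr; rewrite [leLHS]/Num.norm /= mx_normrE; apply/bigmax_leP.
by split=> // -[i j] _ /=; rewrite (ord1 i).
Qed.

Lemma norm_rV_lt (v : V) r : 0 < r -> (forall i, `|v 0 i| < r) -> `|v| < r.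
Proof.
move=> r0 vr; rewrite [ltLHS]/Num.norm /= mx_normrE; apply/bigmax_ltP.
by split=> // -[i j] _ /=; rewrite (ord1 i).
Qed.

(** An open set is the union of the countably many rational boxes that it contains, and the preimage
    of a box is described by coordinates. *)
Lemma measurable_preimage_open d (S : measurableType d) (u : S -> V) (U : set V) :
  measurable_rows u -> open U -> measurable (u @^-1` U).
Proof.
move=> mu oU.
pose box (q : 'rV[rat]_n * rat) : set V :=
  [set x | [forall i, `|x 0 i - ratr (q.1 0 i)| < ratr q.2]].
pose F (q : 'rV[rat]_n * rat) : set S :=
  if `[< box q `<=` U >] then u @^-1` box q else set0.
have -> : u @^-1` U = \bigcup_q F q.
  apply/seteqP; split => s /=; last first.
    by move=> [q _]; rewrite /F; case: asboolP => // qU /qU.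
  move=> Us; move: oU; rewrite openE => /(_ _ Us) /nbhs_ballP[e /= e0 eU].
  have e2 : 0 < e / 2 by rewrite divr_gt0.
  have [e' e'e] := rat_in_itvoo e2; move: e'e; rewrite in_itv /= => /andP[e'0 e'e].
  (* The box with centre q and radius e' contains [u s], and its points are within 2 e' < e of
     [u s]. *)
  have hq i : exists q : rat, `|u s 0 i - ratr q| < ratr e'.
    have : u s 0 i - ratr e' < u s 0 i + ratr e' by rewrite ltrD2l gtrN.
    move=> /rat_in_itvoo[q]; rewrite in_itv /= => /andP[q1 q2]; exists q.
    by rewrite ltr_norml; apply/andP; split; lra.
  have [q qP] := choice hq.
  exists (\row_i q i, e') => //; rewrite /F ifT /=; last first.
    apply/asboolP => y /forallP /= yq; apply: eU; rewrite -ball_normE /=.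
    apply: norm_rV_lt => // i; rewrite !mxE.
    have h1 := qP i; have h2 := yq i; rewrite mxE in h2.
    rewrite -(subrK (ratr (q i)) (u s 0 i)) -addrA.
    apply: le_lt_trans (ler_normD _ _) _.
    rewrite distrC in h2; lra.
  by apply/forallP => i /=; rewrite mxE.
apply: countable_bigcupT_measurable => [|q]; first exact: countableP.
rewrite /F.
case: ifP => _; last exact: measurable0.
have mb : measurable_fun setT (fun s => [forall i, `|u s 0 i - ratr (q.1 0 i)| < ratr q.2]).
  apply: (measurable_forall (b := fun i s => `|u s 0 i - ratr (q.1 0 i)| < ratr q.2)) => i.
  apply: measurable_fun_ltr => //; apply: measurableT_comp => //.
  exact: measurable_funB.
rewrite -[X in measurable X]setTI.
exact: (mb measurableT [set true]).
Qed.

(** The set where the extension exceeds x is an open part of U, together with the complement of U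
    when x < 0. *)
Lemma measurable_extend0 d (S : measurableType d) (u : S -> V) (U : set V) (phi : V -> R) :
  measurable_rows u -> open U -> (forall x, U x -> {for x, continuous phi}) ->
  measurable_fun setT (fun s => if `[< U (u s) >] then phi (u s) else 0).
Proof.
move=> mu oU cphi.
apply: (measurability _ (RGenOInfty.measurableE R)) => /= _ [_ [x ->] <-].
rewrite setTI.
pose Ux := [set y | U y /\ x < phi y].
have oUx : open Ux.
  rewrite openE => y [Uy xy]; apply: filterI.
    by move: oU; rewrite openE => /(_ _ Uy).
  exact: (cvgr_gt (phi y) (cphi _ Uy)).
have -> : (fun s => if `[< U (u s) >] then phi (u s) else 0) @^-1` `]x, +oo[%classic
   = u @^-1` Ux `|` (if x < 0 then ~` (u @^-1` U) else set0).
  apply/seteqP; split => s /=; rewrite in_itv /= andbT.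
    case: asboolP => Us xs; first by left.
    by right; rewrite xs.
  case=> [[Us xs]|]; first by rewrite asboolT.
  by case: ifP => // x0 Us; rewrite asboolF.
apply: measurableU; first exact: measurable_preimage_open.
by case: ifP => _ //; apply/measurableC/measurable_preimage_open.
Qed.

End BorelRows.

(** * Averages over the cube *)

Section Average.
Variables (R : realType) (n : nat).
Local Notation V := 'rV[R]_n.
Local Open Scope ereal_scope.
Implicit Types g : V -> \bar R.

Definition row_of (v : nat -> R) : V := \row_(i < n) v i.

(* The average over the unit ball of the sup norm. *)
Definition Av g : \bar R :=
  (2 ^- n)%:E * iint n (fun v => if inbox n v then g (row_of v) else 0).

Definition borel g := Meas (fun v => g (row_of v)).
Definition borel2 (g : V -> V -> \bar R) := MeasP (fun v w => g (row_of v) (row_of w)).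

Let c0 : (0 <= 2 ^- n :> R)%R. Proof. by rewrite invr_ge0 exprn_ge0. Qed.

Lemma norm_row_of v : inbox n v -> (`|row_of v| <= 1)%R.
Proof. by move=> /forallP vb; apply: norm_rV_le => // i; rewrite mxE. Qed.

Lemma le_Av g g' : (forall u, (`|u| <= 1)%R -> 0 <= g u) ->
  (forall u, (`|u| <= 1)%R -> g u <= g' u) -> Av g <= Av g'.
Proof.
move=> g0 gg'; apply: lee_wpmul2l; first by rewrite lee_fin.
apply: le_iint => v; case: ifP => // /norm_row_of hv; first exact: g0.
exact: gg'.
Qed.

Lemma AvD g g' : (forall u, 0 <= g u) -> (forall u, 0 <= g' u) ->
  borel g -> borel g' -> Av (fun u => g u + g' u) = Av g + Av g'.
Proof.
move=> g0 g'0 mg mg'; rewrite /Av -ge0_muleDr; last 2 first.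
- by apply: iint_ge0 => v; case: ifP.
- by apply: iint_ge0 => v; case: ifP.
rewrite -iintD; first last.
- exact: Meas_inbox.
- exact: Meas_inbox.
- by move=> v; case: ifP.
- by move=> v; case: ifP.
by congr (_ * iint _ _); apply/funext => v; case: ifP => //; rewrite adde0.
Qed.

Lemma AvZ (c : R) g : (0 <= c)%R -> (forall u, 0 <= g u) -> borel g ->
  Av (fun u => c%:E * g u) = c%:E * Av g.
Proof.
move=> c0' g0 mg; rewrite /Av [RHS]muleCA -(@iintZ _ _ c) //; last 2 first.
- by move=> v; case: ifP.
- exact: Meas_inbox.
by congr (_ * iint _ _); apply/funext => v; case: ifP => //; rewrite mule0.
Qed.

Lemma Av_cst (c : R) : (0 <= c)%R -> Av (fun=> c%:E) = c%:E.
Proof.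
move=> c0'; rewrite /Av iint_inbox // -EFinM mulrCA mulVf ?mulr1 //.
Qed.

Lemma borel_sum (I : Type) (r : seq I) (P : pred I) (G : I -> V -> \bar R) :
  (forall i, borel (G i)) -> borel (fun u => \sum_(i <- r | P i) G i u).
Proof.
move=> mG d S v mv; rewrite /=.
elim: r => [|i r IH]; first by under eq_fun do rewrite big_nil; exact: measurable_cst.
under eq_fun do rewrite big_cons; case: (P i) => //.
by apply: emeasurable_funD => //; apply: mG.
Qed.

Lemma Av_sum (I : Type) (r : seq I) (P : pred I) (c : I -> R) (G : I -> V -> \bar R) :
  (forall i, (0 <= c i)%R) -> (forall i u, 0 <= G i u) -> (forall i, borel (G i)) ->
  Av (fun u => \sum_(i <- r | P i) (c i)%:E * G i u)
  = \sum_(i <- r | P i) (c i)%:E * Av (G i).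
Proof.
move=> cge0 G0 mG.
have mZ i : borel (fun u => (c i)%:E * G i u).
  move=> d S v mv; apply: emeasurable_funM => //; exact: mG.
have Z0 i u : 0 <= (c i)%:E * G i u by rewrite mule_ge0 ?lee_fin.
elim: r => [|i r IH].
  by rewrite big_nil -[RHS](Av_cst (lexx 0%R)); congr Av; apply/funext => u; rewrite big_nil.
rewrite big_cons -IH.
case: ifP => Pi.
  rewrite -AvZ // -AvD //; last 2 first.
  - by move=> u; apply: sume_ge0.
  - by apply: borel_sum.
  by congr Av; apply/funext => u; rewrite big_cons Pi.
by congr Av; apply/funext => u; rewrite big_cons Pi.
Qed.

Lemma Av_swap (g : V -> V -> \bar R) : (forall u w, 0 <= g u w) -> borel2 g ->
  Av (fun u => Av (g u)) = Av (fun w => Av (g^~ w)).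
Proof.
move=> g0 mg.
pose G (v w : nat -> R) := if inbox n v && inbox n w then g (row_of v) (row_of w) else 0.
have G0 v w : 0 <= G v w by rewrite /G; case: ifP.
have mG : MeasP G.
  move=> d S v w mv mw.
  apply: measurable_fun_ifT => //; last exact: mg.
  by apply: measurable_and; apply: measurable_inbox.
(* Brings the inner normalization and both cube conditions into the form required by [iint_swap]. *)
have key (H : (nat -> R) -> (nat -> R) -> \bar R) :
    (forall v w, 0 <= H v w) -> MeasP H ->
    iint n (fun v => if inbox n v then (2 ^- n)%:E *
      iint n (fun w => if inbox n w then H v w else 0) else 0)
    = (2 ^- n)%:E * iint n (fun v => iint n (fun w =>
        if inbox n v && inbox n w then H v w else 0)).
  move=> H0 mH; rewrite -iintZ //; last 2 first.
  - by move=> v; apply: iint_ge0 => w; case: ifP.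
  - apply: (@MeasP_iint R n (fun v w => if inbox n v && inbox n w then H v w else 0)).
      by move=> v w; case: ifP.
    move=> d S v w mv mw.
    apply: measurable_fun_ifT => //; last exact: mH.
    by apply: measurable_and; apply: measurable_inbox.
  congr iint; apply/funext => v; case: ifP => _ //=.
  by rewrite iint0 mule0.
rewrite /Av (key (fun v w => g (row_of v) (row_of w))) //.
rewrite (key (fun w v => g (row_of v) (row_of w))) //; last first.
  by move=> d S w v mw mv; apply: mg.
congr (_ * (_ * _)); rewrite (iint_swap n n G0 mG); congr iint; apply/funext => w.
by congr iint; apply/funext => v; rewrite /G andbC.
Qed.

Lemma Av_ge0 g : (forall u, (`|u| <= 1)%R -> 0 <= g u) -> 0 <= Av g.
Proof.
by move=> g0; apply: le_trans (le_Av (g := fun=> 0%R%:E) _ g0); rewrite // Av_cst.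
Qed.

Lemma borelZ (c : R) g : borel g -> borel (fun u => c%:E * g u).
Proof. by move=> mg d S v mv; apply: emeasurable_funM => //; exact: mg. Qed.

Lemma borelD g g' : borel g -> borel g' -> borel (fun u => g u + g' u).
Proof.
by move=> mg mg' d S v mv; apply: emeasurable_funD; [exact: mg | exact: mg'].
Qed.

Lemma borel_Av (g : V -> V -> \bar R) : (forall u w, 0 <= g u w) -> borel2 g ->
  borel (fun u => Av (g u)).
Proof.
move=> g0 mg d S v mv; apply: emeasurable_funM => //.
apply: (@MeasP_iint R n (fun v w => if inbox n w then g (row_of v) (row_of w) else 0)) => //.
  by move=> v' w; case: ifP.
move=> d' S' v' w' mv' mw'; apply: measurable_fun_ifT => //; last exact: mg.
exact: measurable_inbox.
Qed.

End Average.

(** * From averages to pointwise bounds *)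

Section PointwiseFromAverages.
Variables (R : realType) (n r : nat).
Local Notation V := 'rV[R]_n.
Local Notation W := 'rV[R]_2.

(** Being a sum over coordinates, it is measurable term by term, and it exceeds the sup norm by a
    factor of at most 2. *)
Definition norm1 (w : W) : R := \sum_j `|w 0 j|.

Lemma norm1_ge0 w : 0 <= norm1 w. Proof. by apply: sumr_ge0. Qed.

Lemma norm1D a b : norm1 (a + b) <= norm1 a + norm1 b.
Proof. by rewrite -big_split; apply: ler_sum => j _; rewrite mxE ler_normD. Qed.

Lemma norm1Z c a : norm1 (c *: a) = `|c| * norm1 a.
Proof. by rewrite mulr_sumr; apply: eq_bigr => j _; rewrite mxE normrM. Qed.

Lemma norm1N a : norm1 (- a) = norm1 a.
Proof. by rewrite -scaleN1r norm1Z normrN1 mul1r. Qed.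

Lemma norm1_0 : norm1 0 = 0.
Proof. by rewrite -(scale0r 0) norm1Z normr0 mul0r. Qed.

Lemma norm1_sum k (c : 'I_k -> R) (w : 'I_k -> W) :
  norm1 (\sum_i c i *: w i) <= \sum_i `|c i| * norm1 (w i).
Proof.
elim/big_ind2 : _ => [|a b a' b' h h'|i _]; first by rewrite norm1_0.
  by apply: le_trans (norm1D _ _) _; exact: lerD.
by rewrite norm1Z.
Qed.

Lemma norm_le_norm1 w : `|w| <= norm1 w.
Proof.
apply: norm_rV_le (norm1_ge0 w) _ => j.
by rewrite /norm1 (bigD1 j) //= lerDl sumr_ge0.
Qed.

Lemma norm1_le_norm w : norm1 w <= 2 * `|w|.
Proof.
apply: (@le_trans _ _ (\sum_(j < 2) `|w|)).
  by apply: ler_sum => j _; exact: norm_coord.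
by rewrite sumr_const card_ord mulr_natl.
Qed.

Variable ft : V -> W.
Hypothesis mft : forall d (S : measurableType d) (u : S -> V), measurable_rows u ->
  forall j, measurable_fun setT (fun s => ft (u s) 0 j).

Definition osc (h w : V) : R := norm1 (Dl (nseq r h) ft w).

Lemma osc_ge0 h w : 0 <= osc h w. Proof. exact: norm1_ge0. Qed.

Lemma measurable_rows_affine d (S : measurableType d) (h w : S -> V) (c : R) :
  measurable_rows h -> measurable_rows w -> measurable_rows (fun s => w s + c *: h s).
Proof.
move=> mh mw i; under eq_fun do rewrite !mxE.
by apply: measurable_funD => //; apply: measurable_funM.
Qed.

Lemma measurable_osc d (S : measurableType d) (h w : S -> V) :
  measurable_rows h -> measurable_rows w ->
  measurable_fun setT (fun s => osc (h s) (w s)).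
Proof.
move=> mh mw; apply: measurable_sum => j; apply: measurableT_comp => //.
under eq_fun do rewrite Dl_nseq summxE.
apply: measurable_sum => k; under eq_fun do rewrite mxE.
by apply: measurable_funM => //; apply: mft; apply: measurable_rows_affine.
Qed.

Lemma measurable_rows_row_of d (S : measurableType d) (v : nat -> S -> R) :
  (forall j, measurable_fun setT (v j)) -> measurable_rows (fun s => row_of n (fun j => v j s)).
Proof. by move=> mv i; under eq_fun do rewrite mxE; exact: mv. Qed.

Lemma measurable_rows_cst d (S : measurableType d) (x : V) :
  measurable_rows (fun _ : S => x).
Proof. by move=> i. Qed.

Lemma norm_altbin k : `|altbin R r k| = 'C(r, k)%:R.
Proof. by rewrite normrM normrX normrN1 expr1n mul1r normr_nat. Qed.

(* Both sides of [e] are the double alternating sum of [ft] over the points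
   [z + j u + k u']. *)
Lemma osc_compare u u' z :
  osc u z <= osc u' z + \sum_(k < r) 'C(r, k.+1)%:R * osc u (z + k.+1%:R *: u')
    + \sum_(j < r) 'C(r, j.+1)%:R * osc u' (z + j.+1%:R *: u).
Proof.
pose T h w := Dl (nseq r h) ft w; pose a := altbin R r.
have e : \sum_(k < r.+1) a k *: T u (z + k%:R *: u')
       = \sum_(j < r.+1) a j *: T u' (z + j%:R *: u).
  rewrite /T; under eq_bigr do rewrite Dl_nseq scaler_sumr.
  rewrite exchange_big /=; apply: eq_bigr => j _.
  rewrite Dl_nseq scaler_sumr; apply: eq_bigr => k _.
  by rewrite !scalerA mulrC addrAC.
rewrite !big_ord_recl !scale0r !addr0 in e.
set A := \sum_(k < r) _ in e; set B := \sum_(j < r) _ in e.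
have a0 : `|a 0| = 1 by rewrite norm_altbin bin0.
have e2 : a 0 *: T u z = a 0 *: T u' z + B - A by rewrite -e addrK.
rewrite -[leLHS]mul1r -{1}a0 -norm1Z e2.
apply: le_trans (norm1D _ _) _; rewrite norm1N addrAC; apply: lerD; last first.
  by apply: le_trans (norm1_sum _ _) _; apply: ler_sum => k _; rewrite /a norm_altbin.
apply: le_trans (norm1D _ _) _; rewrite norm1Z a0 mul1r; apply: lerD => //.
by apply: le_trans (norm1_sum _ _) _; apply: ler_sum => k _; rewrite /a norm_altbin.
Qed.

Lemma sum_bin_le (x : R) (g : 'I_r -> R) : 0 <= x -> (forall k, g k <= x) ->
  \sum_(k < r) 'C(r, k.+1)%:R * g k <= 2 ^+ r * x.
Proof.
move=> x0 gx; apply: (@le_trans _ _ (\sum_(k < r) 'C(r, k.+1)%:R * x)).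
  by apply: ler_sum => k _; rewrite ler_wpM2l.
rewrite -mulr_suml ler_wpM2r // -natr_sum -natrX ler_nat.
have := expnDn 1 1 r; rewrite addnn -mul2n muln1 big_ord_recl /= => ->.
by apply: leq_trans (leq_addl _ _); apply: leq_sum => k _; rewrite !exp1n !muln1.
Qed.

Local Open Scope ereal_scope.

Lemma borel_osc_step (h w : V) (b : R) :
  borel (fun u : V => (osc h (w + b *: u)%R)%:E).
Proof.
move=> d S v mv; apply/measurable_EFinP; apply: measurable_osc; first exact: measurable_rows_cst.
by apply: measurable_rows_affine; [exact: measurable_rows_row_of | exact: measurable_rows_cst].
Qed.

Lemma borel2_osc (z : V) (a b : R) :
  borel2 (fun u u' : V => (osc (a *: u')%R (z + b *: u)%R)%:E).
Proof.
move=> d S v w mv mw; apply/measurable_EFinP; apply: measurable_osc.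
  have := measurable_rows_affine a (measurable_rows_row_of mw) (measurable_rows_cst 0%R).
  by under eq_fun do rewrite add0r.
by apply: measurable_rows_affine; [exact: measurable_rows_row_of | exact: measurable_rows_cst].
Qed.

Lemma borel_osc_dir (z : V) (a : R) : borel (fun u : V => (osc (a *: u)%R z)%:E).
Proof.
move=> d S v mv; have := MeasP1 (fun=> 0%R) (borel2_osc z a 0) mv.
by under eq_fun do rewrite scale0r addr0.
Qed.

Lemma sum_bin_leE (x : R) (G : 'I_r -> \bar R) : (0 <= x)%R -> (forall k, G k <= x%:E) ->
  \sum_(k < r) 'C(r, k.+1)%:R%:E * G k <= (2 ^+ r * x)%:E.
Proof.
move=> x0 Gx; apply: (@le_trans _ _ (\sum_(k < r) ('C(r, k.+1)%:R * x)%:E)).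
  by apply: lee_sum => k _; rewrite EFinM; apply: lee_wpmul2l; rewrite ?lee_fin.
by rewrite sumEFin lee_fin; apply: (@sum_bin_le x (fun=> x)).
Qed.

Section Telescope.
Variables (z : V) (s B theta : R).
Hypotheses (s0 : (0 < s)%R) (B0 : (0 <= B)%R) (th0 : (0 <= theta < 1)%R).
Let si i := (s / 2 ^+ i)%R.
Hypothesis cft : forall z', (`|z' - z| <= r%:R * s)%R -> {for z', continuous ft}.
Hypothesis avB : forall z' i h sig, (`|z' - z| <= r%:R * s)%R -> (`|h| <= si i)%R ->
  (si i.+1 <= sig <= r%:R * si i)%R ->
  Av (fun v => (osc h (z' + sig *: v)%R)%:E) <= (B * theta ^+ i)%:E.

(** Here the step is averaged and the base point is fixed, while [avB] averages the base point with
    the step fixed. *)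
Let F z' i := Av (fun u => (osc (si i *: u)%R z')%:E).
Let si0 i : (0 < si i)%R. Proof. by rewrite divr_gt0 ?exprn_gt0. Qed.
Let siS i : (si i.+1 = si i / 2)%R.
Proof. by rewrite /si exprSr invfM mulrA. Qed.

Let sig_range i (k : 'I_r) : (si i.+1 <= k.+1%:R * si i.+1 <= r%:R * si i)%R
  /\ (si i.+1 <= k.+1%:R * si i <= r%:R * si i)%R.
Proof.
have h1 : (1 <= k.+1%:R :> R)%R by rewrite ler1n.
have h2 : (k.+1%:R <= r%:R :> R)%R by rewrite ler_nat.
have := si0 i; have : (si i.+1 <= si i)%R by rewrite siS; have := si0 i; lra.
have := si0 i.+1; move: (si i.+1) (si i) => a b a0 ab b0; split; apply/andP; split; nra.
Qed.

Let Bi0 i : (0 <= B * theta ^+ i)%R.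
Proof. by case/andP: th0 => t0 _; rewrite mulr_ge0 ?exprn_ge0. Qed.

Let F0 z' i : 0 <= F z' i.
Proof. by apply: Av_ge0 => u _; rewrite lee_fin osc_ge0. Qed.

(** Take [osc_compare] with u of scale [si i] and u' of scale [si i.+1], and average over both. In
    each cross term one of the two vectors is the step and the other displaces the base point, so
    that [avB] applies. *)
Lemma avg_step z' i : (`|z' - z| <= r%:R * s)%R ->
  F z' i <= F z' i.+1 + (2 ^+ r.+1 * (B * theta ^+ i))%:E.
Proof.
move=> hz'.
pose G1 u := \sum_(k < r) 'C(r, k.+1)%:R%:E *
  Av (fun u' => (osc (si i *: u)%R (z' + (k.+1%:R * si i.+1) *: u')%R)%:E).
pose g2 (j : 'I_r) (u u' : V) := (osc (si i.+1 *: u')%R (z' + (j.+1%:R * si i) *: u)%R)%:E.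
pose G2 u := \sum_(j < r) 'C(r, j.+1)%:R%:E * Av (g2 j u).
have ge0 (c : nat) x : 0 <= x -> 0 <= c%:R%:E * x :> \bar R.
  by move=> x0; rewrite mule_ge0 // lee_fin.
have g20 j u u' : 0 <= g2 j u u' by rewrite lee_fin osc_ge0.
have bg2 j : borel2 (g2 j) by exact: borel2_osc.
have bAg2 j : borel (fun u => Av (g2 j u)) by exact: borel_Av.
have Ag20 j u : 0 <= Av (g2 j u) by exact: Av_ge0.
have G20 u : 0 <= G2 u by apply: sume_ge0 => j _; exact: ge0.
have le1 u : (`|u| <= 1)%R ->
    (osc (si i *: u)%R z')%:E <= F z' i.+1 + (2 ^+ r * (B * theta ^+ i))%:E + G2 u.
  move=> hu; rewrite -[leLHS](Av_cst n) ?osc_ge0 //.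
  apply: (@le_trans _ _ (F z' i.+1 + G1 u + G2 u)); last first.
    apply: leeD => //; apply: leeD => //; apply: sum_bin_leE => // k.
    apply: avB => //; last by have [] := sig_range i k.
    by rewrite normrZ gtr0_norm // ger_pMr.
  rewrite /F /G1 /G2 -!Av_sum //; last 3 first.
  - by move=> j; exact: borel_osc_dir.
  - by move=> j u'; rewrite lee_fin osc_ge0.
  - by move=> j; exact: borel_osc_step.
  rewrite -AvD //; last 4 first.
  - by move=> u'; rewrite lee_fin osc_ge0.
  - by move=> u'; apply: sume_ge0 => k _; apply: ge0; rewrite lee_fin osc_ge0.
  - exact: borel_osc_dir.
  - by apply: borel_sum => k; apply: borelZ; exact: borel_osc_step.
  rewrite -AvD //; last 4 first.
  - by move=> u'; apply: adde_ge0; rewrite ?lee_fin ?osc_ge0 //;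
       apply: sume_ge0 => k _; apply: ge0; rewrite lee_fin osc_ge0.
  - by move=> u'; apply: sume_ge0 => k _; apply: ge0; rewrite lee_fin osc_ge0.
  - apply: borelD; first exact: borel_osc_dir.
    by apply: borel_sum => k; apply: borelZ; exact: borel_osc_step.
  - by apply: borel_sum => j; apply: borelZ; exact: borel_osc_dir.
  apply: le_Av => u' hu'; first by rewrite lee_fin osc_ge0.
  under [X in _ + X + _]eq_bigr do rewrite -EFinM.
  under [X in _ + X]eq_bigr do rewrite /g2 -EFinM.
  rewrite !sumEFin -!EFinD lee_fin.
  apply: le_trans (osc_compare (si i *: u) (si i.+1 *: u') z') _.
  rewrite le_eqVlt; apply/orP; left; apply/eqP.
  by congr (_ + _ + _)%R; apply: eq_bigr => k _; rewrite scalerA.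
(* Here the displacement is u, so the two averages are exchanged to make it the inner variable. *)
have Avg2 j : Av (fun u => Av (g2 j u)) <= (B * theta ^+ i)%:E.
  rewrite Av_swap // -[leRHS](Av_cst n) //; apply: le_Av => w hw; first exact: Av_ge0.
  apply: avB => //; last by have [] := sig_range i j.
  rewrite normrZ gtr0_norm //; apply: le_trans (ler_piMr (ltW (si0 _)) hw) _.
  by rewrite siS; have := si0 i; lra.
(* [Av_cst] takes a real constant, so an infinite average is treated apart. *)
have [Foo|Ffin] := eqVneq (F z' i.+1) +oo.
  by rewrite Foo addye // leey.
have FE : F z' i.+1 = (fine (F z' i.+1))%:E.
  by rewrite fineK // ge0_fin_numE // lt_neqAle Ffin leey.
apply: (@le_trans _ _ (Av (fun u : V => (fine (F z' i.+1) + 2 ^+ r * (B * theta ^+ i))%:E + G2 u))).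
  by apply: le_Av => u hu; [rewrite lee_fin osc_ge0 | rewrite EFinD -FE; exact: le1].
have c0 : (0 <= fine (F z' i.+1) + 2 ^+ r * (B * theta ^+ i))%R.
  by rewrite addr_ge0 ?fine_ge0 // mulr_ge0 ?exprn_ge0.
rewrite AvD // ?Av_cst //; last by apply: borel_sum => j; exact: borelZ.
rewrite EFinD -FE exprS -mulrA mulr2n mulrDl !mul1r EFinD addeA; apply: leeD => //.
by rewrite /G2 Av_sum //; exact: sum_bin_leE.
Qed.

(** The sum of the geometric series of the errors in [avg_step], divided by B. *)
Let C1 : R := (2 ^+ r.+1 / (1 - theta))%R.

Lemma avg_telescope z' i : (`|z' - z| <= r%:R * s)%R ->
  F z' 0 <= F z' i + (C1 * B * (1 - theta ^+ i))%:E.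
Proof.
case/andP: th0 => t0 t1 hz'; elim: i => [|i IH].
  by rewrite expr0 subrr mulr0 adde0.
apply: le_trans IH _; apply: le_trans (leeD (avg_step i hz') (lexx _)) _.
rewrite -addeA -EFinD; apply: leeD => //; rewrite lee_fin /C1 !exprS le_eqVlt.
apply/orP; left; apply/eqP; move: (2 ^+ r)%R (theta ^+ i)%R => p q.
by field; rewrite subr_eq0 gt_eqF.
Qed.

(** This ends the telescoping: by continuity, differences with short steps at z' are small. *)
Lemma avg_small z' (e : R) : (`|z' - z| <= r%:R * s)%R -> (0 < r)%N -> (0 < e)%R ->
  exists i, F z' i <= e%:E.
Proof.
move=> hz' r0 e0.
(* The factor 2 is the loss from [norm1] to the sup norm, and 2^r the loss in [Dl_bound]. *)
have e1 : (0 < e / (2 * 2 ^+ r))%R by rewrite divr_gt0 // mulr_gt0 // exprn_gt0.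
have /cvgrPdist_le /(_ _ e1) /nbhs_ballP[rho /= rho0 hrho] := cft hz'.
have [i hi] : exists i, (r%:R * si i < rho)%R.
  have [i /= hi] : exists i : nat, (r%:R * s / rho < i%:R)%R.
    by exists (Num.truncn (r%:R * s / rho)).+1; exact: truncnS_gt.
  exists i; rewrite /si mulrA ltr_pdivrMr ?exprn_gt0 //.
  move: hi; rewrite ltr_pdivrMr // mulrC => /lt_le_trans; apply.
  rewrite mulrC ler_pM2l // -natrX ler_nat; exact/ltnW/ltn_expl.
exists i; rewrite -[leRHS](Av_cst n (ltW e0)).
apply: le_Av => u hu; rewrite lee_fin ?osc_ge0 //.
have -> : osc (si i *: u)%R z' = norm1 (Dl (nseq r (si i *: u)%R) (fun x => ft x - ft z')%R z').
  by rewrite DlB Dl_cst ?subr0 // -size_eq0 size_nseq -lt0n.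
apply: le_trans (norm1_le_norm _) _.
have := @Dl_bound R _ _ (nseq r (si i *: u)%R) (fun x => ft x - ft z')%R z' (si i) (e / (2 * 2 ^+ r)).
rewrite size_nseq => H.
have -> : (e = 2 * (2 ^+ r * (e / (2 * 2 ^+ r))))%R.
  by field; rewrite expf_neq0.
rewrite ler_pM2l //; apply: H.
  by move=> h /nseqP[-> _]; rewrite normrZ gtr0_norm // ger_pMr.
move=> x' hx'; rewrite distrC; apply: hrho; rewrite -ball_normE /= distrC.
exact: le_lt_trans hx' hi.
Qed.

Lemma avg_bound z' : (`|z' - z| <= r%:R * s)%R -> (0 < r)%N -> F z' 0 <= (C1 * B)%:E.
Proof.
move=> hz' r0; apply/lee_addgt0Pr => e e0.
have [i Fi] := avg_small hz' r0 e0.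
apply: le_trans (avg_telescope i hz') _; rewrite addeC; apply: leeD => //.
rewrite lee_fin ler_piMr //; last by rewrite gerBl exprn_ge0 //; case/andP: th0.
case/andP: th0 => t0 t1.
by rewrite mulr_ge0 // divr_ge0 ?exprn_ge0 // subr_ge0 ltW.
Qed.

(** [osc_compare] with the given h and a random step s u. The first term and the terms based at z +
    (k+1) h are covered by [avg_bound], which is why it is stated for all points within r s of z;
    the terms based at z + (k+1) s u are covered by [avB] at scale 0. *)
Lemma osc_le_avg h : (0 < r)%N -> (`|h| <= s)%R ->
  (osc h z <= (C1 + 2 ^+ r + 2 ^+ r * C1) * B)%R.
Proof.
move=> r0 hh; have s00 : si 0 = s by rewrite /si expr0 divr1.
have hz : (`|z - z| <= r%:R * s)%R by rewrite subrr normr0 mulr_ge0 // ltW.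
have C10 : (0 <= C1 * B)%R.
  case/andP: th0 => t0 t1.
  by rewrite mulr_ge0 // divr_ge0 ?exprn_ge0 // subr_ge0 ltW.
have ge0 (c : nat) x : 0 <= x -> 0 <= c%:R%:E * x :> \bar R.
  by move=> x0; rewrite mule_ge0 // lee_fin.
rewrite -lee_fin -[leLHS](Av_cst n) ?osc_ge0 //.
pose g1 (k : 'I_r) (u : V) := (osc h (z + (k.+1%:R * s) *: u)%R)%:E.
pose g2 (k : 'I_r) (u : V) := (osc (s *: u)%R (z + k.+1%:R *: h)%R)%:E.
have g10 k u : 0 <= g1 k u by rewrite lee_fin osc_ge0.
have g20 k u : 0 <= g2 k u by rewrite lee_fin osc_ge0.
have b1 k : borel (g1 k) by exact: borel_osc_step.
have b2 k : borel (g2 k) by exact: borel_osc_dir.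
apply: (@le_trans _ _ (Av (fun u : V => (osc (s *: u)%R z)%:E
   + \sum_(k < r) 'C(r, k.+1)%:R%:E * g1 k u + \sum_(k < r) 'C(r, k.+1)%:R%:E * g2 k u))).
  apply: le_Av => u hu; first by rewrite lee_fin osc_ge0.
  rewrite /g1 /g2.
  under [X in _ + X + _]eq_bigr do rewrite -EFinM.
  under [X in _ + X]eq_bigr do rewrite -EFinM.
  rewrite !sumEFin -!EFinD lee_fin.
  apply: le_trans (osc_compare h (s *: u) z) _.
  rewrite le_eqVlt; apply/orP; left; apply/eqP.
  by congr (_ + _ + _)%R; apply: eq_bigr => k _; rewrite scalerA.
rewrite AvD; last 4 first.
- by move=> u; apply: adde_ge0; rewrite ?lee_fin ?osc_ge0 //;
     apply: sume_ge0 => k _; apply: ge0; exact: g10.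
- by move=> u; apply: sume_ge0 => k _; apply: ge0; exact: g20.
- apply: borelD; first exact: borel_osc_dir.
  by apply: borel_sum => k; apply: borelZ; exact: b1.
- by apply: borel_sum => k; exact: borelZ.
rewrite AvD; last 4 first.
- by move=> u; rewrite lee_fin osc_ge0.
- by move=> u; apply: sume_ge0 => k _; apply: ge0; exact: g10.
- exact: borel_osc_dir.
- by apply: borel_sum => k; exact: borelZ.
rewrite !Av_sum // mulrDl mulrDl -mulrA !EFinD; apply: leeD; first apply: leeD.
- by have := avg_bound hz r0; rewrite /F s00.
- apply: sum_bin_leE => // k; have := avB (i := 0) hz; rewrite expr0 mulr1 s00; apply => //.
  by have [_] := sig_range 0 k; rewrite s00.
- apply: sum_bin_leE => // k.
  have hk : (`|z + k.+1%:R *: h - z| <= r%:R * s)%R.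
    rewrite addrC addKr normrZ ger0_norm //; apply: ler_pM => //.
    by rewrite ler_nat.
  by have := avg_bound hk r0; rewrite /F s00.
Qed.

End Telescope.
End PointwiseFromAverages.

(** * Euclidean balls and the difference bound *)

Section EuclideanNorm.
Variables (R : realType) (k : nat).
Implicit Types u v w : 'rV[R]_k.

Lemma enorm_ge0 v : 0 <= enorm v. Proof. exact: sqrtr_ge0. Qed.

Lemma sum_sqr_ge0 v : 0 <= \sum_i v 0 i ^+ 2.
Proof. by apply: sumr_ge0 => i _; exact: sqr_ge0. Qed.

Lemma norm_le_enorm v : `|v| <= enorm v.
Proof.
apply: norm_rV_le (enorm_ge0 v) _ => i.
rewrite -sqrtr_sqr /enorm ler_sqrt ?sum_sqr_ge0 // (bigD1 i) //= lerDl.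
by apply: sumr_ge0 => j _; exact: sqr_ge0.
Qed.

Lemma enorm_le_norm v : enorm v <= k%:R * `|v|.
Proof.
have kv0 : 0 <= k%:R * `|v| by rewrite mulr_ge0.
rewrite -(ger0_norm kv0) -sqrtr_sqr /enorm ler_sqrt ?sqr_ge0 //.
apply: (@le_trans _ _ (\sum_(i < k) `|v| ^+ 2)).
  apply: ler_sum => i _; rewrite -real_normK ?num_real //.
  by rewrite lerXn2r ?nnegrE //; exact: norm_coord.
rewrite sumr_const card_ord -[leLHS]mulr_natl exprMn ler_wpM2r ?sqr_ge0 //.
by rewrite -natrX ler_nat; case: (k) => // k'; rewrite leq_pmulr.
Qed.

Lemma enormZ c v : enorm (c *: v) = `|c| * enorm v.
Proof.
rewrite /enorm -sqrtr_sqr -sqrtrM ?sqr_ge0 //; congr Num.sqrt.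
by rewrite mulr_sumr; apply: eq_bigr => i _; rewrite mxE exprMn.
Qed.

Lemma enormN v : enorm (- v) = enorm v.
Proof. by rewrite -scaleN1r enormZ normrN1 mul1r. Qed.

Lemma enorm0 : enorm (0 : 'rV[R]_k) = 0.
Proof. by rewrite -(scale0r 0) enormZ normr0 mul0r. Qed.

Lemma enorm_sqr v : enorm v ^+ 2 = \sum_i v 0 i ^+ 2.
Proof. by rewrite sqr_sqrtr // sum_sqr_ge0. Qed.

(** Expand the nonnegative sum of the squares (|v| u_i - |u| v_i)^2. *)
Lemma enorm_cauchy_schwarz u v : \sum_i u 0 i * v 0 i <= enorm u * enorm v.
Proof.
have [->|v0] := eqVneq v 0.
  by rewrite enorm0 mulr0 big1 // => i _; rewrite mxE mulr0.
have ev : 0 < enorm v.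
  by apply: lt_le_trans (norm_le_enorm v); rewrite normr_gt0.
have H : 0 <= \sum_i (enorm v * u 0 i - enorm u * v 0 i) ^+ 2.
  by apply: sumr_ge0 => i _; exact: sqr_ge0.
have [->|u0] := eqVneq u 0.
  by rewrite enorm0 mul0r big1 // => i _; rewrite mxE mul0r.
have eu : 0 < enorm u.
  by apply: lt_le_trans (norm_le_enorm u); rewrite normr_gt0.
have E : \sum_i (enorm v * u 0 i - enorm u * v 0 i) ^+ 2
   = 2 * (enorm u * enorm v) * (enorm u * enorm v - \sum_i u 0 i * v 0 i).
  transitivity (enorm v ^+ 2 * (\sum_i u 0 i ^+ 2) + enorm u ^+ 2 * (\sum_i v 0 i ^+ 2)
     - 2 * (enorm u * enorm v) * \sum_i u 0 i * v 0 i).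
    rewrite !mulr_sumr -big_split -sumrB /=; apply: eq_bigr => i _; ring.
  by rewrite -!enorm_sqr; ring.
by rewrite E pmulr_rge0 ?subr_ge0 // in H; rewrite mulr_gt0 // mulr_gt0.
Qed.

Lemma enormD u v : enorm (u + v) <= enorm u + enorm v.
Proof.
rewrite -(@ler_pXn2r _ 2) ?nnegrE ?addr_ge0 ?enorm_ge0 //.
have -> : (enorm u + enorm v) ^+ 2 = enorm u ^+ 2 + enorm v ^+ 2 + 2 * (enorm u * enorm v) by ring.
rewrite !enorm_sqr.
have -> : \sum_i (u + v) 0 i ^+ 2
   = \sum_i u 0 i ^+ 2 + \sum_i v 0 i ^+ 2 + 2 * \sum_i u 0 i * v 0 i.
  by rewrite mulr_sumr -!big_split /=; apply: eq_bigr => i _; rewrite mxE; ring.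
by rewrite lerD2l ler_pM2l // enorm_cauchy_schwarz.
Qed.

Lemma enorm_gt0 v : (0 < enorm v) = (v != 0).
Proof.
apply/idP/idP => [|v0].
  by apply: contraTneq => ->; rewrite enorm0 ltxx.
by apply: lt_le_trans (norm_le_enorm v); rewrite normr_gt0.
Qed.

Lemma edistC u v : edist u v = edist v u.
Proof. by rewrite /edist -enormN opprB. Qed.

Lemma edist_triangle w u v : edist u v <= edist u w + edist w v.
Proof. by rewrite /edist; apply: le_trans (enormD _ _); rewrite addrA subrK. Qed.

End EuclideanNorm.

(** * Integrals over Euclidean balls compared with averages over cubes *)

Section Volume.
Variables (R : realType) (n : nat).
Local Notation V := 'rV[R]_n.
Local Open Scope ereal_scope.

Lemma diam_eball_le (c : V) (r : R) : diam (eball c r) <= (2 * r)%:E.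
Proof.
apply: ge_ereal_sup => _ [a [b [ha [hb ->]]]]; rewrite lee_fin.
apply: le_trans (edist_triangle c _ _) _.
by move: ha hb; rewrite /eball /= [edist c b]edistC; lra.
Qed.

Lemma le_diam_eball (c h : V) (r : R) : (enorm h < r)%R -> (enorm h)%:E <= diam (eball c r).
Proof.
move=> hr; apply: ereal_sup_ubound; exists (c + h)%R, c.
rewrite /eball /edist /= subrr enorm0 addrAC subrr add0r; split => //.
by split=> //; exact: le_lt_trans (enorm_ge0 h) hr.
Qed.

Definition boxc (c : V) (s : R) (y : V) : bool := [forall i, (`|y 0 i - c 0 i| <= s)%R].

Lemma boxcP (c y : V) s : (0 <= s)%R -> boxc c s y = (`|y - c| <= s)%R.
Proof.
move=> s0; apply/forallP/idP => [H|H i].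
  by apply: norm_rV_le => // i; rewrite !mxE.
by apply: le_trans H; have := norm_coord (y - c) i; rewrite !mxE.
Qed.

Lemma borel_boxc (c : V) s (g : V -> \bar R) :
  borel g -> borel (fun y => if boxc c s y then g y else 0).
Proof.
move=> mg d S v mv; apply: measurable_fun_ifT => //; last exact: mg.
apply: (measurable_forall (b := fun i x => (`|(row_of n (fun j => v j x)) 0 i - c 0 i| <= s)%R)) => i.
apply: measurable_fun_ler => //; apply: measurableT_comp => //; apply: measurable_funB => //.
by under eq_fun do rewrite mxE; exact: mv.
Qed.

Lemma iint_box (c : V) s (g : V -> \bar R) : (0 < s)%R -> (forall y, 0 <= g y) -> borel g ->
  iint n (fun v => if boxc c s (row_of n v) then g (row_of n v) else 0)
  = ((2 * s) ^+ n)%:E * Av (fun u => g (c + s *: u)%R).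
Proof.
move=> s0 g0 mg.
pose cn (j : nat) := if insub j is Some i then c 0%R i else 0%R : R.
rewrite (iint_affine n cn s0); last 2 first.
- by move=> v; case: ifP.
- exact: borel_boxc.
rewrite /Av muleA -EFinM exprMn mulrAC mulfV ?expf_neq0 // mul1r.
congr (_ * iint _ _); apply/funext => v /=.
have -> : row_of n (affine_upto n cn s v) = (c + s *: row_of n v)%R.
  apply/rowP => i; rewrite !mxE /affine_upto ltn_ord /cn.
  by case: insubP => [j _ /val_inj ->|/negP[]]; rewrite ?ltn_ord.
congr (if _ then _ else _); apply/forallP/forallP => H i; have := H i;
  rewrite !mxE; (have -> : (c 0 i + s * v i - c 0 i = s * v i)%R by ring);
  by rewrite normrM gtr0_norm // ger_pMr.
Qed.

(** Passes from the integrand h of the ball estimate to a Borel minorant g on a cube, to which the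
    calculus of [Av] applies. *)
Lemma le_Rn_integral_on (B : set V) (g h : V -> \bar R) (c : V) (s : R) :
  (0 < s)%R -> (forall y, 0 <= g y) -> borel g -> (forall y, 0 <= h y) ->
  (forall y, (`|y - c| <= s)%R -> B y /\ g y <= h y) ->
  ((2 * s) ^+ n)%:E * Av (fun u => g (c + s *: u)%R) <= Rn_integral_on B h.
Proof.
move=> s0 g0 mg h0 gh; rewrite -iint_box //; apply: le_iint => v /=.
  by case: ifP.
have := boxcP c (row_of n v) (ltW s0); case: boxc => [hv|_]; last by case: ifP.
by have [Bv gv] := gh _ (esym hv); rewrite ifT //; apply/asboolP.
Qed.

Lemma Rn_integral_on_le (B : set V) (h : V -> \bar R) (c : V) (s k : R) :
  (0 < s)%R -> (0 <= k)%R -> (forall y, B y -> 0 <= h y <= k%:E) ->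
  (forall y, B y -> (`|y - c| <= s)%R) ->
  Rn_integral_on B h <= (k * (2 * s) ^+ n)%:E.
Proof.
move=> s0 k0 hB Bc; rewrite mulrC EFinM -[k%:E in leRHS](Av_cst n) //.
rewrite -(@iint_box c s (fun=> k%:E)) //.
apply: le_iint => v /=; case: asboolP => // Bv.
- by case/andP: (hB _ Bv).
- by rewrite boxcP ?(ltW s0) // (Bc _ Bv); case/andP: (hB _ Bv).
- by case: ifP.
Qed.

Lemma volume_eball_ge (c : V) (r : R) : (0 < n)%N -> (0 < r)%R ->
  ((r / n%:R) ^+ n)%:E <= volume (eball c r).
Proof.
move=> n0 r0; have n0' : (0 < n%:R :> R)%R by rewrite ltr0n.
(* The Euclidean norm is at most n times the sup norm, so the cube of this half-side lies within
   distance r / 2 of the centre. *)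
have s0 : (0 < r / (2 * n%:R))%R by rewrite divr_gt0 // mulr_gt0.
have := @le_Rn_integral_on (eball c r) (fun=> 1%:E) (fun=> 1%:E) c _ s0.
rewrite Av_cst // mule1 => H; rewrite /volume.
have -> : (r / n%:R = 2 * (r / (2 * n%:R)))%R by field; rewrite gt_eqF.
apply: H => // y hy; split=> //; rewrite /eball /= /edist.
apply: le_lt_trans (enorm_le_norm _) _.
apply: (@le_lt_trans _ _ (n%:R * (r / (2 * n%:R)))%R); first by rewrite ler_pM2l.
have -> : (n%:R * (r / (2 * n%:R)) = r / 2)%R by field; rewrite gt_eqF.
by lra.
Qed.

Lemma volume_eball_le (c : V) (r : R) : (0 < r)%R ->
  volume (eball c r) <= ((2 * r) ^+ n)%:E.
Proof.
move=> r0; have := @Rn_integral_on_le (eball c r) (fun=> 1%:E) c r 1%R r0.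
rewrite mul1r; apply => //; first by move=> y _; rewrite lee_fin lexx ler01.
move=> y hy; apply: le_trans (norm_le_enorm _) _; exact: ltW.
Qed.

Lemma fine_volume_eball (c : V) (r : R) : (0 < n)%N -> (0 < r)%R ->
  ((r / n%:R) ^+ n <= fine (volume (eball c r)) <= (2 * r) ^+ n)%R.
Proof.
move=> n0 r0; have := volume_eball_ge c n0 r0; have := volume_eball_le c r0.
by case: (volume _) => // v; rewrite ?lee_fin //= => -> ->.
Qed.

End Volume.

(** * Pointwise bound for pure differences *)

Section PointwiseDifferences.
Variables (R : realType) (n m : nat).
Local Notation V := 'rV[R]_n.
Local Notation W := 'rV[R]_2.

(** A real-valued substitute for a lower bound on the distance to the boundary, which can be
    infinite. *)
Definition room (E : normedModType R) (U : set E) (x : E) (r : R) : Prop :=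
  forall z, `|z - x| <= r -> U z.

Lemma room_shift (E : normedModType R) (U : set E) (x z : E) (r s : R) :
  room U x r -> `|z - x| + s <= r -> room U z s.
Proof.
move=> xr zs w wz; apply: xr; apply: le_trans (ler_distD z _ _) _.
by apply: le_trans zs; rewrite addrC lerD2l.
Qed.

Lemma room_le (E : normedModType R) (U : set E) (x : E) (r s : R) :
  room U x r -> s <= r -> room U x s.
Proof. by move=> xr sr w wz; apply: xr; exact: le_trans sr. Qed.

Lemma room_in (E : normedModType R) (U : set E) (x : E) (r : R) :
  0 <= r -> room U x r -> U x.
Proof. by move=> r0; apply; rewrite subrr normr0. Qed.

Lemma closure_eball (c : V) (r : R) :
  closure (eball c r) `<=` [set z | `|z - c| <= r].
Proof.
have cl : closed [set z : V | `|z - c| <= r].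
  rewrite (_ : [set z | _] = closed_ball_ Num.norm c r); first exact: closed_closed_ball_.
  by apply/seteqP; split => z /=; rewrite /closed_ball_ /= distrC.
rewrite [X in _ `<=` X](closure_id _).1 //; apply: closure_subset => z hz /=.
by apply: le_trans (norm_le_enorm _) _; exact: ltW.
Qed.

Lemma cc_eball (O : set V) (c : V) (r : R) : room O c r -> cc (eball c r) O.
Proof.
move=> cr; split; last by move=> z /closure_eball; exact: cr.
apply: bounded_closed_compact; last exact: closed_closure.
exists (`|c| + r); split; first exact: num_real.
move=> M hM z /closure_eball /= hz; apply: le_trans (ltW hM).
by rewrite -[z](subrK c) addrC; apply: le_trans (ler_normD _ _) _; rewrite lerD2l.
Qed.

Lemma Delta_in (l : nat) (h : V) (f : V -> W) (D : set V) (y : V) :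
  (forall k : nat, (k <= l)%N -> D (y + k%:R *: h)) ->
  Delta l h f D y = Dl (nseq l h) f y.
Proof. by move=> hD; rewrite Dl_nseq /Delta asboolT. Qed.

Lemma norm1_le_enorm (w : W) : norm1 w <= 2 * enorm w.
Proof. by apply: le_trans (norm1_le_norm _) _; rewrite ler_pM2l // norm_le_enorm. Qed.

Lemma powR_div_pow2 (t p : R) i : 0 <= t ->
  (t / 2 ^+ i) `^ p = t `^ p * (2 `^ (- p)) ^+ i.
Proof.
move=> t0; rewrite powRM // ?invr_ge0 ?exprn_ge0 //; congr (_ * _).
have -> : 2 ^- i = 2 `^ (- i%:R) :> R by rewrite powR_invn.
have -> : 2 `^ (- p) ^+ i = (2 `^ (- p)) `^ i%:R by rewrite powR_mulrn ?powR_ge0.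
by rewrite -(powRrM 2 (- i%:R) p) -(powRrM 2 (- p) i%:R) !mulNr mulrC.
Qed.

Lemma powR_half_le (a b q : R) : 0 < a -> 0 < q -> a / 2 <= b ->
  b `^ (- q) <= 2 `^ q * a `^ (- q).
Proof.
move=> a0 q0 ab.
have -> : 2 `^ q * a `^ (- q) = (a / 2) `^ (- q).
  rewrite powRM ?invr_ge0 ?(ltW a0) // mulrC; congr (_ * _).
  by rewrite -powR_inv1 // -powRrM mulN1r opprK.
have a2 : 0 < a / 2 by exact: divr_gt0.
rewrite !powRN lef_pV2 ?posrE ?powR_gt0 //; last exact: lt_le_trans ab.
by apply: ge0_ler_powR; rewrite ?nnegrE ?(ltW q0) ?(ltW a2) // (le_trans (ltW a2)).
Qed.

Variables (O : set V) (d C : R) (G : V -> V -> W).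
Hypotheses (n0 : (0 < n)%N) (d0 : 0 < d) (C1 : 1 <= C).
Hypothesis oO : open O.
Hypothesis cG : forall x y, O x -> O y -> y != x -> {for y, continuous (G x)}.
Hypothesis bG : ball_est O m d C G.

Let p := m%:R + d : R.
Let q := n%:R + d : R.
Let p0 : 0 < p. Proof. by rewrite ltr_wpDl. Qed.
Let q0 : 0 < q. Proof. by rewrite ltr_wpDl. Qed.
Let r := m.+1.

(** One step h is selected from the supremum in [ball_est]. The normalization is removed with volume
    at most (2s)^n and n (1 + p/n) = n + p; the distance is passed to the sup norm, which is
    smaller, under a negative power. *)
Lemma Rn_integral_ball_le (x c h : V) (s : R) : O x -> 0 < s -> room O c s ->
  2 * s * C <= `|x - c| -> enorm h < s ->
  (Rn_integral_on (eball c s) (fun y => (enorm (Delta m.+1 h (G x) (eball c s) y))%:E)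
   <= ((2 * s) `^ (n%:R + p) * (C * `|x - c| `^ (- q)))%:E)%E.
Proof.
move=> Ox s0 cs sx hs.
have xc0 : 0 < `|x - c|.
  apply: lt_le_trans sx; rewrite !mulr_gt0 //; exact: lt_le_trans C1.
have := bG Ox s0 (cc_eball cs).
have hd : (C%:E * diam (eball c s) <= (edist x c)%:E)%E.
  apply: (@le_trans _ _ (C%:E * (2 * s)%:E)%E).
    by apply: lee_wpmul2l; rewrite ?lee_fin ?(le_trans ler01) // diam_eball_le.
  rewrite -EFinM lee_fin mulrC; apply: le_trans sx _; exact: norm_le_enorm.
move=> /(_ hd) H.
set X := Rn_integral_on _ _.
set v := fine (volume (eball c s)) in H.
have /andP[v1 v2] := fine_volume_eball c n0 s0.
have v0 : 0 < v by apply: lt_le_trans v1; rewrite exprn_gt0 // divr_gt0 // ltr0n.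
have {H} H : (((v `^ (1 + p / n%:R))^-1)%:E * X <= (C * edist x c `^ (- q))%:E)%E.
  apply: le_trans H; apply: ereal_sup_ubound; exists h; split => //.
  exact: le_diam_eball.
rewrite lee_pdivrMl ?powR_gt0 // -EFinM in H; apply: le_trans H _.
rewrite lee_fin; apply: ler_pM.
- exact: powR_ge0.
- by rewrite mulr_ge0 ?powR_ge0 // (le_trans ler01).
- have n0' : 0 < n%:R :> R by rewrite ltr0n.
  have -> : n%:R + p = n%:R * (1 + p / n%:R) by field; rewrite gt_eqF.
  rewrite [X in _ <= X]powRrM; apply: ge0_ler_powR.
  + by rewrite addr_ge0 // divr_ge0 // ltW.
  + by rewrite nnegrE ltW.
  + by rewrite nnegrE powR_ge0.
  + by rewrite powR_mulrn // mulr_ge0 // ltW.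
- rewrite ler_wpM2l ?(le_trans ler01) // !powRN lef_pV2 ?posrE ?powR_gt0 //.
    apply: ge0_ler_powR; rewrite ?nnegrE ?enorm_ge0 ?(ltW q0) //.
    exact: norm_le_enorm.
  by apply: lt_le_trans xc0 _; exact: norm_le_enorm.
Qed.

Lemma pointwise_difference_bound :
  exists C' Lam : R, [/\ 0 < C', 0 < Lam & forall x y u t, O x -> 0 < t ->
    room O y (Lam * t) -> Lam * t <= `|x - y| -> `|u| <= t ->
    `|Dl (nseq m.+1 u) (G x) y| <= C' * `|x - y| `^ (- q) * t `^ p].
Proof.
have nR : 1 <= n%:R :> R by rewrite ler1n.
have rR : 1 <= r%:R :> R by rewrite ler1n.
have nr0 : 1 <= n%:R * r%:R :> R by rewrite -[leLHS]mulr1 ler_pM.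
(* The points w + k h occurring below are within 2 r s of z' in the sup norm, hence within 2 n r s
   in the Euclidean norm; the factor 3 leaves a strict margin, so they lie in the ball of radius
   [al] s. *)
have [al alE] : exists al : R, al = 3 * (n%:R * r%:R) by eexists.
have al0 : 0 < al by rewrite alE mulr_gt0 // (lt_le_trans ltr01).
(* Base points move by at most r t, so |x - z'| remains at least |x - y| / 2 >= r t + 2 [al] C t,
   which meets the condition C diam(B) <= |x - c| of the ball estimate. *)
pose Lam : R := 2 * r%:R + 4 * al * C.
have C0 : 0 < C := lt_le_trans ltr01 C1.
have Lam0 : 0 < Lam by rewrite addr_gt0 // !mulr_gt0 // (lt_le_trans ltr01).
(* The factor that the bound s^p gains when s is halved. *)
pose theta : R := 2 `^ (- p).
have th0 : 0 <= theta < 1.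
  rewrite powR_ge0 /theta powRN invf_lt1 ?powR_gt0 //.
  have : (1 : R) `^ p < 2 `^ p by apply: gt0_ltr_powR; rewrite ?nnegrE ?ltr1n.
  by rewrite powR1.
pose C2 : R := 2 ^+ r.+1 / (1 - theta) + 2 ^+ r + 2 ^+ r * (2 ^+ r.+1 / (1 - theta)).
pose C3 : R := 2 * (2 * al) `^ (n%:R + p) * C * 2 `^ q.
have C30 : 0 < C3 by rewrite !mulr_gt0 ?powR_gt0 // mulr_gt0.
have C20 : 0 < C2.
  have h1 : 0 < 2 ^+ r.+1 / (1 - theta).
    by rewrite divr_gt0 ?exprn_gt0 // subr_gt0; case/andP: th0.
  have h2 : 0 < 2 ^+ r :> R by exact: exprn_gt0.
  by apply: addr_gt0; [exact: addr_gt0 | exact: mulr_gt0].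
exists (C2 * C3), Lam; split => //; first exact: mulr_gt0.
move=> x y u t Ox t0 hy hxy hu.
have xy0 : 0 < `|x - y| by apply: lt_le_trans hxy; exact: mulr_gt0.
pose U := O `\ x.
have oU : open U.
  rewrite /U setDE; apply: openI => //; apply: closed_openC.
  exact: (compact_closed (@norm_hausdorff _ _) (@compact_set1 _ x)).
(* The averages need a measurable function on the whole space; it agrees with [G x] at all points
   that the differences reach. *)
pose ft z : W := if `[< U z >] then G x z else 0.
have cft z : U z -> {for z, continuous ft}.
  move=> Uz; have [Oz zx] := Uz.
  have := cG Ox Oz; rewrite (_ : z != x); last by apply/eqP.
  move=> /(_ isT) cz; have fz : ft z = G x z by rewrite /ft asboolT.
  suff : ft @ z --> ft z by [].
  rewrite fz.
  have H : \forall w \near z, G x w = ft w.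
    near=> w; rewrite /ft asboolT //; near: w.
    by move: oU; rewrite openE; apply.
  exact: cvg_trans (@near_eq_cvg _ _ (nbhs z) _ (G x) ft H) cz.
have mft d' (S : measurableType d') (w : S -> V) : measurable_rows w ->
    forall j, measurable_fun setT (fun s => ft (w s) 0 j).
  move=> mw j.
  have := @measurable_extend0 R n d' S w U (fun z => G x z 0 j) mw oU.
  have -> : (fun s => ft (w s) 0 j) = (fun s => if `[< U (w s) >] then G x (w s) 0 j else 0).
    by apply/funext => s; rewrite /ft; case: ifP => //; rewrite mxE.
  move=> H; apply: H => z [Oz zx]; have := cG Ox Oz; rewrite (_ : z != x); last by apply/eqP.
  move=> /(_ isT) cz.
  apply: (@continuous_comp _ _ _ (G x) (fun w : W => w 0 j)) => //; exact: coord_continuous.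
have alC1 : al <= al * C by rewrite ler_peMr // ltW.
have inU z : `|z - y| <= (2 * r%:R + 2 * al) * t -> U z.
  move=> hz; split.
    apply: hy; apply: le_trans hz _; rewrite ler_pM2r // lerD2l; have := al0; lra.
  move=> /= zx; move: hz; rewrite zx leNgt => /negP; apply.
  apply: lt_le_trans hxy; rewrite ltr_pM2r // ltrD2l; have := al0; lra.
have ft_eq z l h s : 0 <= s -> `|h| <= s -> `|z - y| + l%:R * s <= (2 * r%:R + 2 * al) * t ->
    Dl (nseq l h) (G x) z = Dl (nseq l h) ft z.
  move=> s0 hs hz; apply: (@eq_Dl R _ _ _ _ _ _ s); first by move=> h' /nseqP[->].
  move=> w; rewrite size_nseq => hw; rewrite /ft asboolT //; apply: inU.
  apply: le_trans hz; apply: (le_trans (ler_distD z w y)).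
  by rewrite addrC lerD2l.
have rt : r%:R * t <= (2 * r%:R + 2 * al) * t.
  by rewrite ler_pM2r //; have := al0; lra.
rewrite (@ft_eq y r u t) ?subrr ?normr0 ?add0r ?(ltW t0) //.
apply: le_trans (norm_le_norm1 _) _.
pose B := C3 * `|x - y| `^ (- q) * t `^ p.
have B0 : 0 <= B by rewrite !mulr_ge0 ?powR_ge0 // ltW.
have -> : C2 * C3 * `|x - y| `^ (- q) * t `^ p = C2 * B by rewrite /B !mulrA.
have cy z' : `|z' - y| <= r%:R * t -> {for z', continuous ft}.
  by move=> hz'; apply: cft; apply: inU; exact: le_trans rt.
apply: (@osc_le_avg R n r ft mft y t B theta t0 B0 th0 cy) => //.
move=> z' i h sig hz' hh /andP[sig1 sig2].
have [s sE] : exists s, s = t / 2 ^+ i by eexists.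
rewrite -sE in hh sig2.
have s0 : 0 < s by rewrite sE divr_gt0 ?exprn_gt0.
have st : s <= t by rewrite sE ler_pdivrMr ?exprn_gt0 // ler_peMr ?exprn_ege1 ?ler1n // ltW.
have sig1' : s / 2 <= sig by move: sig1; rewrite exprSr invfM mulrA -sE.
have sig0 : 0 < sig by apply: lt_le_trans sig1'; rewrite divr_gt0.
have hals : al * s <= al * t by rewrite ler_pM2l.
have hlam : Lam * t = 2 * (r%:R * t) + 4 * ((al * t) * C) by rewrite /Lam; ring.
have alt0 : 0 < al * t by rewrite mulr_gt0.
have alC : al * t <= (al * t) * C by rewrite ler_peMr // ltW.
have rt0 : 0 <= r%:R * t by rewrite mulr_ge0 // ltW.
have room' : room O z' (al * s).
  apply: (room_shift hy); rewrite hlam; lra.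
have hxz : `|x - y| / 2 <= `|x - z'|.
  have := ler_distD z' x y; move: hxy; rewrite hlam; lra.
have hxz2 : 2 * (al * s) * C <= `|x - z'|.
  apply: le_trans hxz; move: hxy; rewrite hlam => hxy.
  have : al * s * C <= al * t * C by rewrite ler_pM2r.
  lra.
have hen : enorm h < al * s.
  apply: le_lt_trans (enorm_le_norm _) _.
  apply: (@le_lt_trans _ _ (n%:R * s)); first by rewrite ler_wpM2l.
  rewrite ltr_pM2r // alE; have : n%:R <= n%:R * r%:R :> R by rewrite ler_peMr.
  lra.
have I1 := Rn_integral_ball_le Ox (mulr_gt0 al0 s0) room' hxz2 hen.
have inB k w : (k <= r)%N -> `|w - z'| <= sig -> eball z' (al * s) (w + k%:R *: h).
  move=> kr hw; rewrite /eball /edist /=; apply: le_lt_trans (enorm_le_norm _) _.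
  have : `|w + k%:R *: h - z'| <= 2 * (r%:R * s).
    rewrite addrAC; apply: le_trans (ler_normD _ _) _.
    rewrite normrZ ger0_norm //.
    have : k%:R * `|h| <= r%:R * s by apply: ler_pM => //; rewrite ler_nat.
    have := le_trans hw sig2; lra.
  move=> hk; apply: (@le_lt_trans _ _ (n%:R * (2 * (r%:R * s)))); first by rewrite ler_wpM2l.
  have -> : n%:R * (2 * (r%:R * s)) = (2 * (n%:R * r%:R)) * s by ring.
  by rewrite ltr_pM2r // alE; have := nr0; lra.
(* The factor 1/2 compensates [norm1] <= 2 [enorm]. *)
have I2 := @le_Rn_integral_on R n (eball z' (al * s))
   (fun w => ((1/2) * osc r ft h w)%:E)
   (fun y0 => (enorm (Delta m.+1 h (G x) (eball z' (al * s)) y0))%:E) z' sig sig0.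
have osc_b : borel (fun w => (osc r ft h w)%:E).
  rewrite (_ : (fun w => _) = (fun w => (osc r ft h (0 + 1 *: w))%:E)).
    exact: borel_osc_step.
  by apply/funext => w; rewrite add0r scale1r.
have {}I2 : (((2 * sig) ^+ n)%:E * Av (fun v => ((1/2) * osc r ft h (z' + sig *: v))%:E) <=
    ((2 * (al * s)) `^ (n%:R + p) * (C * `|x - z'| `^ (- q)))%:E)%E.
  apply: le_trans I1; apply: I2.
  - by move=> w; rewrite lee_fin mulr_ge0 // osc_ge0.
  - exact: (@borelZ R n (1 / 2) (fun w => (osc r ft h w)%:E) osc_b).
  - by move=> w; rewrite lee_fin enorm_ge0.
  move=> w hw; split.
    by have := inB 0%N w (leq0n _) hw; rewrite scale0r addr0.
  rewrite Delta_in; last by move=> k kr; exact: inB.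
  rewrite (@ft_eq w r h s) ?(ltW s0) //; last first.
    have := ler_distD z' w y; have := hw; have := sig2.
    have : r%:R * s <= r%:R * t by rewrite ler_pM2l // (lt_le_trans ltr01).
    have : r%:R * t <= al * t by rewrite ler_pM2r // alE; nra.
    rewrite mulrDl -!mulrA; lra.
  rewrite lee_fin /osc mul1r mulrC ler_pdivrMr // mulrC; exact: norm1_le_enorm.
have osc_b' : borel (fun v => (osc r ft h (z' + sig *: v))%:E) by exact: borel_osc_step.
have {}I2 : (((2 * sig) ^+ n / 2)%:E * Av (fun v => (osc r ft h (z' + sig *: v))%:E) <=
    ((2 * (al * s)) `^ (n%:R + p) * (C * `|x - z'| `^ (- q)))%:E)%E.
  apply: le_trans I2; rewrite (_ : (fun v => (1 / 2 * _)%:E)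
    = (fun v => ((1/2)%:E * (osc r ft h (z' + sig *: v))%:E)%E)) //.
  rewrite AvZ //; last by move=> w; rewrite lee_fin osc_ge0.
  rewrite [leRHS]muleA -EFinM.
  by have -> : (2 * sig) ^+ n * (1 / 2) = (2 * sig) ^+ n / 2 by rewrite mul1r.
rewrite -lee_pdivlMl ?divr_gt0 ?exprn_gt0 ?mulr_gt0 // -EFinM in I2.
apply: le_trans I2 _; rewrite lee_fin.
have -> : B * theta ^+ i = C3 * (`|x - y| `^ (- q) * s `^ p).
  by rewrite sE powR_div_pow2 ?(ltW t0) // /B /theta; ring.
(* By sig >= s / 2, the cube of averaging has volume at least s^n. *)
have h1 : ((2 * sig) ^+ n / 2)^-1 <= 2 * s `^ (- n%:R).
  rewrite invfM invrK mulrC ler_pM2l // powRN powR_mulrn ?(ltW s0) //.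
  by rewrite lef_pV2 ?posrE ?exprn_gt0 ?mulr_gt0 // lerXn2r ?nnegrE ?mulr_ge0 ?(ltW s0) ?(ltW sig0) //; lra.
have h2 : `|x - z'| `^ (- q) <= 2 `^ q * `|x - y| `^ (- q).
  exact: powR_half_le.
have h3 : (2 * (al * s)) `^ (n%:R + p) = (2 * al) `^ (n%:R + p) * (s `^ n%:R * s `^ p).
  by rewrite -powRD ?(gt_eqF s0) ?implybT // -powRM ?mulr_ge0 ?(ltW s0) ?(ltW al0) // ?mulrA.
rewrite h3.
apply: (@le_trans _ _ (2 * s `^ (- n%:R) * ((2 * al) `^ (n%:R + p) * (s `^ n%:R * s `^ p)
     * (C * (2 `^ q * `|x - y| `^ (- q)))))).
  apply: ler_pM => //.
  - by rewrite invr_ge0 divr_ge0 ?exprn_ge0 ?mulr_ge0 // ltW.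
  - by rewrite !mulr_ge0 ?powR_ge0 // ltW.
  - apply: ler_wpM2l; first by rewrite !mulr_ge0 ?powR_ge0.
    by rewrite ler_pM2l.
have e : s `^ (- n%:R) * s `^ n%:R = 1.
  by rewrite powRN mulVf // gt_eqF // powR_gt0.
rewrite le_eqVlt; apply/orP; left; apply/eqP.
transitivity (C3 * (`|x - y| `^ (- q) * s `^ p) * (s `^ (- n%:R) * s `^ n%:R)).
  by rewrite /C3; ring.
by rewrite e mulr1.
Unshelve. all: by end_near.
Qed.

End PointwiseDifferences.

(** * Uniform domains *)

Section Chains.
Variables (R : realType) (n : nat).
Local Notation V := 'rV[R]_n.
Implicit Types (O E : set V).

Definition segm (x y : V) : set V := (fun t : R => x + t *: (y - x)) @` `[0, 1]%classic.

Lemma segm_connected x y : connected (segm x y).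
Proof.
apply: connected_continuous_connected; first exact: segment_connected.
apply: continuous_subspaceT => t; apply: cvgD; first exact: cvg_cst.
by apply: cvgZr_tmp; exact: cvg_id.
Qed.

Lemma segm_compact x y : compact (segm x y).
Proof.
apply: continuous_compact; last exact: segment_compact.
apply: continuous_subspaceT => t; apply: cvgD; first exact: cvg_cst.
by apply: cvgZr_tmp; exact: cvg_id.
Qed.

Lemma segm_left x y : segm x y x.
Proof. by exists 0; rewrite ?scale0r ?addr0 //= in_itv /= lexx ler01. Qed.

Lemma segm_right x y : segm x y y.
Proof. by exists 1; rewrite ?scale1r 1?addrC ?subrK //= in_itv /= lexx ler01. Qed.

Lemma segm_meets_bdry O x y : open O -> O x -> ~ O y ->
  exists2 u, segm x y u & bdry O u.
Proof.
move=> oO Ox nOy; apply: contrapT => nb.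
have E u : segm x y u -> closure O u -> O u.
  move=> xyu cu; apply: contrapT => nOu; apply: nb; exists u => //; split => //.
  by move/interior_subset.
have H : segm x y `&` O = segm x y; first apply: (@segm_connected x y).
- by exists x; split => //; exact: segm_left.
- by exists O.
- exists (closure O); first exact: closed_closure.
  apply/seteqP; split => u [xyu Ou]; split => //; first exact: subset_closure.
  exact: E.
by apply: nOy; have := segm_right x y; rewrite -H => -[].
Qed.

Lemma room_of_dist_bd O z (r : R) : open O -> O z ->
  ((n%:R * r)%:E < dist_bd O z)%E -> room O z r.
Proof.
move=> oO Oz hr w wz; apply: contrapT => nOw.
have [u [t /=]] := segm_meets_bdry oO Oz nOw.
rewrite in_itv /= => /andP[t0 t1] ut bu; move: hr; apply/negP; rewrite -leNgt.
apply: (@le_trans _ _ (edist z u)%:E); first by apply: ereal_inf_lbound; exists u.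
rewrite lee_fin /edist; apply: le_trans (enorm_le_norm _) _; rewrite ler_wpM2l //.
apply: le_trans wz; rewrite -ut distrC addrC addKr normrZ ger0_norm // ler_piMl //.
Qed.

(** Cut the cube around x into cells and call two cells adjacent if they contain points of E at
    distance at most [mu]. Connectedness of E makes the cell of z reachable from that of x, and a
    path without repetition is no longer than the number of cells, which depends only on n, D and
    delta. *)
Lemma grid_chain (D delta : R) : 0 <= D -> 0 < delta -> exists N : nat,
  forall E x z (r : R), 0 < r -> connected E -> E x -> E z ->
  (forall p, E p -> `|p - x| <= D * r) ->
  exists l : seq V, [/\ (size l <= N)%N, path (fun a b => `|b - a| <= delta * r) x l,
    last x l = z & forall p, p \in l -> E p].
Proof.
move=> D0 delta0.
(* Each coordinate ranges over an interval of length 2 D r, that is 6 D / delta cells of side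
   [mu]. *)
pose K := (Num.truncn (6 * D / delta)).+1.
pose T : finType := {ffun 'I_n -> 'I_K}.
exists #|T|.+2 => E x z r r0 cE Ex Ez ED.
(* A third of the allowed step: consecutive representatives are joined through two intermediate
   points of E, by three moves of length at most [mu]. *)
pose mu := delta * r / 3.
have mu0 : 0 < mu by rewrite divr_gt0 // mulr_gt0.
pose idx (p : V) (i : 'I_n) : nat := Num.truncn ((p 0 i - x 0 i + D * r) / mu).
have shift0 p i : E p -> 0 <= p 0 i - x 0 i + D * r <= 2 * D * r.
  move=> Ep; have := le_trans (norm_coord (p - x) i) (ED _ Ep); rewrite !mxE ler_norml.
  by move=> /andP[h1 h2]; apply/andP; split; lra.
have idxK p i : E p -> (idx p i < K)%N.
  move=> /(@shift0 _ i) /andP[h1 h2]; rewrite ltnS; apply: le_truncn.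
  rewrite ler_pdivrMr //.
  have -> : 6 * D / delta * mu = 2 * D * r by rewrite /mu; field; rewrite gt_eqF.
  by [].
pose cell (p : V) : T := [ffun i => inord (idx p i)].
have cellP p q : E p -> E q -> cell p = cell q -> `|p - q| <= mu.
  move=> Ep Eq /ffunP pq; apply: norm_rV_le (ltW mu0) _ => i; rewrite !mxE.
  have := congr1 val (pq i); rewrite !ffunE /= !inordK ?idxK // /idx => e.
  have /andP[hp _] := shift0 p i Ep; have /andP[hq _] := shift0 q i Eq.
  have hp' : 0 <= (p 0 i - x 0 i + D * r) / mu by rewrite divr_ge0 // ltW.
  have hq' : 0 <= (q 0 i - x 0 i + D * r) / mu by rewrite divr_ge0 // ltW.
  have /andP[p1 p2] := truncn_itv hp'; have /andP[q1 q2] := truncn_itv hq'.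
  rewrite -e in q1 q2; move: p1 p2 q1 q2; move: (Num.Def.trunc _) => k.
  rewrite -natr1 => p1 p2 q1 q2.
  have -> : p 0 i - q 0 i
      = ((p 0 i - x 0 i + D * r) / mu - (q 0 i - x 0 i + D * r) / mu) * mu.
    by field; rewrite gt_eqF.
  rewrite normrM (gtr0_norm mu0) ler_piMl ?(ltW mu0) // ler_norml; apply/andP; split; lra.
pose e (a b : T) : bool := `[< exists p q, [/\ E p, E q, cell p = a, cell q = b & `|q - p| <= mu] >].
have conn p : E p -> connect e (cell x) (cell p).
  pose S := [set p | E p /\ connect e (cell x) (cell p)].
  have near_eq p1 p2 : E p1 -> E p2 -> `|p2 - p1| <= mu -> e (cell p1) (cell p2).
    by move=> E1 E2 h; apply/asboolP; exists p1, p2.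
  (* S is open and closed in E, because points of E at distance less than [mu] lie in the same or in
     adjacent cells. *)
  have SE : S = E.
    apply: cE.
    - by exists x; split => //; exact: connect0.
    - exists (\bigcup_(p1 in S) ball p1 mu).
        by apply: bigcup_open => p1 _; exact: ball_open.
      apply/seteqP; split => p1.
        by move=> Sp1; split; [case: Sp1|exists p1 => //; exact: ballxx].
      move=> [Ep1 [p2 [Ep2 cp2]]]; rewrite -ball_normE /= => h; split=> //.
      by apply: connect_trans cp2 (connect1 (near_eq _ _ Ep2 Ep1 _)); rewrite distrC ltW.
    - exists (~` \bigcup_(p1 in E `\` S) ball p1 mu).
        by apply: open_closedC; apply: bigcup_open => p1 _; exact: ball_open.
      apply/seteqP; split => p1.
        move=> [Ep1 cp1]; split=> // -[p2 [Ep2 nSp2]]; rewrite -ball_normE /= => h.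
        apply: nSp2; split => //.
        by apply: connect_trans cp1 (connect1 (near_eq _ _ Ep1 Ep2 _)); rewrite ltW.
      move=> [Ep1 np1]; apply: contrapT => nS; apply: np1; exists p1 => //.
      exact: ballxx.
  by move=> Ep; have [_] : S p by rewrite SE.
have [p0 pth lst] := connectP (conn z Ez).
case/shortenP: pth lst => p ep up _ lst.
pose rep (a : T) : V := xget x [set q | E q /\ cell q = a].
have repE a : E (rep a).
  by rewrite /rep; case: xgetP => [q _ []|].
have repC q : E q -> cell (rep (cell q)) = cell q.
  by move=> Eq; have [] := @xgetPex _ x [set q' | E q' /\ cell q' = cell q]; first by exists q.
exists (rcons [seq rep a | a <- cell x :: p] z); split.
- rewrite size_rcons size_map /= !ltnS.
  have := max_card (mem (cell x :: p)); rewrite (card_uniqP up).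
  exact: leq_trans (leqnSn _).
- have near_rep q : E q -> `|rep (cell q) - q| <= mu by move=> Eq; apply: cellP => //; exact: repC.
  have mu3 : mu + mu + mu = delta * r by rewrite /mu; field.
  have mud : mu <= delta * r by rewrite -mu3; have := mu0; lra.
  rewrite rcons_path /=; apply/andP; split; last first.
    rewrite last_map -lst distrC; apply: le_trans mud; exact: near_rep.
  apply/andP; split; first by apply: le_trans mud; exact: near_rep.
  elim: (p) (cell x) ep => //= b p' IH a /andP[/asboolP[p1 [p2 [E1 E2 <- <- h]]] pth].
  rewrite IH // andbT -mu3.
  have h1 := near_rep _ E1; have h2 := near_rep _ E2.
  apply: le_trans (ler_distD p1 _ _) _; rewrite addrC [leRHS]addrC addrA.
  rewrite [`|p1 - _|]distrC.
  have : `|rep (cell p2) - p1| <= mu + mu.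
    by apply: le_trans (ler_distD p2 _ _) _; exact: lerD.
  by move: h1; lra.
- by rewrite last_rcons.
- move=> q; rewrite mem_rcons inE => /orP[/eqP->//|/mapP[a _ ->]]; exact: repE.
Qed.

Definition chain O (x z : V) (step room_r radius : R) (N : nat) :=
  exists l : seq V, [/\ (size l <= N)%N, path (fun a b => `|b - a| <= step) x l,
    last x l = z & forall p, p \in l -> room O p room_r /\ `|p - x| <= radius].

(* The two consequences of uniformity that the proof uses. *)
Definition chainable O (c : R) :=
  (forall x y s, O x -> O y -> 0 < s -> 2 * s <= `|x - y| ->
     exists z, `|z - x| <= s /\ room O z (s / c)) /\
  (forall M lam, 0 < M -> 0 < lam -> exists N : nat, forall x z r, 0 < r ->
     room O x r -> room O z r -> `|z - x| <= M * r ->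
     chain O x z (lam * r) (r / c) (c * M * r) N).

(** Both properties come from the continuum E joining the two points. For the first, the
    intermediate value theorem gives a point of E at distance exactly s from x; for the second,
    [grid_chain] discretizes E. *)
Lemma uniform_chainable O : (0 < n)%N -> uniform_domain O ->
  exists2 c : R, 1 <= c & chainable O c.
Proof.
move=> n0 [c [c1 [[oO _] uO]]].
have n1 : 1 <= n%:R :> R by rewrite ler1n.
have c0 : 0 < c := lt_le_trans ltr01 c1.
have nc1 : 1 <= n%:R * c by rewrite -[leLHS]mulr1 ler_pM.
have roomE E x y p a : E `<=` O -> E p -> 0 < a -> a <= `|p - x| -> a <= `|p - y| ->
    ((Num.min (edist p x) (edist p y))%:E <= c%:E * dist_bd O p)%E ->
    room O p (a / (2 * n%:R * c)).
  move=> EO Ep a0 ax ay h; apply: room_of_dist_bd => //; first exact: EO.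
  (* The factor 2 provides the strict inequality required by [room_of_dist_bd], and n the passage
     from Euclidean to sup norm. *)
  have -> : n%:R * (a / (2 * n%:R * c)) = a / (2 * c).
    by field; rewrite !gt_eqF // (lt_le_trans ltr01).
  apply: (@lt_le_trans _ _ (a / c)%:E).
    by rewrite lte_fin invfM mulrCA mulrA -mulrA gtr_pMl ?divr_gt0 // invf_lt1 // ltr1n.
  rewrite mulrC EFinM lee_pdivrMl //.
  apply: le_trans h; rewrite lee_fin le_min.
  by rewrite (le_trans ax (norm_le_enorm _)) (le_trans ay (norm_le_enorm _)).
exists (4 * n%:R * c); first by rewrite -mulrA; lra.
have cc0 : 0 < 4 * n%:R * c by rewrite -mulrA; lra.
split.
- move=> x y s Ox Oy s0 sxy.
  have xy : x != y by apply: contraTneq sxy => ->; rewrite subrr normr0 -ltNge mulr_gt0.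
  have [E [[EO _ cE Ex Ey] [_ Emin]]] := uO x y Ox Oy xy.
  have : is_interval ((fun p => `|p - x|) @` E).
    apply/connected_intervalP/connected_continuous_connected => //.
    apply: continuous_subspaceT => p.
    apply: (@cvg_norm _ _ _ (nbhs p) _ (fun p0 => p0 - x)).
    by apply: (@cvgB _ _ _ (nbhs p)); [exact: cvg_id | exact: cvg_cst].
  move=> /(_ 0 `|y - x|) H.
  have [z Ez zs] : ((fun p => `|p - x|) @` E) s.
    apply: H; [by exists x; rewrite ?subrr ?normr0|by exists y|].
    by rewrite distrC; lra.
  exists z; rewrite zs; split => //.
  have zy : s <= `|z - y|.
    have := ler_distD z x y; rewrite [`|x - z|]distrC zs; lra.
  have := @roomE E x y z s EO Ez s0 _ zy (Emin _ Ez); rewrite zs lexx => /(_ isT).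
  move=> /room_le; apply; rewrite ler_pM2l // lef_pV2 ?posrE -?mulrA //; nra.
move=> M lam M0 lam0.
have cM0 : 0 <= c * n%:R * M by rewrite !mulr_ge0 // ltW.
have [N HN] := grid_chain cM0 lam0.
exists N => x z r r0 xr zr zx.
have [<-|xz] := eqVneq x z.
  by exists [::].
have Ox : O x by apply: room_in xr; exact: ltW.
have Oz : O z by apply: room_in zr; exact: ltW.
have [E [[EO _ cE Ex Ez] [dE Emin]]] := uO x z Ox Oz xz.
have ED p : E p -> `|p - x| <= c * n%:R * M * r.
  move=> Ep; apply: le_trans (norm_le_enorm _) _.
  rewrite -lee_fin; apply: le_trans (le_trans dE _).
    by apply: ereal_sup_ubound; exists p, x.
  rewrite lee_fin -!mulrA ler_pM2l // /edist; apply: le_trans (enorm_le_norm _) _.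
  by rewrite ler_wpM2l // distrC.
have [l [ls lp ll lE]] := HN E x z r r0 cE Ex Ez ED.
exists l; split => // p /lE Ep; split; last first.
  apply: le_trans (ED _ Ep) _; rewrite ler_pM2r // ler_pM2r //; nra.
have half : r / (4 * n%:R * c) <= r / 2.
  by rewrite ler_pM2l // lef_pV2 ?posrE -?mulrA //; nra.
(* Near an end, p inherits half of its room; away from both ends, uniformity gives room r / (4 n c),
   whence the constant 4 n c. *)
have [h1|h1] := leP `|p - x| (r / 2).
  by apply: (room_shift xr); lra.
have [h2|h2] := leP `|p - z| (r / 2).
  by apply: (room_shift zr); lra.
have r2 : 0 < r / 2 by rewrite divr_gt0.
have := @roomE E x z p _ EO Ep r2 (ltW h1) (ltW h2) (Emin _ Ep).
have -> : r / 2 / (2 * n%:R * c) = r / (4 * n%:R * c); last by [].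
by field; rewrite !gt_eqF // (lt_le_trans ltr01).
Qed.

Lemma setT_uniform : uniform_domain (setT : set V).
Proof.
exists 1; split=> //; split.
  split; first exact: openT.
  split; last by exists 0.
  move=> B [x Bx] [C oC]; rewrite setTI => BC [D cD]; rewrite setTI => BD.
  apply/seteqP; split => // y _; apply: contrapT => nBy.
  have oB : open B by rewrite BC.
  have [u _ [cu iu]] := segm_meets_bdry oB Bx nBy.
  have Bu : B u by move: cu; rewrite BD -(closure_id D).1.
  by apply: iu; move: oB; rewrite openE; apply.
move=> x y _ _ xy; exists (segm x y); split.
  by split => //; [exact: segm_compact|exact: segm_connected|exact: segm_left|exact: segm_right].
split.
  apply: ge_ereal_sup => _ [_ [_ [[t /= + <-] [[t' /= + <-] ->]]]].
  rewrite !in_itv /= => /andP[t0 t1] /andP[t'0 t'1]; rewrite mul1r lee_fin /edist.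
  have -> : x + t *: (y - x) - (x + t' *: (y - x)) = (t' - t) *: (x - y) by lmod R.
  rewrite enormZ ler_piMl ?enorm_ge0 // ler_norml; apply/andP; split; lra.
move=> z _.
have -> : dist_bd setT z = +oo%E.
  rewrite /dist_bd (_ : [set e | _] = set0) ?ereal_inf0 //.
  apply/seteqP; split => // e [w [[_ iw] _]]; apply: iw.
  by rewrite interiorT.
by rewrite mul1e leey.
Qed.

End Chains.

(** * Mixed differences *)

Section MixedDifferences.
Variables (R : realType) (n m : nat) (d : R) (O : set 'rV[R]_n) (c : R).
Local Notation V := 'rV[R]_n.
Local Notation W := 'rV[R]_2.
Local Notation E := (V * V)%type.
Hypotheses (mn : (0 < m < n)%N) (d01 : 0 < d < 1) (c1 : 1 <= c) (chO : chainable O c).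

Let d0 : 0 < d. Proof. by case/andP: d01. Qed.
Let d1 : d < 1. Proof. by case/andP: d01. Qed.
Let c0 : 0 < c. Proof. exact: lt_le_trans c1. Qed.

(* The size of a [q]-fold difference with steps of length [t] at two points at
   distance [rho]. *)
Definition phi (q : nat) (rho t : R) : R :=
  if (q <= m)%N then rho `^ (m%:R - n%:R - q%:R) * t ^+ q
  else rho `^ (- (n%:R + d)) * t `^ (m%:R + d).

(* A step in [x] alone or in [y] alone. *)
Definition isdir (h : E) : bool := (h.1 == 0) || (h.2 == 0).

Definition diff_bound (q : nat) (C Lam : R) (F : E -> W) : Prop :=
  forall x y t l, 0 < t -> room O x (Lam * t) -> room O y (Lam * t) ->
    Lam * t <= `|x - y| -> size l = q ->
    (forall h, h \in l -> isdir h /\ `|h| <= t) ->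
    `|Dl l F (x, y)| <= C * phi q `|x - y| t.

Lemma phi_ge0 q rho t : 0 <= t -> 0 <= phi q rho t.
Proof. by move=> t0; rewrite /phi; case: ifP => _; rewrite mulr_ge0 ?powR_ge0 ?exprn_ge0. Qed.

Lemma phi_gt0 q rho t : 0 < rho -> 0 < t -> 0 < phi q rho t.
Proof. by move=> r0 t0; rewrite /phi; case: ifP => _; rewrite mulr_gt0 ?powR_gt0 ?exprn_gt0. Qed.

(** The exponent n + q + 1 dominates both n + q - m and n + d. *)
Lemma phi_half q rho rho' t : 0 <= t -> 0 < rho -> rho / 2 <= rho' ->
  phi q rho' t <= 2 ^+ (n + q).+1 * phi q rho t.
Proof.
move=> t0 r0 hr; rewrite /phi; case/andP: mn => m0 mltn.
have mnR : m%:R < n%:R :> R by rewrite ltr_nat.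
have bound e : 0 < e -> e <= (n + q).+1%:R ->
    rho' `^ (- e) <= 2 ^+ (n + q).+1 * rho `^ (- e).
  move=> e0 eq; apply: le_trans (powR_half_le r0 e0 hr) _.
  apply: ler_wpM2r; first exact: powR_ge0.
  by rewrite -powR_mulrn //; apply: ler_powR => //; rewrite ler1n.
rewrite -natr1 natrD in bound; have q0 : 0 <= q%:R :> R by [].
case: ifP => _; rewrite mulrA; apply: ler_wpM2r; rewrite ?exprn_ge0 ?powR_ge0 //.
  have -> : m%:R - n%:R - q%:R = - (n%:R + q%:R - m%:R) :> R by ring.
  by apply: bound; [lra | have : 0 <= m%:R :> R by []; lra].
by apply: bound; [rewrite ltr_wpDl | have := d1; lra].
Qed.

Lemma chain_bound (g : V -> W) x z step rr rad N B : 0 <= B -> 0 <= rad ->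
  room O x rr -> chain O x z step rr rad N ->
  (forall a b, room O a rr -> `|a - x| <= rad -> `|b - a| <= step -> `|g b - g a| <= B) ->
  `|g z - g x| <= N%:R * B.
Proof.
move=> B0 rad0 xr [l [lN lp <- lr]] gB.
have xx : `|x - x| <= rad by rewrite subrr normr0.
suff H a : room O a rr -> `|a - x| <= rad -> path (fun a b => `|b - a| <= step) a l ->
    `|g (last a l) - g a| <= (size l)%:R * B.
  by apply: le_trans (H x xr xx lp) _; rewrite ler_wpM2r // ler_nat.
elim: l a lr {lp lN} => [|b l IH] a lr ra ax /=; first by rewrite subrr normr0 mul0r.
case/andP => ab bl; have [rb bx] := lr b (mem_head _ _).
rewrite -natr1 mulrDl mul1r; apply: le_trans (ler_distD (g b) _ _) _.
apply: lerD; last exact: gB.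
by apply: IH => // p pl; apply: lr; rewrite inE pl orbT.
Qed.

(** The weight absorbs the error of one doubling. For q > m, 2^-q [phi](2t) <= 2^(d-1) [phi](t) is a
    genuine contraction and a constant weight works. For q <= m, 2^-q [phi](2t) = [phi](t), but the
    error is at most A (t/rho)^d [phi](t), so a weight that decreases with t by multiples of
    (t/rho)^d pays for it. *)
Lemma diff_weight (q : nat) (A B : R) : 0 <= A -> 0 <= B ->
  exists2 J, 0 <= J & forall rho, 0 < rho -> exists w : R -> R, forall t, 0 < t -> t <= rho ->
    [/\ B <= w t, w t <= J & (2 * t <= rho ->
      A * phi q.+1 rho t + 2 ^- q * (w (2 * t) * phi q rho (2 * t)) <= w t * phi q rho t)].
Proof.
move=> A0 B0; have two0 : 0 <= 2 :> R by [].
have pow2d : 1 < 2 `^ d.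
  have : (1 : R) `^ d < 2 `^ d by apply: gt0_ltr_powR; rewrite ?nnegrE ?ltr1n.
  by rewrite powR1.
have [qm|mq] := leqP q m.
  (* Chosen so that J1 ((2t/rho)^d - (t/rho)^d) = A (t/rho)^d. *)
  pose J1 := A / (2 `^ d - 1).
  have J10 : 0 <= J1 by rewrite divr_ge0 // subr_ge0 ltW.
  exists (B + J1); first exact: addr_ge0.
  move=> rho rho0; exists (fun t => B + J1 - J1 * (t / rho) `^ d) => t t0 trho.
  have tr0 : 0 < t / rho by exact: divr_gt0.
  have tr1 : t / rho <= 1 by rewrite ler_pdivrMr // mul1r.
  have p1 : (t / rho) `^ d <= 1.
    have : (t / rho) `^ d <= 1 `^ d.
      by apply: ge0_ler_powR; rewrite ?nnegrE ?(ltW d0) ?(ltW tr0).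
    by rewrite powR1.
  split.
  - by rewrite -addrA lerDl subr_ge0 ler_piMr.
  - by rewrite gerBl mulr_ge0 // powR_ge0.
  move=> _.
  have e1 : 2 ^- q * phi q rho (2 * t) = phi q rho t.
    by rewrite /phi qm exprMn; field; rewrite expf_neq0.
  have e2 : phi q.+1 rho t <= (t / rho) `^ d * phi q rho t.
    rewrite /phi qm; case: ltnP => [qm'|mq].
      have -> : rho `^ (m%:R - n%:R - q.+1%:R) * t ^+ q.+1
          = (t / rho) * (rho `^ (m%:R - n%:R - q%:R) * t ^+ q).
        have -> : m%:R - n%:R - q.+1%:R = (m%:R - n%:R - q%:R) + (-1) :> R.
          by rewrite -natr1; ring.
        rewrite powRD ?(gt_eqF rho0) ?implybT // powR_inv1 ?(ltW rho0) // exprS; ring.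
      apply: ler_wpM2r; first by rewrite mulr_ge0 ?powR_ge0 ?exprn_ge0 // ltW.
      by apply: ger1_powR; rewrite ?tr0 // ltW.
    have -> : q = m by apply/eqP; rewrite eqn_leq qm.
    rewrite powRM ?invr_ge0 ?(ltW rho0) ?(ltW t0) // -powR_inv1 ?(ltW rho0) //.
    rewrite -powRrM mulN1r.
    have -> : - (n%:R + d) = (m%:R - n%:R - m%:R) + (- d) :> R by ring.
    rewrite [X in rho `^ X * _ <= _]addrC.
    rewrite !powRD ?(gt_eqF rho0) ?(gt_eqF t0) ?implybT // powR_mulrn ?(ltW t0) //.
    by rewrite le_eqVlt; apply/orP; left; apply/eqP; ring.
  have e3 : (2 * t / rho) `^ d = 2 `^ d * (t / rho) `^ d.
    by rewrite -mulrA powRM // ltW.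
  rewrite mulrCA e1 e3.
  have ph0 := @phi_ge0 q rho t (ltW t0).
  apply: (@le_trans _ _ ((A * (t / rho) `^ d +
     (B + J1 - J1 * (2 `^ d * (t / rho) `^ d))) * phi q rho t)).
    by rewrite [leRHS]mulrDl lerD2r -mulrA; apply: ler_wpM2l.
  apply: ler_wpM2r => //.
  have -> : A = J1 * (2 `^ d - 1) by rewrite /J1 divfK // subr_eq0 gt_eqF.
  by rewrite le_eqVlt; apply/orP; left; apply/eqP; ring.
pose th : R := 2 `^ (d - 1).
have th1 : th < 1.
  have -> : th = (2 `^ (1 - d))^-1 by rewrite -powRN opprB.
  rewrite invf_lt1 ?powR_gt0 //.
  have : (1 : R) `^ (1 - d) < 2 `^ (1 - d).
    by apply: gt0_ltr_powR; rewrite ?nnegrE ?ltr1n // subr_gt0.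
  by rewrite powR1.
(* The term A / (1 - th) is the fixed point of J -> A + th J. *)
pose J := B + A / (1 - th).
have J0 : 0 <= J by rewrite addr_ge0 // divr_ge0 // subr_ge0 ltW.
exists J => // rho rho0; exists (fun=> J) => t t0 trho; split => //.
  by rewrite /J lerDl divr_ge0 // subr_ge0 ltW.
move=> _.
have nqm : (q <= m)%N = false by apply/negbTE; rewrite -ltnNge.
have nqm' : (q.+1 <= m)%N = false by apply/negbTE; rewrite -ltnNge ltnS ltnW.
have ph0 := @phi_ge0 q rho t (ltW t0).
have -> : phi q.+1 rho t = phi q rho t by rewrite /phi nqm nqm'.
have e1 : 2 ^- q * phi q rho (2 * t) <= th * phi q rho t.
  rewrite /phi nqm powRM ?(ltW t0) //.
  have -> : 2 ^- q * (rho `^ (- (n%:R + d)) * (2 `^ (m%:R + d) * t `^ (m%:R + d)))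
     = (2 ^- q * 2 `^ (m%:R + d)) * (rho `^ (- (n%:R + d)) * t `^ (m%:R + d)) by ring.
  apply: ler_wpM2r; first by rewrite mulr_ge0 ?powR_ge0.
  rewrite -powR_invn // -powRD ?pnatr_eq0 ?implybT //.
  apply: ler_powR; first by rewrite ler1n.
  have : m.+1%:R <= q%:R :> R by rewrite ler_nat.
  by rewrite -natr1; lra.
rewrite mulrCA; apply: (@le_trans _ _ ((A + J * th) * phi q rho t)).
  by rewrite [leRHS]mulrDl lerD2l -mulrA; apply: ler_wpM2l.
apply: ler_wpM2r => //.
have h0 : 0 < 1 - th by rewrite subr_gt0.
have : A = (A / (1 - th)) * (1 - th) by rewrite divfK // gt_eqF.
rewrite /J; set a := A / (1 - th) => ->.
have : 0 <= B * (1 - th) by rewrite mulr_ge0 // ltW.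
by lra.
Qed.

Lemma isdir_inl (h : V) : isdir (h, 0). Proof. by rewrite /isdir eqxx orbT. Qed.
Lemma isdir_inr (h : V) : isdir (0, h). Proof. by rewrite /isdir eqxx. Qed.

Lemma norm_inl (h : V) : `|((h, 0) : E)| = `|h|.
Proof. by rewrite prod_normE /= normr0 max_l. Qed.

Lemma norm_inr (h : V) : `|((0, h) : E)| = `|h|.
Proof. by rewrite prod_normE /= normr0 max_r. Qed.

Lemma norm_snd (p : E) : `|p.2| <= `|p|.
Proof. by rewrite prod_normE le_max lexx orbT. Qed.

Lemma dist_prod (a b x y : V) : `|((a, b) : E) - (x, y)| = Num.max `|a - x| `|b - y|.
Proof. by rewrite prod_normE. Qed.

Section Induction.
Variables (F : E -> W) (C0 : R).
Hypothesis C00 : 0 <= C0.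
Hypothesis size_F : forall x y, O x -> O y -> x != y ->
  `|F (x, y)| <= C0 * `|x - y| `^ (m%:R - n%:R).

Lemma phi_scale q rho k : 0 < rho -> 0 <= k ->
  phi q rho (k * rho) = rho `^ (m%:R - n%:R) * phi q 1 k.
Proof.
move=> r0 k0; rewrite /phi; case: ifP => _.
  rewrite powR1 mul1r exprMn -[rho ^+ q]powR_mulrn ?(ltW r0) // mulrCA.
  rewrite -powRD ?(gt_eqF r0) ?implybT // subrK mulrC //.
rewrite powR1 mul1r powRM ?(ltW r0) // mulrCA -powRD ?(gt_eqF r0) ?implybT //.
rewrite mulrC; congr (_ `^ _ * _); ring.
Qed.

Lemma le_phi q rho t t' : 0 <= t -> t <= t' -> phi q rho t <= phi q rho t'.
Proof.
move=> t0 tt'; have t'0 : 0 <= t' := le_trans t0 tt'.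
rewrite /phi; case: ifP => _; apply: ler_wpM2l; rewrite ?powR_ge0 //.
  by rewrite lerXn2r // nnegrE.
by apply: ge0_ler_powR; rewrite ?nnegrE // addr_ge0 // ltW.
Qed.

Lemma dist_shift (x y x' y' : V) a b r : `|x' - x| <= a -> `|y' - y| <= b ->
  r + a + b <= `|x - y| -> r <= `|x' - y'|.
Proof.
move=> ha hb h; have h1 := ler_distD x' x y; have h2 := ler_distD y' x' y.
rewrite [`|x - x'|]distrC in h1; lra.
Qed.

(** Where the doubling stops. Once t >= kap rho, homogeneity of [phi] makes rho^(m-n) at most a
    multiple of [phi q rho t], so the size estimate at each of the 2^q points is enough. *)
Lemma top_bound q kap : 0 < kap -> exists2 B, 0 <= B & forall rho x y t l, 0 < rho ->
  kap * rho <= t -> room O x (q%:R * t) -> room O y (q%:R * t) ->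
  rho / 2 + q%:R * t + q%:R * t <= `|x - y| -> size l = q ->
  (forall h, h \in l -> `|h| <= t) -> `|Dl l F (x, y)| <= B * phi q rho t.
Proof.
move=> kap0; have ph := phi_gt0 q ltr01 kap0.
exists (2 ^+ q * (C0 * 2 ^+ n.+1) / phi q 1 kap).
  by rewrite divr_ge0 ?(ltW ph) ?mulr_ge0 ?exprn_ge0.
move=> rho x y t l rho0 kt rx ry hxy sl hl.
have t0 : 0 < t by apply: lt_le_trans kt; exact: mulr_gt0.
have H : `|Dl l F (x, y)| <= 2 ^+ size l * (C0 * 2 ^+ n.+1 * rho `^ (m%:R - n%:R)).
  apply: (@Dl_bound _ _ _ _ _ _ t) => // -[x' y'].
  rewrite dist_prod sl ge_max => /andP[hx hy].
  have hd : rho / 2 <= `|x' - y'| by apply: dist_shift hx hy hxy.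
  have d'0 : 0 < `|x' - y'| by apply: lt_le_trans hd; exact: divr_gt0.
  have := size_F (rx _ hx) (ry _ hy); rewrite -subr_eq0 -normr_gt0 d'0 => /(_ isT) h.
  apply: le_trans h _; rewrite -mulrA; apply: ler_wpM2l => //.
  have := @phi_half 0 rho `|x' - y'| t (ltW t0) rho0 hd.
  by rewrite /phi leq0n addn0 expr0 !mulr1 subr0.
apply: le_trans H _; rewrite sl.
have : phi q rho (kap * rho) <= phi q rho t.
  by apply: le_phi => //; rewrite mulr_ge0 // ltW.
rewrite phi_scale // ?(ltW kap0) // -ler_pdivlMr // => h.
have -> : 2 ^+ q * (C0 * 2 ^+ n.+1) / phi q 1 kap * phi q rho t
  = 2 ^+ q * (C0 * 2 ^+ n.+1 * (phi q rho t / phi q 1 kap)) by ring.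
apply: ler_wpM2l; first exact: exprn_ge0.
by apply: ler_wpM2l => //; rewrite mulr_ge0 // exprn_ge0.
Qed.

(** Each link of the chain acts as one more step in x, so the change along it is a (q+1)-fold
    difference. *)
Lemma move_fst q C Lam rho x y z t l rr rad N : 0 <= C -> 0 < rho -> 0 < t -> 0 <= rad ->
  diff_bound q.+1 C Lam F -> Lam * t <= rr -> Lam * t <= rho / 2 ->
  room O x rr -> room O y (Lam * t) -> chain O x z t rr rad N ->
  rho / 2 + rad <= `|x - y| -> size l = q ->
  (forall h, h \in l -> isdir h /\ `|h| <= t) ->
  `|Dl l F (z, y) - Dl l F (x, y)| <= N%:R * (C * 2 ^+ (n + q.+1).+1 * phi q.+1 rho t).
Proof.
move=> C_ge0 rho0 t0 rad0 HF Lrr Lrho rx ry ch hxy sl hl.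
have B0 : 0 <= C * 2 ^+ (n + q.+1).+1 * phi q.+1 rho t.
  by rewrite !mulr_ge0 ?exprn_ge0 ?phi_ge0 // ltW.
apply: (chain_bound (g := fun a => Dl l F (a, y)) B0 rad0 rx ch) => a b ra ax ab.
have -> : Dl l F (b, y) - Dl l F (a, y) = Dl ((b - a, 0) :: l) F (a, y).
  by rewrite /=; congr (Dl l F _ - _); congr (_, _); rewrite ?addr0 // addrC subrK.
have had : rho / 2 <= `|a - y|.
  apply: (@dist_shift x y a y rad 0 _ ax); rewrite ?subrr ?normr0 //; lra.
apply: le_trans (HF _ _ t _ t0 _ ry _ _ _) _.
- exact: room_le ra Lrr.
- exact: le_trans had.
- by rewrite /= sl.
- by move=> h; rewrite inE => /orP[/eqP->|/hl//]; rewrite isdir_inl norm_inl.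
by rewrite -mulrA; apply: ler_wpM2l => //; apply: phi_half; rewrite // ltW.
Qed.

Lemma move_snd q C Lam rho x y z t l rr rad N : 0 <= C -> 0 < rho -> 0 < t -> 0 <= rad ->
  diff_bound q.+1 C Lam F -> Lam * t <= rr -> Lam * t <= rho / 2 ->
  room O y rr -> room O x (Lam * t) -> chain O y z t rr rad N ->
  rho / 2 + rad <= `|x - y| -> size l = q ->
  (forall h, h \in l -> isdir h /\ `|h| <= t) ->
  `|Dl l F (x, z) - Dl l F (x, y)| <= N%:R * (C * 2 ^+ (n + q.+1).+1 * phi q.+1 rho t).
Proof.
move=> C_ge0 rho0 t0 rad0 HF Lrr Lrho ry rx ch hxy sl hl.
have B0 : 0 <= C * 2 ^+ (n + q.+1).+1 * phi q.+1 rho t.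
  by rewrite !mulr_ge0 ?exprn_ge0 ?phi_ge0 // ltW.
apply: (chain_bound (g := fun a => Dl l F (x, a)) B0 rad0 ry ch) => a b ra ay ab.
have -> : Dl l F (x, b) - Dl l F (x, a) = Dl ((0, b - a) :: l) F (x, a).
  by rewrite /=; congr (Dl l F _ - _); congr (_, _); rewrite ?addr0 // addrC subrK.
have had : rho / 2 <= `|x - a|.
  apply: (@dist_shift x y x a 0 rad _ _ ay); rewrite ?subrr ?normr0 //; lra.
apply: le_trans (HF _ _ t _ t0 rx _ _ _ _) _.
- exact: room_le ra Lrr.
- exact: le_trans had.
- by rewrite /= sl.
- by move=> h; rewrite inE => /orP[/eqP->|/hl//]; rewrite isdir_inr norm_inr.
by rewrite -mulrA; apply: ler_wpM2l => //; apply: phi_half; rewrite // ltW.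
Qed.

Lemma halve_steps q C Lam rho x y t l : 0 <= C -> 0 < rho -> 0 < t ->
  diff_bound q.+1 C Lam F -> Lam * t <= rho / 2 ->
  room O x (Lam * t + q%:R * t) -> room O y (Lam * t + q%:R * t) ->
  rho / 2 + q%:R * t + q%:R * t <= `|x - y| -> size l = q ->
  (forall h, h \in l -> isdir h /\ `|h| <= t) ->
  `|Dl l F (x, y)| <= q%:R * (C * 2 ^+ (n + q.+1).+1 * phi q.+1 rho t)
     + 2 ^- q * `|Dl [seq 2%:R *: h | h <- l] F (x, y)|.
Proof.
move=> C_ge0 rho0 t0 HF Lrho rx ry hxy sl hl.
set B := C * _ * _.
have := @Dl_double _ _ _ l F (x, y) t B (fun h hl' => (hl h hl').2).
rewrite sl => H.
have {}H := H _; set D2 := Dl _ F (x, y) in H *.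
have {}H : `|D2 - 2 ^+ q *: Dl l F (x, y)| <= q%:R * 2 ^+ q * B.
  apply: H => h [x' y'] hin; rewrite dist_prod ge_max => /andP[hx hy].
  have hd : rho / 2 <= `|x' - y'| by apply: dist_shift hx hy hxy.
  apply: le_trans (HF _ _ t _ t0 _ _ _ _ _) _.
  - by apply: room_shift rx _; rewrite addrC lerD2l.
  - by apply: room_shift ry _; rewrite addrC lerD2l.
  - exact: le_trans hd.
  - by rewrite /= sl.
  - by move=> k; rewrite inE => /orP[/eqP->|]; exact: hl.
  by rewrite /B -mulrA; apply: ler_wpM2l => //; apply: phi_half; rewrite // ltW.
have p0 : 0 < 2 ^+ q :> R by exact: exprn_gt0.
have e (X : R) : 2 ^+ q * (2 ^- q * X) = X by rewrite mulVKf // gt_eqF.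
rewrite -(ler_pM2l p0) mulrDr e.
rewrite -[X in X * `|_|](gtr0_norm p0) -normrZ.
have -> : 2 ^+ q *: Dl l F (x, y) = D2 - (D2 - 2 ^+ q *: Dl l F (x, y)) by lmod R.
apply: le_trans (ler_normB _ _) _; rewrite addrC; apply: lerD => //.
by rewrite mulrCA mulrA.
Qed.

(** Used in [diff_bound_step] with e = Lam t, b = q t, a = L1 t, k = c L1 t and s = c c L1 t; D, D1
    and D2 are the distances of the pair before the moves, after moving the first point and after
    moving both. *)
Lemma step_arith (rho D D1 D2 a k e s b : R) : 0 < rho -> 0 <= e -> 64 * s <= rho -> k <= s -> a <= k ->
  e + b <= a -> 0 <= b -> rho <= D + 4 * k -> D - 2 * k <= D1 -> D1 - 2 * k <= D2 ->
  [/\ e <= rho / 2, rho / 2 + 2 * s <= D, rho / 2 + 2 * s <= D1 & rho / 2 + b + b <= D2].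
Proof. by move=> *; split; lra. Qed.

Lemma start_arith (rho D a k e s b : R) : 0 < rho -> 0 <= e -> 64 * s <= rho -> k <= s -> a <= k ->
  e + b <= a -> 0 <= b -> rho <= D + 4 * k ->
  [/\ b <= a, rho / 2 + b + b <= D, 2 * (2 * k) <= D & 2 * k <= 2 * s].
Proof. by move=> *; split; lra. Qed.

Lemma distance_back (rho D D1 D2 k : R) : rho <= D + 4 * k -> D - 2 * k <= D1 ->
  D1 - 2 * k <= D2 -> rho <= D2 + 4 * (2 * k).
Proof. by move=> *; lra. Qed.

Lemma combine_moves (g p1 p2 p3 a b u v : R) : g <= p1 + p2 + p3 -> p1 <= a -> p2 <= a ->
  p3 <= b + u -> u <= v -> g <= 2 * a + b + v.
Proof. by move=> *; lra. Qed.

(** One round moves the pair inwards to double its room, replaces the steps by their doubles and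
    divides by 2^q. All errors are (q+1)-fold differences, and [diff_weight] sums them over the
    rounds. *)
Lemma diff_bound_step (q : nat) (C Lam : R) : 0 <= C -> 1 <= Lam ->
  diff_bound q.+1 C Lam F ->
  exists C' Lam', [/\ 0 <= C', 1 <= Lam' & diff_bound q C' Lam' F].
Proof.
move=> C_ge0 Lam1 HF; have [G1 G2] := chO.
have q0 : 0 <= q%:R :> R by [].
(* Chains lose a factor c of room, so their points keep room (Lam + q) t. *)
have [L1 L1E] : exists L1, L1 = c * (Lam + q%:R) by eexists.
have L1lam : Lam + q%:R <= L1 by rewrite L1E ler_peMl // addr_ge0 // (le_trans ler01).
have L1c : L1 / c = Lam + q%:R by rewrite L1E mulrC mulKf // gt_eqF.
have L11 : 1 <= L1 by lra.
have L10 : 0 < L1 := lt_le_trans ltr01 L11.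
have c20 : 0 < 2 * c by exact: mulr_gt0.
have Li0 : 0 < L1^-1 by rewrite invr_gt0.
(* For room r = L1 t, these parameters mean targets within 2 c r and links of length t. *)
have [N HN] := G2 (2 * c) (L1^-1) c20 Li0.
(* With L2 t <= rho, all displacements of one round are small fractions of rho. *)
have [L2 L2E] : exists L2, L2 = 64 * (c * c * L1) by eexists.
have ccL : c * L1 <= c * c * L1 by rewrite -mulrA ler_peMl // mulr_ge0 // ltW.
have cL : L1 <= c * L1 by rewrite ler_peMl // ltW.
have L21 : L1 <= L2 by rewrite L2E; lra.
have L20 : 0 < L2 := lt_le_trans L10 L21.
pose A := (2 * N%:R + q%:R) * (C * 2 ^+ (n + q.+1).+1).
have A0 : 0 <= A by rewrite mulr_ge0 ?addr_ge0 ?mulr_ge0 ?exprn_ge0.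
have kap0 : 0 < (2 * L2)^-1 by rewrite invr_gt0 mulr_gt0.
have [B B0 HB] := top_bound q kap0.
have [J J0 HJ] := @diff_weight q A B A0 B0.
exists J, L2; split => //; first exact: le_trans L21.
move=> x y t l t0 rx ry txy sl hl.
have [rho rhoE] : exists rho, rho = `|x - y| by eexists.
have rho0 : 0 < rho by rewrite rhoE; apply: lt_le_trans txy; exact: mulr_gt0.
have [w Hw] := HJ rho rho0.
(* Induction on the number of doublings left, with rho frozen at the initial distance. A round with
   step t costs at most 4 c L1 t of distance, so a total loss of at most 4 c L1 t before the round
   becomes at most 4 c L1 (2t) after it. *)
have main i : forall x y t l, 0 < t -> rho / L2 <= 2 ^+ i * t -> L2 * t <= rho ->
    rho <= `|x - y| + 4 * (L1 * c * t) ->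
    room O x (L1 * t) -> room O y (L1 * t) -> size l = q ->
    (forall h, h \in l -> isdir h /\ `|h| <= t) ->
    `|Dl l F (x, y)| <= w t * phi q rho t.
  elim: i {x y t l t0 rx ry txy sl hl rhoE} => [|i IH] x y t l t0 ti trho dxy rx ry sl hl;
  have tr : t <= rho by (apply: le_trans trho; rewrite ler_peMl ?(ltW t0) // (le_trans L11)).
  1,2: have Lt : 64 * (c * c * L1 * t) <= rho by move: trho; rewrite L2E -!mulrA.
  1,2: have ct : L1 * t <= c * L1 * t by rewrite ler_pM2r.
  1,2: have cct : c * L1 * t <= c * c * L1 * t by rewrite ler_pM2r.
  1,2: have Ldec : Lam * t + q%:R * t <= L1 * t by rewrite -mulrDl ler_pM2r.
  1,2: have Lt0 : 0 < L1 * t by exact: mulr_gt0.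
  1,2: have Lamt : t <= Lam * t by rewrite ler_peMl // ltW.
  1,2: have qt0 : 0 <= q%:R * t by rewrite mulr_ge0 // ltW.
  1,2: rewrite [L1 * c]mulrC in dxy.
  1,2: have [qL far farz k2s] := start_arith rho0 (ltW (lt_le_trans t0 Lamt)) Lt cct ct Ldec qt0 dxy.
  1,2: have [wB wJ wrec] := Hw t t0 tr.
  1,2: have hlt h : h \in l -> `|h| <= t by move=> /hl [].
  1,2: have top : rho / L2 <= 2 * t -> `|Dl l F (x, y)| <= w t * phi q rho t.
  1,3: move=> tt; apply: (@le_trans _ _ (B * phi q rho t));
    last (by apply: ler_wpM2r => //; apply: phi_ge0; exact: ltW);
    apply: HB => //; [|exact: room_le rx qL|exact: room_le ry qL];
    by move: tt; rewrite ler_pdivrMl ?mulr_gt0 // ler_pdivrMr // -!mulrA [t * L2]mulrC.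
  - by apply: top; apply: le_trans ti _; rewrite expr0 ler_wpM2r ?(ltW t0) // ler1n.
  have [h2|h2] := leP (L2 * (2 * t)) rho; last first.
    by apply: top; rewrite ler_pdivrMr // mulrC ltW.
  have r0 : 0 < 2 * (L1 * t) * c by rewrite !mulr_gt0.
  have Ox : O x by apply: room_in rx; exact: ltW.
  have Oy : O y by apply: room_in ry; exact: ltW.
  have e2 : 2 * (L1 * t) * c = 2 * (c * L1 * t) by ring.
  (* The new points have room 2 L1 t, which is what the induction hypothesis asks for step 2t. *)
  have [|z [zx rz]] := G1 x y _ Ox Oy r0; first by rewrite e2.
  have [|u [uy ru]] := G1 y x _ Oy Ox r0; first by rewrite e2 distrC.
  rewrite mulfK ?gt_eqF // in rz ru.
  have e3 : L1^-1 * (L1 * t) = t by rewrite mulKf // gt_eqF.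
  have e4 : L1 * t / c = Lam * t + q%:R * t by rewrite mulrAC L1c mulrDl.
  have e5 : c * (2 * c) * (L1 * t) = 2 * (c * c * L1 * t) by ring.
  have chx : chain O x z t (Lam * t + q%:R * t) (2 * (c * c * L1 * t)) N.
    have := HN x z (L1 * t) Lt0 rx (room_le rz _) _.
    rewrite e3 e4 e5; apply; first by rewrite ler_peMl ?ler1n // ltW.
    by apply: le_trans zx _; rewrite [leRHS]mulrAC.
  have chy : chain O y u t (Lam * t + q%:R * t) (2 * (c * c * L1 * t)) N.
    have := HN y u (L1 * t) Lt0 ry (room_le ru _) _.
    rewrite e3 e4 e5; apply; first by rewrite ler_peMl ?ler1n // ltW.
    by apply: le_trans uy _; rewrite [leRHS]mulrAC.
  have rad0 : 0 <= 2 * (c * c * L1 * t) by rewrite !mulr_ge0 // ltW.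
  have P1 := @move_fst q C Lam rho x y z t l _ _ N C_ge0 rho0 t0 rad0 HF _ _ _ _ chx _ sl hl.
  have P2 := @move_snd q C Lam rho z y u t l _ _ N C_ge0 rho0 t0 rad0 HF _ _ _ _ chy _ sl hl.
  have dzy : `|x - y| - 2 * (c * L1 * t) <= `|z - y|.
    by rewrite lerBlDl -e2; apply: le_trans (ler_distD z x y) _; rewrite lerD2r distrC.
  have dzu : `|z - y| - 2 * (c * L1 * t) <= `|z - u|.
    by rewrite lerBlDr -e2; apply: le_trans (ler_distD u z y) _; rewrite lerD2l.
  have [f1 f2 f3 f4] := step_arith rho0 (ltW (lt_le_trans t0 Lamt)) Lt cct ct Ldec qt0 dxy dzy dzu.
  have fz : Lam * t + q%:R * t <= 2 * (L1 * t).
    by apply: le_trans Ldec _; rewrite ler_peMl ?ler1n // ltW.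
  have rz1 := room_le rz fz; have ru1 := room_le ru fz.
  have f5 : Lam * t <= Lam * t + q%:R * t by rewrite lerDl.
  have f6 : Lam * t <= L1 * t := le_trans f5 Ldec.
  have {}P1 := P1 f5 f1 (room_le rx Ldec) (room_le ry f6) f2.
  have {}P2 := P2 f5 f1 (room_le ry Ldec) (room_le rz1 f5) f3.
  have P3 := @halve_steps q C Lam rho z u t l C_ge0 rho0 t0 HF f1 rz1 ru1 f4 sl hl.
  have t20 : 0 < 2 * t by exact: mulr_gt0.
  have P4 : `|Dl [seq 2%:R *: h | h <- l] F (z, u)| <= w (2 * t) * phi q rho (2 * t).
    apply: IH => //.
    - by rewrite mulrA -exprSr.
    - have -> : L1 * c * (2 * t) = 2 * (c * L1 * t) by ring.
      exact: distance_back dxy dzy dzu.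
    - by have -> : L1 * (2 * t) = 2 * (L1 * t) by ring.
    - by have -> : L1 * (2 * t) = 2 * (L1 * t) by ring.
    - by rewrite size_map.
    move=> _ /mapP[h /hl [dh th] ->]; split.
      by move: dh; rewrite /isdir /= => /orP[/eqP->|/eqP->]; rewrite scaler0 eqxx ?orbT.
    by rewrite normrZ ger0_norm // ler_pM2l.
  have trho2 : 2 * t <= rho.
    by apply: le_trans h2; rewrite ler_peMl ?(ltW t20) // (le_trans L11).
  apply: le_trans (wrec trho2).
  have P5 : 2 ^- q * `|Dl [seq 2%:R *: h | h <- l] F (z, u)| <=
      2 ^- q * (w (2 * t) * phi q rho (2 * t)).
    by apply: ler_wpM2l => //; rewrite invr_ge0 exprn_ge0.
  have P6 : `|Dl l F (x, y)| <= `|Dl l F (z, y) - Dl l F (x, y)|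
     + `|Dl l F (z, u) - Dl l F (z, y)| + `|Dl l F (z, u)|.
    rewrite -[X in `|X| <= _]subr0; apply: le_trans (ler_distD (Dl l F (z, y)) _ _) _.
    rewrite distrC -addrA lerD2l subr0 -[X in `|X| <= _]subr0.
    by apply: le_trans (ler_distD (Dl l F (z, u)) _ _) _; rewrite subr0 distrC.
  have -> : A * phi q.+1 rho t = 2 * (N%:R * (C * 2 ^+ (n + q.+1).+1 * phi q.+1 rho t))
     + q%:R * (C * 2 ^+ (n + q.+1).+1 * phi q.+1 rho t) by rewrite /A; ring.
  exact: combine_moves P6 P1 P2 P3 P5.
have [i hi] : exists i : nat, rho / L2 <= 2 ^+ i * t.
  exists (Num.truncn (rho / L2 / t)).+1; rewrite -ler_pdivrMr //.
  apply: (le_trans (ltW (truncnS_gt _))); rewrite -natrX ler_nat; exact/ltnW/ltn_expl.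
have [_ wJ _] : [/\ B <= w t, w t <= J & _] := Hw t t0 ltac:(by rewrite rhoE; apply: le_trans txy; rewrite ler_peMl ?(ltW t0) // (le_trans L11)).
apply: le_trans (main i x y t l t0 hi _ _ _ _ sl hl) _.
- by rewrite rhoE.
- by rewrite -rhoE lerDl !mulr_ge0 // ltW.
- by apply: room_le rx _; rewrite ler_pM2r.
- by apply: room_le ry _; rewrite ler_pM2r.
by rewrite -rhoE; apply: ler_wpM2r => //; apply: phi_ge0; exact: ltW.
Qed.

End Induction.
End MixedDifferences.

(** * Start of the descent: (2m+1)-fold differences *)

Section Base.
Variables (R : realType) (n m : nat) (d : R) (O : set 'rV[R]_n).
Local Notation V := 'rV[R]_n.
Local Notation W := 'rV[R]_2.
Local Notation E := (V * V)%type.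
Hypotheses (mn : (0 < m < n)%N) (d01 : 0 < d < 1).

Let d0 : 0 < d. Proof. by case/andP: d01. Qed.

Definition swap (p : E) : E := (p.2, p.1).

Lemma Dl_swapE (F : E -> W) l p : Dl l F p = Dl (map swap l) (F \o swap) (swap p).
Proof.
elim: l p => [|h l IH] p /=; first by case: p.
by rewrite !IH.
Qed.

Lemma norm_swap p : `|swap p| = `|p|.
Proof. by rewrite !prod_normE /= maxC. Qed.

Lemma Dl_inr (K : V -> V -> W) l x y :
  Dl [seq ((0, k) : E) | k <- l] (fun p => K p.1 p.2) (x, y) = Dl l (K x) y.
Proof.
elim: l y => //= h l IH y; rewrite -!IH; congr (Dl _ _ _ - _).
by congr (_, _); rewrite /= addr0.
Qed.

Definition pure_bound (C Lam : R) (K : V -> V -> W) := forall x y u t, O x -> 0 < t ->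
  room O y (Lam * t) -> Lam * t <= `|x - y| -> `|u| <= t ->
  `|Dl (nseq m.+1 u) (K x) y| <= C * `|x - y| `^ (- (n%:R + d)) * t `^ (m%:R + d).

(** The case where more than m steps move y alone: m+1 of them form a difference of K(x, .) bounded
    by [Dl_kemperman], and the other m steps are merely expanded. *)
Lemma half_base (K : V -> V -> W) C Lam : 0 < C -> 0 < Lam -> pure_bound C Lam K ->
  exists C' Lam', [/\ 0 <= C', 1 <= Lam' & forall x y t l, 0 < t ->
    room O x (Lam' * t) -> room O y (Lam' * t) -> Lam' * t <= `|x - y| ->
    size l = (m + m).+1 -> (m < count (fun h : E => h.1 == 0%R) l)%N ->
    (forall h : E, h \in l -> `|h| <= t) ->
    `|Dl l (fun p => K p.1 p.2) (x, y)| <= C' * phi n m d (m + m).+1 `|x - y| t].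
Proof.
move=> C0 Lam0 HK; pose r : R := m.+1%:R.
have r1 : 1 <= r by rewrite ler1n.
have r0 : 0 < r := lt_le_trans ltr01 r1.
have Lr0 : 0 < Lam * r by exact: mulr_gt0.
(* Kemperman's steps have length up to r t with r = m+1, so [pure_bound] is used at scale r t.
   Altogether x moves by at most r t and y by at most 2 r t, which explains 3 r; half of the
   distance is kept. *)
exists (2 ^+ (m + m).+1 * (C * 2 `^ (n%:R + d) * r `^ (m%:R + d))), (2 * (Lam * r + 3 * r)); split.
- by rewrite !mulr_ge0 ?exprn_ge0 ?powR_ge0 // ltW.
- lra.
move=> x y t l t0 rx ry txy sl cl hl.
set L := 2 * _ in rx ry txy.
have rt0 : 0 < r * t by exact: mulr_gt0.
have Lrt0 : 0 < Lam * (r * t) by exact: mulr_gt0.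
have Lt : L * t = 2 * (Lam * (r * t) + 3 * (r * t)) by rewrite /L; ring.
have mr : m%:R * t <= r * t by rewrite ler_pM2r // ler_nat.
have rho0 : 0 < `|x - y| by apply: lt_le_trans txy; rewrite Lt; lra.
pose l0 := [seq h <- l | h.1 == 0]; pose l1 := [seq h <- l | ~~ (h.1 == 0)].
pose l2 := take m.+1 l0; pose l3 := l1 ++ drop m.+1 l0.
have s2 : size l2 = m.+1 by rewrite size_takel // size_filter.
have pl : perm_eq l (l3 ++ l2).
  rewrite perm_sym /l3 /l2 -catA; apply: (@perm_trans _ (l1 ++ l0)).
    by rewrite perm_cat2l perm_catC cat_take_drop.
  by rewrite perm_catC perm_filterC.
have s3 : size l3 = m.
  by have := perm_size pl; rewrite sl size_cat s2 addnS => -[] /addIn.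
have hl' h : h \in l3 ++ l2 -> `|h| <= t by move=> hh; apply: hl; rewrite (perm_mem pl).
rewrite (Dl_perm _ _ pl) Dl_cat.
have -> : 2 ^+ (m + m).+1 * (C * 2 `^ (n%:R + d) * r `^ (m%:R + d)) *
     phi n m d (m + m).+1 `|x - y| t
  = 2 ^+ size l3 * (2 ^+ m.+1 * (C * (2 `^ (n%:R + d) * `|x - y| `^ (- (n%:R + d))) *
     (r * t) `^ (m%:R + d))).
  rewrite /phi leqNgt ltnS leq_addr /= s3 -addnS exprD powRM ?(ltW r0) ?(ltW t0) //; ring.
apply: (@Dl_bound _ _ _ _ _ _ t); first by move=> h hh; apply: hl'; rewrite mem_cat hh.
move=> [x' y']; rewrite s3 dist_prod ge_max => /andP[hx hy].
have Ox' : O x' by apply: rx; apply: le_trans hx _; rewrite Lt; lra.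
have l2E : l2 = [seq ((0, k) : E) | k <- map snd l2].
  rewrite -map_comp -[LHS]map_id; apply/eq_in_map => -[h k] /mem_take.
  by rewrite mem_filter /= => /andP[/eqP -> _].
rewrite l2E Dl_inr.
have -> : 2 ^+ m.+1 = 2 ^+ size (map snd l2) :> R by rewrite size_map s2.
apply: (@Dl_kemperman _ _ _ _ _ _ t).
  move=> k /mapP[h hh ->]; apply: le_trans (norm_snd _) _.
  by apply: hl'; rewrite mem_cat hh orbT.
rewrite size_map s2 => y'' u hy'' hu.
have hyy : `|y'' - y| <= 2 * (r * t).
  by apply: le_trans (ler_distD y' _ _) _; rewrite /r in mr *; lra.
have hd : `|x - y| / 2 + Lam * (r * t) <= `|x' - y''|.
  apply: (dist_shift hx hyy); rewrite Lt in txy; lra.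
apply: le_trans (HK _ _ u (r * t) Ox' rt0 _ _ hu) _.
- by apply: room_shift ry _; rewrite Lt; lra.
- by apply: le_trans hd; rewrite lerDr divr_ge0.
rewrite -!mulrA; apply: ler_wpM2l; first exact: ltW.
rewrite mulrA; apply: ler_wpM2r; first exact: powR_ge0.
apply: powR_half_le => //; first by rewrite ltr_wpDl.
by apply: le_trans hd; rewrite lerDl ltW.
Qed.

Lemma diff_bound_le q C C' Lam Lam' F : C <= C' -> Lam <= Lam' ->
  diff_bound m d O q C Lam F -> diff_bound m d O q C' Lam' F.
Proof.
move=> CC LL H x y t l t0 rx ry txy sl hl.
have LLt : Lam * t <= Lam' * t by rewrite ler_pM2r.
apply: le_trans (H _ _ t _ t0 (room_le rx LLt) (room_le ry LLt) (le_trans LLt txy) sl hl) _.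
by apply: ler_wpM2r => //; apply: phi_ge0; exact: ltW.
Qed.

(** If at most m of the 2m+1 steps move y alone, at least m+1 move x alone, and exchanging the
    variables reduces to [half_base]. *)
Lemma diff_bound_base (K : V -> V -> W) C1 Lam1 C2 Lam2 : 0 < C1 -> 0 < Lam1 -> 0 < C2 -> 0 < Lam2 ->
  pure_bound C1 Lam1 K -> pure_bound C2 Lam2 (fun x y => K y x) ->
  exists C Lam, [/\ 0 <= C, 1 <= Lam & diff_bound m d O (m + m).+1 C Lam (fun p => K p.1 p.2)].
Proof.
move=> C10 L10 C20 L20 H1 H2.
have [C [Lam [C0 Lam0 H]]] := half_base C10 L10 H1.
have [C' [Lam' [C'0 Lam'0 H']]] := half_base C20 L20 H2.
exists (Num.max C C'), (Num.max Lam Lam'); split; rewrite ?le_max ?C0 ?Lam0 //.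
move=> x y t l t0 rx ry txy sl hl.
have Lt : Lam * t <= Num.max Lam Lam' * t by rewrite ler_pM2r // le_max lexx.
have Lt' : Lam' * t <= Num.max Lam Lam' * t by rewrite ler_pM2r // le_max lexx orbT.
have ph := phi_ge0 n m d (m + m).+1 `|x - y| (ltW t0).
have [cl|cl] := ltnP m (count (fun h : E => h.1 == 0%R) l).
  apply: (le_trans (H _ _ t _ t0 (room_le rx Lt) (room_le ry Lt) (le_trans Lt txy) sl cl _)).
    by move=> h /hl [].
  by apply: ler_wpM2r => //; rewrite le_max lexx.
rewrite Dl_swapE distrC.
apply: (@le_trans _ _ (C' * phi n m d (m + m).+1 `|y - x| t)).
  apply: (H' _ _ t) => //; try exact: room_le Lt'.
  - by rewrite distrC; exact: le_trans txy.
  - by rewrite size_map.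
  - rewrite count_map -(leq_add2l m); apply: (@leq_trans (size l)).
      by rewrite sl addnS.
    rewrite (_ : size l = count (predU (fun h : E => h.1 == 0%R)
        (preim swap (fun h : E => h.1 == 0%R))) l); last first.
      by apply/esym/eqP; rewrite -all_count; apply/allP => h /hl [].
    apply: (@leq_trans (count (fun h : E => h.1 == 0%R) l + count (preim swap (fun h : E => h.1 == 0%R)) l)).
      by rewrite -count_predUI leq_addr.
    by rewrite leq_add2r.
  by move=> _ /mapP[h /hl [_ th] ->]; rewrite norm_swap.
by apply: ler_wpM2r; rewrite 1?distrC // le_max lexx orbT.
Qed.

Lemma diff_bound_all (c C0 : R) (F : E -> W) C Lam Q : 1 <= c -> chainable O c -> 0 <= C0 ->
  (forall x y, O x -> O y -> x != y -> `|F (x, y)| <= C0 * `|x - y| `^ (m%:R - n%:R)) ->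
  0 <= C -> 1 <= Lam -> diff_bound m d O Q C Lam F ->
  exists C' Lam', [/\ 0 <= C', 1 <= Lam' & forall q, (q <= Q)%N -> diff_bound m d O q C' Lam' F].
Proof.
move=> c1 cO C00 sF; elim: Q C Lam => [|Q IH] C Lam C_ge0 Lam1 H.
  by exists C, Lam; split=> // q; rewrite leqn0 => /eqP->.
have [C' [Lam' [C'0 Lam'1 H']]] := diff_bound_step mn d01 c1 cO C00 sF C_ge0 Lam1 H.
have [C2 [Lam2 [C20 Lam21 H2]]] := IH _ _ C'0 Lam'1 H'.
exists (Num.max C C2), (Num.max Lam Lam2); split; rewrite ?le_max ?C_ge0 ?Lam1 //.
move=> q; rewrite leq_eqVlt ltnS => /orP[/eqP->|qQ].
  by apply: diff_bound_le H; rewrite le_max lexx.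
by apply: diff_bound_le (H2 q qQ); rewrite le_max lexx orbT.
Qed.

End Base.

(** * Difference quotients *)

Lemma two_lt_powR (R : realType) (d : R) : 0 < d -> 2 < 2 `^ (1 + d).
Proof.
move=> d0; rewrite powRD ?pnatr_eq0 ?implybT // powRr1 // ltr_pMr //.
have : (1 : R) `^ d < 2 `^ d by apply: gt0_ltr_powR; rewrite ?nnegrE ?ltr1n.
by rewrite powR1.
Qed.

(** The solution A of A 2^(1+d) = 2 A + 1 + 2^(1+d), the balance in the induction of [approx_mul];
    it is positive because 2^(1+d) > 2. *)
Definition quotient_cst (R : realType) (d : R) : R := (1 + 2 `^ (1 + d)) / (2 `^ (1 + d) - 2).

Lemma quotient_cst_ge0 (R : realType) (d : R) : 0 < d -> 0 <= quotient_cst d.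
Proof.
move=> /two_lt_powR h; apply: divr_ge0; first by rewrite addr_ge0 ?powR_ge0.
by rewrite subr_ge0 ltW.
Qed.

Section Quotients.
Variables (R : realType) (W : normedModType R) (u : R -> W) (t0 d M M1 : R).
Hypotheses (d0 : 0 < d) (M_ge0 : 0 <= M) (M1_ge0 : 0 <= M1).
Hypothesis u_add : forall a b t, 0 <= a <= t -> 0 <= b <= t -> t <= t0 ->
  `|u (a + b) - u a - u b| <= M * t `^ (1 + d).
Hypothesis u_lip : forall t, 0 <= t <= t0 -> `|u t| <= M1 * t.

Let d1_ge0 : 0 <= 1 + d. Proof. by rewrite addr_ge0 // ltW. Qed.

(** Binary halving: write N = 2k, plus 1 if N is odd. The error for k is doubled, but the admissible
    error grows by 2^(1+d), which leaves space for the two additivity defects. *)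
Lemma approx_mul N h : (0 < N)%N -> 0 <= h -> N%:R * h <= t0 ->
  `|u (N%:R * h) - N%:R *: u h| <= quotient_cst d * M * (N%:R * h) `^ (1 + d).
Proof.
move=> + h0; elim/ltn_ind: N => N IH N0 Nh.
have A0 := quotient_cst_ge0 d0; have two_lt := two_lt_powR d0.
set a := 2 `^ (1 + d) in two_lt *.
have AE : quotient_cst d * a = 2 * quotient_cst d + 1 + a.
  have : quotient_cst d * (a - 2) = 1 + a.
    by rewrite /quotient_cst -/a divfK // gt_eqF // subr_gt0.
  lra.
have [N1|N1] := leqP N 1.
  have -> : N = 1%N by apply/eqP; rewrite eqn_leq N1.
  by rewrite mul1r scale1r subrr normr0; apply: mulr_ge0; [exact: mulr_ge0|exact: powR_ge0].
have NE := odd_double_half N; set k := N./2 in NE.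
have k0 : (0 < k)%N by rewrite /k half_gt0.
have kN : (k < N)%N by rewrite /k -divn2 ltn_Pdiv.
pose X := k%:R * h.
have X0 : 0 <= X by rewrite mulr_ge0.
have k2N : (k.*2 <= N)%N by rewrite -[leqRHS]NE leq_addl.
have X2 : 2 * X <= N%:R * h.
  by rewrite /X mulrA ler_wpM2r // -natrM mul2n ler_nat.
have XX : X <= 2 * X by rewrite ler_peMl // ler1n.
have hk := IH k kN k0 (le_trans (le_trans XX X2) Nh).
have kk : `|u (2 * X) - u X - u X| <= M * X `^ (1 + d).
  have -> : 2 * X = X + X by rewrite mulr2n mulrDl mul1r.
  by apply: u_add; rewrite ?X0 ?lexx // (le_trans XX) // (le_trans X2).
have Y0 : 0 <= X `^ (1 + d) by exact: powR_ge0.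
have aX : (2 * X) `^ (1 + d) = a * X `^ (1 + d) by rewrite powRM.
have odd_part : `|u (N%:R * h) - u (2 * X) - (odd N)%:R *: u h| <= M * (a * X `^ (1 + d)).
  have -> : N%:R * h = 2 * X + (odd N)%:R * h.
    by rewrite -[in LHS]NE natrD -muln2 natrM /X; ring.
  case: (odd N); last first.
    by rewrite mul0r scale0r addr0 subr0 subrr normr0 !mulr_ge0 ?powR_ge0.
  rewrite scale1r mul1r -aX; apply: u_add; last exact: le_trans Nh.
    by rewrite mulr_ge0 /=.
  rewrite h0 /=; apply: le_trans XX; rewrite /X -[leLHS]mul1r ler_wpM2r // ler1n //.
have -> : u (N%:R * h) - N%:R *: u h = (u (N%:R * h) - u (2 * X) - (odd N)%:R *: u h)
   + ((u (2 * X) - u X - u X) + 2 *: (u X - k%:R *: u h)).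
  have -> : N%:R = (odd N)%:R + 2 * k%:R :> R by rewrite -[in LHS]NE natrD -muln2 natrM mulrC.
  by lmod R.
apply: (le_trans (ler_normD _ _)); apply: (@le_trans _ _ (M * (a * X `^ (1 + d)) +
   (M * X `^ (1 + d) + 2 * (quotient_cst d * M * X `^ (1 + d))))).
  apply: lerD => //; apply: (le_trans (ler_normD _ _)); apply: lerD => //.
  by rewrite normrZ ger0_norm // ler_pM2l.
have -> : M * (a * X `^ (1 + d)) + (M * X `^ (1 + d) + 2 * (quotient_cst d * M * X `^ (1 + d)))
   = quotient_cst d * M * (2 * X) `^ (1 + d).
  rewrite aX (_ : quotient_cst d * M * (a * _) = quotient_cst d * a * (M * X `^ (1 + d))).
    by rewrite AE; ring.
  by ring.
apply: ler_wpM2l; first exact: mulr_ge0.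
by apply: ge0_ler_powR; rewrite ?nnegrE ?mulr_ge0.
Qed.

(** Write t = N h + r with 0 <= r <= h. The Lipschitz bound serves only for the remainder r, and its
    contribution vanishes as h tends to 0. *)
Lemma quotient_small h t : 0 < h -> h <= t -> t <= t0 ->
  `|t^-1 *: u t - h^-1 *: u h| <= (quotient_cst d + 1) * M * t `^ d + 2 * M1 * (h / t).
Proof.
move=> h0 ht tt0; have t_gt0 := lt_le_trans h0 ht.
pose N := Num.truncn (t / h); pose r := t - N%:R * h.
have th0 : 0 <= t / h by rewrite divr_ge0 ?(ltW t_gt0) ?(ltW h0).
have /andP[N1 N2] := truncn_itv th0; rewrite -/N in N1 N2.
have N0 : (0 < N)%N by rewrite /N truncn_gt0 ler_pdivlMr // mul1r.
have Nht : N%:R * h <= t by rewrite -ler_pdivlMr.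
have r0 : 0 <= r by rewrite subr_ge0.
have rh : r <= h.
  by rewrite lerBlDr -{1}[h]mul1r -mulrDl nat1r -ler_pdivrMr // ltW.
have A0 := (quotient_cst_ge0 d0).
have tE : t = N%:R * h + r by rewrite /r; ring.
have e1 := approx_mul N0 (ltW h0) (le_trans Nht tt0).
have Nh0 : 0 <= N%:R * h by rewrite mulr_ge0 // ltW.
have e2 : `|u t - u (N%:R * h) - u r| <= M * t `^ (1 + d).
  by rewrite {1}tE; apply: u_add; rewrite ?Nh0 ?r0 //= (le_trans rh).
have e3 : `|u r| <= M1 * h.
  apply: le_trans (u_lip _) _; first by rewrite r0 (le_trans rh) // (le_trans ht).
  by rewrite ler_wpM2l.
have e4 : `|u h| <= M1 * h by apply: u_lip; rewrite ltW //= (le_trans ht).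
have -> : t^-1 *: u t - h^-1 *: u h =
   t^-1 *: ((u t - u (N%:R * h) - u r) + (u (N%:R * h) - N%:R *: u h) + (u r - (r / h) *: u h)).
  have -> : u t - u (N%:R * h) - u r + (u (N%:R * h) - N%:R *: u h) + (u r - (r / h) *: u h)
    = u t - (t / h) *: u h.
    have -> : t / h = N%:R + r / h by rewrite /r; field; rewrite gt_eqF.
    by lmod R.
  by rewrite scalerBr scalerA mulKf // gt_eqF.
rewrite normrZ gtr0_norm ?invr_gt0 // mulrC ler_pdivrMr //.
have tp : t `^ (1 + d) = t * t `^ d.
  by rewrite powRD ?(gt_eqF t_gt0) ?implybT // powRr1 // ltW.
have -> : ((quotient_cst d + 1) * M * t `^ d + 2 * M1 * (h / t)) * t =
   M * t `^ (1 + d) + quotient_cst d * M * t `^ (1 + d) + (M1 * h + M1 * h).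
  by rewrite tp; field; rewrite gt_eqF.
apply: le_trans (ler_normD _ _) _; apply: lerD; first (apply: le_trans (ler_normD _ _) _; apply: lerD => //).
  apply: le_trans e1 _; apply: ler_wpM2l; first by rewrite mulr_ge0.
  by apply: ge0_ler_powR; rewrite ?nnegrE ?(ltW t_gt0).
apply: le_trans (ler_normB _ _) _; apply: lerD => //.
rewrite normrZ ger0_norm ?divr_ge0 ?(ltW h0) // -[leRHS]mul1r ler_pM ?divr_ge0 ?(ltW h0) //.
by rewrite ler_pdivrMr // mul1r.
Qed.

(** Both quotients are compared with the one at a common tiny h, and then the Lipschitz constant
    [M1] disappears from the bound. *)
Lemma quotient_dist t t' : 0 < t -> t <= t0 -> 0 < t' -> t' <= t0 ->
  `|t^-1 *: u t - t'^-1 *: u t'| <= (quotient_cst d + 1) * M * (t `^ d + t' `^ d).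
Proof.
move=> t_gt0 tt0 t'0 t't0; apply/ler_addgt0Pr => e e0.
pose k := 2 * M1 * (t^-1 + t'^-1) + 1.
have k0 : 0 < k by rewrite ltr_wpDl // !mulr_ge0 // addr_ge0 // invr_ge0 ltW.
pose h := Num.min (Num.min t t') (e / k).
have h0 : 0 < h by rewrite !lt_min t_gt0 t'0 divr_gt0.
have ht : h <= t by rewrite /h !ge_min lexx.
have ht' : h <= t' by rewrite /h !ge_min lexx orbT.
have he : h * k <= e by rewrite -ler_pdivlMr // /h ge_min lexx orbT.
have H1 := quotient_small h0 ht tt0; have H2 := quotient_small h0 ht' t't0.
apply: le_trans (ler_distD (h^-1 *: u h) _ _) _.
rewrite [X in _ + X <= _]distrC; apply: le_trans (lerD H1 H2) _.
have -> : (quotient_cst d + 1) * M * t `^ d + 2 * M1 * (h / t) +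
  ((quotient_cst d + 1) * M * t' `^ d + 2 * M1 * (h / t')) =
  (quotient_cst d + 1) * M * (t `^ d + t' `^ d) + (h * k - h) by rewrite /k; ring.
rewrite lerD2l; apply: le_trans he; by rewrite gerBl ltW.
Qed.

End Quotients.

Section QuotientLimit.
Variables (R : realType) (k : nat) (u : R -> 'rV[R]_k) (t0 d M M1 : R).
Hypotheses (t0_gt0 : 0 < t0) (d0 : 0 < d) (M_ge0 : 0 <= M) (M1_ge0 : 0 <= M1).
Hypothesis u_add : forall a b t, 0 <= a <= t -> 0 <= b <= t -> t <= t0 ->
  `|u (a + b) - u a - u b| <= M * t `^ (1 + d).
Hypothesis u_lip : forall t, 0 <= t <= t0 -> `|u t| <= M1 * t.
Hypothesis u_opp : forall t, 0 <= t <= t0 -> `|u (- t) + u t| <= M * t `^ (1 + d).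

Lemma quotient_cvg : cvg ((fun s => s^-1 *: u s) @ 0^').
Proof.
apply: cauchy_cvg; apply: cauchy_exP => e e0.
(* The first term bounds the variation of the quotient over ]0, tau], the second the passage to
   negative s by [u_opp], and 1 makes the inequality strict. *)
pose A := (quotient_cst d + 1) * M * 2 + M + 1.
have A0 : 0 < A.
  by rewrite ltr_wpDl // addr_ge0 // !mulr_ge0 // addr_ge0 // (quotient_cst_ge0 d0).
pose tau := Num.min t0 ((e / A) `^ (d^-1)).
have tau0 : 0 < tau by rewrite lt_min t0_gt0 powR_gt0 // divr_gt0.
have taut : tau <= t0 by rewrite ge_min lexx.
have taud : A * tau `^ d <= e.
  rewrite mulrC -ler_pdivlMr //; apply: (@le_trans _ _ (((e / A) `^ (d^-1)) `^ d)).
    by apply: ge0_ler_powR; rewrite ?nnegrE ?powR_ge0 ?(ltW tau0) ?(ltW d0) // ge_min lexx orbT.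
  by rewrite -powRrM mulVf ?gt_eqF // powRr1 // divr_ge0 ?(ltW e0) ?(ltW A0).
exists (tau^-1 *: u tau); rewrite /nbhs /=.
have taudp : 0 < tau `^ d by exact: powR_gt0.
have main s : 0 < s -> s < tau -> `|tau^-1 *: u tau - s^-1 *: u s| + M * s `^ d < e.
  move=> s0 st; have stau := ltW st.
  have := quotient_dist d0 M_ge0 M1_ge0 u_add u_lip tau0 taut s0 (le_trans stau taut).
  have sd : s `^ d <= tau `^ d by apply: ge0_ler_powR; rewrite ?nnegrE ?(ltW s0) ?(ltW tau0) // ltW.
  move=> h; apply: lt_le_trans taud.
  have h1 : M * s `^ d <= M * tau `^ d by rewrite ler_wpM2l.
  have h2 : (quotient_cst d + 1) * M * (tau `^ d + s `^ d)
      <= (quotient_cst d + 1) * M * 2 * tau `^ d.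
    rewrite -[leRHS]mulrA; apply: ler_wpM2l; last by lra.
    by rewrite mulr_ge0 ?addr_ge0 ?(quotient_cst_ge0 d0).
  rewrite /A !mulrDl mul1r; lra.
near=> s; rewrite -ball_normE /=.
have s_neq0 : s != 0 by near: s; exact: nbhs_dnbhs_neq.
have sm : `|s| < tau.
  near: s; apply: dnbhs0_lt; exact: tau0.
case: (ltrgtP s 0) s_neq0 => // [s0|s0] _.
  have ms0 : 0 < - s by rewrite oppr_gt0.
  rewrite ltr0_norm // in sm.
  apply: le_lt_trans (main _ ms0 sm).
  rewrite invrN; have := u_opp (t := - s); rewrite opprK (ltW ms0) /= => H.
  have {}H := H (le_trans (ltW sm) taut).
  apply: le_trans (ler_distD ((- s^-1) *: u (- s)) _ _) _; rewrite lerD2l.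
  rewrite (_ : _ - _ = (- s^-1) *: (u s + u (- s))); last by lmod R.
  rewrite normrZ -invrN gtr0_norm ?invr_gt0 // mulrC ler_pdivrMr //.
  apply: le_trans H _; rewrite powRD ?(gt_eqF ms0) ?implybT // powRr1 ?(ltW ms0) //.
  by rewrite mulrCA mulrC.
rewrite gtr0_norm // in sm; apply: le_lt_trans (main _ s0 sm).
by rewrite lerDl mulr_ge0 // powR_ge0.
Unshelve. all: by end_near. Qed.

End QuotientLimit.

(** * Derivatives *)

Section QuotientDifferences.
Variables (R : realType) (E W : normedModType R).

Lemma Dl_cvg (T : Type) (Fi : set_system T) {FF : Filter Fi} (f : T -> E -> W) g l p t :
  (forall h, h \in l -> `|h| <= t) ->
  (forall p', `|p' - p| <= (size l)%:R * t -> f^~ p' @ Fi --> g p') ->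
  (fun s => Dl l (f s) p) @ Fi --> Dl l g p.
Proof.
elim: l p => [|h l IH] p hl fg /=.
  by apply: fg; rewrite subrr normr0 mul0r.
have ht : `|h| <= t by apply: hl; rewrite mem_head.
have hl' h' : h' \in l -> `|h'| <= t by move=> hh; apply: hl; rewrite inE hh orbT.
apply: cvgB; apply: IH => // p' hp; apply: fg; rewrite /= -natr1 mulrDl mul1r.
  by apply: le_trans (ler_distD (p + h) _ _) _; apply: lerD; rewrite // addrAC subrr add0r.
by apply: le_trans hp _; rewrite lerDl; exact: le_trans ht.
Qed.

Lemma lim_close (f : R -> W) (a b : W) B r : 0 < r -> f @ 0^' --> a ->
  (forall s, 0 < s -> s < r -> `|f s - b| <= B) -> `|a - b| <= B.
Proof.
move=> r0 fa fb; apply/ler_addgt0Pr => e e0.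
have /cvgrPdist_lt/(_ e e0) := fa; rewrite /dnbhs near_withinE => /nbhs_normP[r' /= r'0 H].
pose s := Num.min r r' / 2.
have s0 : 0 < s by rewrite divr_gt0 // lt_min r0.
have sm : s < Num.min r r' by rewrite ltr_pdivrMr // ltr_pMr ?ltr1n // lt_min r0.
apply: le_trans (ler_distD (f s) _ _) _; rewrite addrC; apply: lerD.
  by apply: fb => //; apply: lt_le_trans sm _; rewrite ge_min lexx.
apply/ltW/H; last by rewrite gt_eqF.
by rewrite /= sub0r normrN gtr0_norm //; apply: lt_le_trans sm _; rewrite ge_min lexx orbT.
Qed.

(** The summands are in the order used by [derive]. *)
Definition quot (e : E) (F : E -> W) (s : R) (p : E) : W := s^-1 *: (F (s *: e + p) - F p).

Lemma Dl_quot e F s l p : Dl l (quot e F s) p = s^-1 *: Dl (s *: e :: l) F p.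
Proof.
rewrite Dl_consr -DlZ; congr (Dl l _ p).
by apply/funext => p'; rewrite /quot /D1 [_ + p']addrC.
Qed.

End QuotientDifferences.

Section SmoothnessClasses.
Variables (R : realType) (n m : nat) (d : R) (O : set 'rV[R]_n).
Local Notation V := 'rV[R]_n.
Local Notation W := 'rV[R]_2.
Local Notation E := (V * V)%type.
Hypotheses (mn : (0 < m < n)%N) (d01 : 0 < d < 1) (oO : open O).

Let d0 : 0 < d. Proof. by case/andP: d01. Qed.
Let d1 : d < 1. Proof. by case/andP: d01. Qed.

(* The bounds expected of an [i]-th derivative of a standard kernel. *)
Definition smooth_class (i : nat) (C Lam : R) (F : E -> W) : Prop :=
  forall q, (q + i <= m.+1)%N -> forall x y t l, 0 < t ->
    room O x (Lam * t) -> room O y (Lam * t) -> Lam * t <= `|x - y| -> size l = q ->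
    (forall h, h \in l -> isdir h /\ `|h| <= t) ->
    `|Dl l F (x, y)| <= C * (phi n m d (q + i) `|x - y| t / t ^+ i).

Lemma phi_low q i rho t : 0 < t -> (q + i <= m)%N ->
  phi n m d (q + i) rho t / t ^+ i = rho `^ (m%:R - n%:R - (q + i)%:R) * t ^+ q.
Proof.
move=> t0 h; rewrite /phi h exprD mulrA mulfK // expf_neq0 //; exact: lt0r_neq0.
Qed.

Lemma phi_high q i rho t : 0 < t -> (q + i = m)%N ->
  phi n m d (q.+1 + i) rho t / t ^+ i = rho `^ (- (n%:R + d)) * (t ^+ q * t `^ d).
Proof.
move=> t0 h; rewrite /phi addSn h ltnn -h powRD ?(gt_eqF t0) ?implybT //.
rewrite powR_mulrn ?(ltW t0) // exprD -!mulrA; congr (_ * (_ * _)).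
by rewrite mulrC divfK // expf_neq0 // lt0r_neq0.
Qed.

(** For lists that mix short steps s with long steps t. Each long step is cut into N pieces of
    length at most s, with N at most 2 t/s, so that [Dl_scale] applies. *)
Lemma smooth_class_scale i C Lam F q1 q2 x y s t l1 l2 : 0 <= C -> 1 <= Lam ->
  smooth_class i C Lam F -> (q2 + q1 + i <= m.+1)%N -> 0 < s -> s <= t ->
  room O x ((Lam + q2%:R) * t) -> room O y ((Lam + q2%:R) * t) ->
  2 * ((Lam + 2 * q2%:R) * t) <= `|x - y| ->
  size l1 = q1 -> size l2 = q2 ->
  (forall h, h \in l1 -> isdir h /\ `|h| <= s) ->
  (forall h, h \in l2 -> isdir h /\ `|h| <= t) ->
  `|Dl (l2 ++ l1) F (x, y)| <=
   C * 2 ^+ (n + m.+1).+1 * 2 ^+ m.+1 * ((t / s) ^+ q2 * (phi n m d (q1 + q2 + i) `|x - y| s / s ^+ i)).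
Proof.
move=> C0 Lam1 HF qi s0 st rx ry txy sl1 sl2 hl1 hl2.
have t0 := lt_le_trans s0 st.
have ts1 : 1 <= t / s by rewrite ler_pdivlMr // mul1r.
pose N := (Num.truncn (t / s)).+1.
have N0 : 0 < N%:R :> R by rewrite ltr0n.
have N1 : t / N%:R <= s.
  by rewrite ler_pdivrMr // mulrC -ler_pdivrMr // ltW // truncnS_gt.
have N2 : N%:R <= 2 * (t / s).
  have /andP[] := truncn_itv (le_trans ler01 ts1); rewrite /N -natr1; lra.
pose l3 := [seq N%:R^-1 *: h | h <- l2].
have l23 : l2 = [seq N%:R *: h | h <- l3].
  rewrite -map_comp -[LHS]map_id; apply: eq_map => h /=.
  by rewrite scalerA divff ?scale1r // gt_eqF.
have s3 : size l3 = q2 by rewrite size_map.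
set rho := `|x - y|.
have rho0 : 0 < rho.
  apply: lt_le_trans txy; rewrite !mulr_gt0 // ltr_wpDr ?mulr_ge0 //.
  exact: lt_le_trans Lam1.
have hl3 h : h \in l3 -> isdir h /\ `|h| <= t / N%:R.
  move=> /mapP[k /hl2 [dk tk] ->]; split.
    by move: dk; rewrite /isdir /= => /orP[/eqP->|/eqP->]; rewrite scaler0 eqxx ?orbT.
  by rewrite normrZ gtr0_norm ?invr_gt0 // mulrC ler_pM2r // invr_gt0.
have Lst : Lam * s <= Lam * t by rewrite ler_pM2l // (lt_le_trans ltr01).
have q2t : 0 <= q2%:R * t by rewrite mulr_ge0 // ltW.
rewrite Dl_cat l23.
have -> : C * 2 ^+ (n + m.+1).+1 * 2 ^+ m.+1 *
  ((t / s) ^+ q2 * (phi n m d (q1 + q2 + i) rho s / s ^+ i)) =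
  2 ^+ m.+1 * (t / s) ^+ q2 *
  (C * (2 ^+ (n + m.+1).+1 * phi n m d (q1 + q2 + i) rho s / s ^+ i)) by ring.
set B := C * _.
have B0 : 0 <= B by rewrite /B mulr_ge0 // mulr_ge0 ?invr_ge0 ?exprn_ge0 ?(ltW s0) // mulr_ge0 ?exprn_ge0 ?phi_ge0 ?(ltW s0).
apply: (@le_trans _ _ (N%:R ^+ q2 * B)); last first.
  apply: ler_wpM2r => //; apply: (@le_trans _ _ ((2 * (t / s)) ^+ q2)).
    by rewrite lerXn2r ?nnegrE // mulr_ge0 // (le_trans _ ts1).
  rewrite exprMn; apply: ler_wpM2r; first by rewrite exprn_ge0 // (le_trans _ ts1).
  by apply: ler_weXn2l; rewrite ?ler1n //; apply: leq_trans qi; rewrite -addnA leq_addr.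
rewrite -natrX -s3; apply: (Dl_scale (t := t / N%:R)) => //; first by move=> h /hl3 [].
move=> [x' y']; rewrite s3 natrM -mulrA [N%:R * _]mulrC divfK ?gt_eqF //.
rewrite dist_prod ge_max => /andP[hx hy].
have hd : rho / 2 + Lam * t <= `|x' - y'|.
  apply: (dist_shift hx hy); move: txy; rewrite -/rho; clear -q2t; lra.
rewrite -Dl_cat.
apply: (@le_trans _ _ (C * (phi n m d (q1 + q2 + i) `|x' - y'| s / s ^+ i))).
  apply: HF => //.
  - by rewrite [(q1 + q2)%N]addnC.
  - by apply: (room_shift rx); rewrite mulrDl [leRHS]addrC; apply: lerD.
  - by apply: (room_shift ry); rewrite mulrDl [leRHS]addrC; apply: lerD.
  - apply: le_trans hd; apply: (le_trans Lst); rewrite lerDr; apply: divr_ge0 => //; exact: ltW.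
  - by rewrite size_cat s3 sl1 addnC.
  move=> h; rewrite mem_cat => /orP[/hl3[dh hh]|/hl1 //]; split=> //.
  exact: le_trans N1.
rewrite /B; apply: ler_wpM2l => //; apply: ler_wpM2r; first by rewrite invr_ge0 exprn_ge0 // ltW.
apply: (@le_trans _ _ (2 ^+ (n + (q1 + q2 + i)).+1 * phi n m d (q1 + q2 + i) rho s)).
  apply: phi_half => //; first exact: ltW.
  by apply: le_trans hd; rewrite lerDl mulr_ge0 ?(ltW t0) // (le_trans _ Lam1).
apply: ler_wpM2r; first by apply: phi_ge0; exact: ltW.
by apply: ler_weXn2l; rewrite ?ler1n // ltnS leq_add2l [(q1 + q2)%N]addnC.
Qed.

Lemma open_room x : O x -> exists2 r, 0 < r & room O x r.
Proof.
move=> Ox; have /nbhs_normP[r /= r0 hr] : nbhs x O by exact: open_nbhs_nbhs.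
exists (r / 2); first exact: divr_gt0.
move=> z zx; apply: hr => /=; rewrite distrC; apply: le_lt_trans zx _.
by rewrite ltr_pdivrMr // ltr_pMr // ltr1n.
Qed.

Lemma second_add (Psi : E -> W) (p e : E) (a b : R) (u := fun a => Psi (p + a *: e) - Psi p) :
  u (a + b) - u a - u b = Dl [:: a *: e; b *: e] Psi p.
Proof. by rewrite /u /= scalerDl addrA; lmod R. Qed.

Lemma second_opp (Psi : E -> W) (p e : E) (t : R) (u := fun a => Psi (p + a *: e) - Psi p) :
  u (- t) + u t = Dl [:: t *: e; t *: e] Psi (p - t *: e).
Proof. by rewrite /u /= scaleNr subrK; lmod R. Qed.

Lemma isdirZ a (e : E) : isdir e -> isdir (a *: e).
Proof. by rewrite /isdir /= => /orP[/eqP->|/eqP->]; rewrite scaler0 eqxx ?orbT. Qed.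

Lemma smooth_class_local i C Lam F x y : 0 <= C -> 1 <= Lam ->
  smooth_class i C Lam F -> O x -> O y -> x != y ->
  exists2 t0, 0 < t0 <= 1 & forall q l p' s, (q + i <= m.+1)%N -> 0 < s -> s <= t0 -> size l = q ->
    (forall h, h \in l -> isdir h /\ `|h| <= s) -> `|p' - (x, y)| <= s ->
    `|Dl l F p'| <= C * 2 ^+ (n + (q + i)).+1 * (phi n m d (q + i) `|x - y| s / s ^+ i).
Proof.
move=> C0 Lam1 HF Ox Oy xy; have Lam0 := lt_le_trans ltr01 Lam1.
have [r r0 rx] := open_room Ox; have [r' r'0 ry] := open_room Oy.
have rho0 : 0 < `|x - y| by rewrite normr_gt0 subr_eq0.
set rho := `|x - y| in rho0 *.
pose t0 := Num.min 1 (Num.min (Num.min r r') (rho / 4) / (Lam + 2)).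
have L2 : 0 < Lam + 2 by rewrite addr_gt0.
have t00 : 0 < t0 by rewrite !lt_min ltr01 divr_gt0 // !lt_min r0 r'0 divr_gt0.
have t01 : t0 <= 1 by rewrite ge_min lexx.
exists t0; first by rewrite t00.
have Lt0 : (Lam + 2) * t0 <= Num.min (Num.min r r') (rho / 4).
  by rewrite mulrC -ler_pdivlMr // ge_min lexx orbT.
have Lr : (Lam + 2) * t0 <= r by apply: le_trans Lt0 _; rewrite !ge_min lexx.
have Lr' : (Lam + 2) * t0 <= r' by apply: le_trans Lt0 _; rewrite !ge_min lexx orbT.
have Lrho : (Lam + 2) * t0 <= rho / 4 by apply: le_trans Lt0 _; rewrite !ge_min lexx !orbT.
move=> q l p' s qi s0 st sl hl; case: p' => x' y'; rewrite dist_prod ge_max => /andP[hx hy].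
have LL : Lam * s + s <= (Lam + 2) * t0.
  rewrite -[X in _ + X]mul1r -mulrDl; apply: ler_pM; rewrite ?addr_ge0 ?(ltW s0) ?(ltW Lam0) //.
  by rewrite lerD2l ler1n.
have st2 : 2 * s <= (Lam + 2) * t0.
  by apply: ler_pM => //; rewrite ?(ltW s0) // lerDr ltW.
have hd : rho / 2 <= `|x' - y'| by apply: (dist_shift hx hy); rewrite -/rho; clear -Lrho st2 rho0; lra.
apply: le_trans (HF q qi _ _ s l s0 _ _ _ sl hl) _.
- by apply: (room_shift rx); apply: le_trans Lr; rewrite addrC; apply: le_trans LL; rewrite lerD2l.
- by apply: (room_shift ry); apply: le_trans Lr'; rewrite addrC; apply: le_trans LL; rewrite lerD2l.
- by apply: le_trans hd; clear -LL Lrho s0 rho0; lra.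
rewrite -mulrA; apply: ler_wpM2l => //; rewrite mulrA.
apply: ler_wpM2r; first by rewrite invr_ge0 exprn_ge0 // ltW.
by apply: phi_half => //; exact: ltW.
Qed.

(** [quotient_cvg] needs second differences of size s^(1+d). They are available since i + 2 <= m +
    1: of order s^2 if i + 2 <= m, where s <= 1 is used, and exactly of order s^(1+d) if i + 1 =
    m. *)
Lemma smooth_class_derivable i C Lam F e x y : (i < m)%N -> 0 <= C -> 1 <= Lam ->
  smooth_class i C Lam F -> isdir e -> `|e| <= 1 -> O x -> O y -> x != y ->
  derivable F (x, y) e.
Proof.
move=> im C0 Lam1 HF de e1 Ox Oy xy.
have [t0 /andP[t00 t01] HF'] := smooth_class_local C0 Lam1 HF Ox Oy xy.
set rho := `|x - y| in HF'.
pose K := C * 2 ^+ (n + (2 + i)).+1.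
pose M := K * (rho `^ (m%:R - n%:R - (2 + i)%:R) + rho `^ (- (n%:R + d))).
have K0 : 0 <= K by rewrite mulr_ge0 ?exprn_ge0.
have M0 : 0 <= M by rewrite mulr_ge0 ?addr_ge0 ?powR_ge0.
have second s l p' : 0 < s -> s <= t0 -> size l = 2%N ->
    (forall h, h \in l -> isdir h /\ `|h| <= s) -> `|p' - (x, y)| <= s ->
    `|Dl l F p'| <= M * s `^ (1 + d).
  move=> s0 st sl hl hp.
  apply: le_trans (HF' 2%N l p' s _ s0 st sl hl hp) _; first by rewrite add2n !ltnS.
  rewrite /M -/K -[leRHS]mulrA; apply: ler_wpM2l => //.
  have s1 := le_trans st t01.
  have [h2|h2] := leqP (2 + i) m.
    rewrite phi_low // mulrDl; apply: (@le_trans _ _ (rho `^ (m%:R - n%:R - (2 + i)%:R) * s `^ (1 + d))).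
      apply: ler_wpM2l; first exact: powR_ge0.
      rewrite -powR_mulrn ?(ltW s0) //; apply: ger_powR; first by rewrite s0.
      have := d1; lra.
    by rewrite lerDl mulr_ge0 ?powR_ge0.
  have hm : (1 + i)%N = m by apply/eqP; rewrite eqn_leq im -ltnS.
  have -> : s `^ (1 + d) = s * s `^ d.
    by rewrite powRD ?(gt_eqF s0) ?implybT // powRr1 // ltW.
  rewrite (phi_high (q := 1)) // expr1.
  by rewrite ler_wpM2r ?mulr_ge0 ?powR_ge0 ?(ltW s0) // lerDr powR_ge0.
pose u s := F ((x, y) + s *: e) - F (x, y).
have norme a s : 0 <= a <= s -> `|a *: e| <= s.
  move=> /andP[a0 as_]; rewrite normrZ ger0_norm //; apply: le_trans as_.
  by rewrite -[leRHS]mulr1 ler_wpM2l.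
pose M1 := C * 2 ^+ (n + (1 + i)).+1 * rho `^ (m%:R - n%:R - (1 + i)%:R).
have uE : (fun s => s^-1 *: ((F \o shift (x, y)) (s *: e) - F (x, y))) = (fun s => s^-1 *: u s).
  by apply/funext => s; rewrite /u /= [_ + (x, y)]addrC.
rewrite /derivable uE.
apply: (@quotient_cvg _ _ u t0 d M M1) => //.
- by rewrite !mulr_ge0 ?exprn_ge0 ?powR_ge0.
- move=> a b s ha hb st; rewrite second_add.
  have [s0|s0] := ltP 0 s; last first.
    have a0 : a = 0 by apply/le_anti; case/andP: ha => -> /le_trans ->.
    have -> : Dl [:: a *: e; b *: e] F (x, y) = 0 by rewrite Dl_has0 // a0 scale0r mem_head.
    by rewrite normr0 mulr_ge0 ?powR_ge0.
  apply: second => //; last by rewrite subrr normr0 ltW.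
  by move=> h; rewrite !inE => /orP[]/eqP->; split; rewrite ?isdirZ // norme.
- move=> s /andP[s0 st]; have [s_gt0|s_le0] := ltP 0 s; last first.
    have -> : s = 0 by apply/le_anti; rewrite s0 s_le0.
    by rewrite /u scale0r addr0 subrr normr0 mulr0.
  have := HF' 1%N [:: s *: e] (x, y) s; rewrite /= => H.
  apply: le_trans (H _ s_gt0 st _ _ _) _ => //.
  - by rewrite add1n ltnS ltnW.
  - by move=> h; rewrite inE => /eqP->; rewrite isdirZ // norme // s0 lexx.
  - by rewrite subrr normr0.
  by rewrite phi_low // expr1 /M1 !mulrA.
- move=> s /andP[s0 st]; rewrite second_opp.
  have [s_gt0|s_le0] := ltP 0 s; last first.
    have -> : s = 0 by apply/le_anti; rewrite s0 s_le0.
    by rewrite Dl_has0 ?scale0r ?mem_head // normr0 mulr_ge0 ?powR_ge0.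
  apply: second => //.
    by move=> h; rewrite !inE => /orP[]/eqP->; split; rewrite ?isdirZ // norme // s0 lexx.
  by rewrite addrAC subrr add0r normrN norme // s0 lexx.
Qed.

(** A q-fold difference of the derivative is the limit of s^-1 times a (q+1)-fold difference of F
    with one short step s e. *)
Lemma smooth_class_derive i C Lam : (i < m)%N -> 0 <= C -> 1 <= Lam ->
  exists C' Lam', [/\ 0 <= C', 1 <= Lam' & forall F, smooth_class i C Lam F ->
    forall e, isdir e -> `|e| <= 1 -> smooth_class i.+1 C' Lam' ('D_e F)].
Proof.
move=> im C0 Lam1; have Lam0 := lt_le_trans ltr01 Lam1.
pose K := C * 2 ^+ (n + m.+1).+1 * 2 ^+ m.+1.
have K0 : 0 <= K by rewrite !mulr_ge0 ?exprn_ge0.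
pose Q := (quotient_cst d + 1) * K * 2 `^ (n%:R + d).
have Q0 : 0 <= Q by rewrite mulr_ge0 ?powR_ge0 // mulr_ge0 // addr_ge0 // quotient_cst_ge0.
(* K serves the orders up to m. At order m+1, 4 Q bounds the distance of the limit from the quotient
   with step t, and C that quotient itself. *)
pose C' := K + (4 * Q + C).
pose Lam' := 2 * (Lam + 2 * m.+2%:R) + m.+2%:R + 2.
have m2 : 0 <= m.+2%:R :> R by [].
exists C', Lam'; split.
- by rewrite addr_ge0 // addr_ge0 // mulr_ge0.
- by rewrite /Lam'; lra.
move=> F HF e de e1 q qi x y t l t0 rx ry txy sl hl.
have mt : 0 <= m.+2%:R * t by rewrite mulr_ge0 // ltW.
have Lt : 0 < Lam * t by exact: mulr_gt0.
have L't : Lam' * t = 2 * (Lam * t + 2 * (m.+2%:R * t)) + m.+2%:R * t + 2 * t by rewrite /Lam'; ring.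
have LL' : Lam * t <= Lam' * t by rewrite L't; lra.
rewrite L't in rx ry txy LL'.
have rho0 : 0 < `|x - y| by apply: lt_le_trans txy; lra.
have qm : (q <= m)%N by rewrite addnS ltnS in qi; apply: leq_trans qi; rewrite leq_addr.
have qt (q' : nat) : (q' <= m.+2)%N -> q'%:R * t <= m.+2%:R * t by move=> h; rewrite ler_pM2r // ler_nat.
have norme (s : R) : 0 <= s -> `|s *: e| <= s.
  by move=> s0; rewrite normrZ ger0_norm // -[leRHS]mulr1 ler_wpM2l.
have hlt h : h \in l -> `|h| <= t by move=> /hl [].
have dF p' : `|p' - (x, y)| <= (size l)%:R * t -> (fun s => quot e F s p') @ 0^' --> 'D_e F p'.
  case: p' => x' y'; rewrite dist_prod ge_max sl => /andP[hx hy].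
  have qt' := qt q (leq_trans qm (leq_trans (leqnSn _) (leqnSn _))).
  apply: (@smooth_class_derivable i C Lam) => //.
  - by apply: rx; clear -hx qt' mt Lt t0; lra.
  - by apply: ry; clear -hy qt' mt Lt t0; lra.
  rewrite -subr_eq0 -normr_gt0; apply: (@lt_le_trans _ _ (Lam * t)) => //.
  apply: (dist_shift hx hy); clear -txy qt' mt Lt t0; lra.
have limF := @Dl_cvg _ _ _ _ _ (dnbhs_filter 0) _ _ _ _ _ hlt dF.
have scale q1 q2 p' s (l1 l2 : seq E) : (q2 + q1 + i <= m.+1)%N -> 0 < s -> s <= t -> size l1 = q1 -> size l2 = q2 ->
    (forall h, h \in l1 -> isdir h /\ `|h| <= s) ->
    (forall h, h \in l2 -> isdir h /\ `|h| <= t) -> `|p' - (x, y)| <= t ->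
    `|Dl (l1 ++ l2) F p'| <= K * ((t / s) ^+ q2 * (phi n m d (q1 + q2 + i) `|p'.1 - p'.2| s / s ^+ i)).
  move=> qi' s0 st s1 s2 h1 h2; case: p' => x' y'; rewrite dist_prod ge_max => /andP[hx hy].
  rewrite (@Dl_perm _ _ _ (l1 ++ l2) (l2 ++ l1)); last by rewrite perm_catC.
  have q2m : (q2 <= m.+2)%N.
    by apply: leq_trans (leqnSn _); apply: leq_trans qi'; rewrite -addnA leq_addr.
  have qt' := qt q2 q2m.
  apply: (smooth_class_scale C0 Lam1) => //.
  - by apply: (room_shift rx); rewrite mulrDl; clear -hx qt' mt Lt t0; lra.
  - by apply: (room_shift ry); rewrite mulrDl; clear -hy qt' mt Lt t0; lra.
  - by apply: (dist_shift hx hy); clear -txy qt' mt Lt t0; lra.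
have [low|high] := leqP (q + i.+1) m.
  rewrite phi_low //.
  have -> : Dl l ('D_e F) (x, y) = Dl l ('D_e F) (x, y) - 0 by rewrite subr0.
  apply: (lim_close t0 limF) => s s0 st.
  rewrite subr0 Dl_quot normrZ gtr0_norm ?invr_gt0 // mulrC ler_pdivrMr //.
  apply: le_trans (scale 1%N q (x, y) s [:: s *: e] l _ s0 (ltW st) _ sl _ hl _) _ => //.
  - by rewrite addn1 addSnnS.
  - by move=> h; rewrite inE => /eqP ->; rewrite isdirZ // norme // ltW.
  - by rewrite subrr normr0 ltW.
  have e0 : (1 + q + i = q.+1 + i)%N by rewrite add1n.
  rewrite e0 phi_low //; last by rewrite addSnnS.
  rewrite -[leRHS]mulrA; apply: ler_pM => //.
  + by rewrite !mulr_ge0 ?powR_ge0 ?exprn_ge0 ?divr_ge0 // ltW.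
  + by rewrite lerDl addr_ge0 // mulr_ge0.
  rewrite -addSnnS expr_div_n exprS le_eqVlt; apply/orP; left; apply/eqP.
  by field; rewrite expf_neq0 // lt0r_neq0.
(* The direct estimate would be of order s^(d-1) here. Instead one step h of the list is split off,
   and at both ends of h the quotients with steps s and t are compared by [quotient_dist], whose
   hypothesis is the bound on (m+1)-fold differences. *)
have qE : (q + i = m)%N by apply/eqP; rewrite eqn_leq -ltnS -addnS qi -ltnS -addnS high.
have q0 : (0 < q)%N by rewrite lt0n; apply: contraTneq im => q0; rewrite -qE q0 ltnn.
case: l => [|h l] in sl hl hlt dF limF *; first by rewrite -sl in q0.
case: q => [//|q] in qi sl qm qE high q0 *; case: sl => sl.
have [dh ht] := hl h (mem_head _ _).
have hl' k : k \in l -> isdir k /\ `|k| <= t by move=> hk; apply: hl; rewrite inE hk orbT.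
have qE' : (q + i.+1 = m)%N by rewrite -addSnnS.
rewrite phi_high //.
pose D := `|x - y| `^ (- (n%:R + d)); rewrite -/D.
have D0 : 0 <= D by exact: powR_ge0.
have half p' : `|p' - (x, y)| <= t -> `|p'.1 - p'.2| `^ (- (n%:R + d)) <= 2 `^ (n%:R + d) * D.
  case: p' => x' y'; rewrite dist_prod ge_max => /andP[hx hy] /=.
  apply: powR_half_le => //; first by rewrite ltr_wpDl.
  have tL : t <= Lam * t by rewrite ler_peMl // ltW.
  by apply: (dist_shift hx hy); clear -txy mt tL t0; lra.
have quotient p' : p' = (x, y) \/ p' = (x, y) + h -> forall s, 0 < s -> s < t ->
    `|s^-1 *: Dl (s *: e :: l) F p' - t^-1 *: Dl (t *: e :: l) F p'| <= 2 * Q * D * (t ^+ q * t `^ d).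
  move=> p'E s s0 st.
  have hp : `|p' - (x, y)| <= t.
    by case: p'E => ->; rewrite ?subrr ?normr0 ?(ltW t0) // addrAC subrr add0r.
  pose D' := `|p'.1 - p'.2| `^ (- (n%:R + d)).
  have D'0 : 0 <= D' by exact: powR_ge0.
  pose u a := Dl l F (p' + a *: e) - Dl l F p'.
  pose M := K * (D' * t ^+ q).
  pose M1 := K * (`|p'.1 - p'.2| `^ (m%:R - n%:R - (q.+1 + i)%:R) * t ^+ q).
  have tq0 : 0 <= t ^+ q by rewrite exprn_ge0 // ltW.
  have M0 : 0 <= M by rewrite !mulr_ge0.
  have M10 : 0 <= M1 by rewrite !mulr_ge0 ?powR_ge0.
  have := @quotient_dist _ _ u t d M M1 d0 M0 M10 _ _ s t s0 (ltW st) t0 (lexx _).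
  rewrite /u => H; apply: le_trans (H _ _) _.
  - move=> a b r ha hb rt; rewrite -/(u (a + b)) -/(u a) -/(u b) second_add.
    have [r0|r0] := ltP 0 r; last first.
      have a0 : a = 0 by apply/le_anti; case/andP: ha => -> /le_trans ->.
      by rewrite Dl_has0 ?a0 ?scale0r ?mem_head // normr0 mulr_ge0 ?powR_ge0.
    rewrite -Dl_cat; apply: le_trans (scale 2%N q p' r [:: a *: e; b *: e] l _ r0 rt _ sl _ hl' hp) _ => //.
    + by rewrite addn2 !addSn -addSn qE.
    + move=> k; rewrite !inE => /orP[]/eqP->; split; rewrite ?isdirZ //.
        by case/andP: ha => a0 ar; apply: le_trans (norme _ a0) ar.
      by case/andP: hb => b0 br; apply: le_trans (norme _ b0) br.
    have e0 : (2 + q + i = q.+2 + i)%N by rewrite add2n.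
    have rd : r `^ (1 + d) = r * r `^ d.
      by rewrite powRD ?(gt_eqF r0) ?implybT // powRr1 // ltW.
    rewrite e0 phi_high // -/D' rd /M -[leRHS]mulrA; apply: ler_wpM2l => //.
    rewrite expr_div_n exprS le_eqVlt; apply/orP; left; apply/eqP.
    by field; rewrite expf_neq0 // lt0r_neq0.
  - move=> r /andP[r0 rt]; have [r_gt0|r_le0] := ltP 0 r; last first.
      have -> : r = 0 by apply/le_anti; rewrite r0 r_le0.
      by rewrite scale0r addr0 subrr normr0 mulr0.
    rewrite -[Dl l F _ - _]/(Dl ([:: r *: e] ++ l) F p').
    apply: le_trans (scale 1%N q p' r [:: r *: e] l _ r_gt0 rt _ sl _ hl' hp) _ => //.
    + by rewrite addn1 qE.
    + by move=> k; rewrite inE => /eqP ->; rewrite isdirZ // norme.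
    have e0 : (1 + q + i = q.+1 + i)%N by rewrite add1n.
    rewrite e0 phi_low ?qE // /M1 -qE -[leRHS]mulrA; apply: ler_wpM2l => //.
    rewrite expr_div_n exprS le_eqVlt; apply/orP; left; apply/eqP.
    by field; rewrite expf_neq0 // lt0r_neq0.
  have sd : s `^ d <= t `^ d by apply: ge0_ler_powR; rewrite ?nnegrE ?(ltW s0) ?(ltW t0) ?(ltW d0) // ltW.
  have td0 : 0 <= t `^ d by exact: powR_ge0.
  apply: (@le_trans _ _ ((quotient_cst d + 1) * M * (2 * t `^ d))).
    apply: ler_wpM2l; last by rewrite mulr2n mulrDl mul1r lerD2r.
    by rewrite mulr_ge0 // addr_ge0 // quotient_cst_ge0.
  have -> : (quotient_cst d + 1) * M * (2 * t `^ d) =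
    (quotient_cst d + 1) * K * (D' * (2 * (t ^+ q * t `^ d))) by rewrite /M; ring.
  have -> : 2 * Q * D * (t ^+ q * t `^ d) =
    (quotient_cst d + 1) * K * (2 `^ (n%:R + d) * D * (2 * (t ^+ q * t `^ d))) by rewrite /Q; ring.
  apply: ler_wpM2l; first by rewrite mulr_ge0 // addr_ge0 // quotient_cst_ge0.
  by apply: ler_wpM2r; [rewrite !mulr_ge0|exact: half].
set X := D * _.
have X0 : 0 <= X by rewrite !mulr_ge0 ?powR_ge0 ?exprn_ge0 // ltW.
pose b := Dl (h :: l) (quot e F t) (x, y).
have Hb : `|b| <= C * X.
  rewrite /b Dl_quot normrZ gtr0_norm ?invr_gt0 // mulrC ler_pdivrMr //.
  apply: le_trans (HF q.+2 _ _ _ t _ t0 _ _ _ _ _) _.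
  - by rewrite addSn qE.
  - exact: room_le rx LL'.
  - exact: room_le ry LL'.
  - exact: le_trans LL' txy.
  - by rewrite /= sl.
  - by move=> k; rewrite inE => /orP[/eqP->|/hl //]; rewrite isdirZ // norme // ltW.
  rewrite phi_high // -/D -[leRHS]mulrA; apply: ler_wpM2l => //.
  by rewrite /X exprS le_eqVlt; apply/orP; left; apply/eqP; ring.
have Hl : `|Dl (h :: l) ('D_e F) (x, y) - b| <= 4 * Q * X.
  apply: (lim_close t0 limF) => s s0 st.
  rewrite /b /= !Dl_quot.
  have H1 := quotient _ (or_introl erefl) s s0 st.
  have H2 := quotient _ (or_intror erefl) s s0 st.
  have -> : forall a a' b b' : W, a - a' - (b - b') = (a - b) - (a' - b') by move=> *; lmod R.
  apply: le_trans (ler_normB _ _) _; apply: le_trans (lerD H2 H1) _.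
  by rewrite le_eqVlt; apply/orP; left; apply/eqP; rewrite /X; ring.
rewrite -[Dl _ _ _](subrK b); apply: le_trans (ler_normD _ _) _.
rewrite /C' mulrDl mulrDl -[leLHS]add0r; apply: lerD; first by rewrite mulr_ge0.
exact: lerD.
Qed.

End SmoothnessClasses.

(** * Hoelder estimates up to the boundary *)

Section HolderEstimates.
Variables (R : realType) (n m : nat) (d : R) (O : set 'rV[R]_n) (c : R).
Local Notation V := 'rV[R]_n.
Local Notation W := 'rV[R]_2.
Local Notation E := (V * V)%type.
Hypotheses (mn : (0 < m < n)%N) (d01 : 0 < d < 1) (oO : open O).
Hypotheses (c1 : 1 <= c) (chO : chainable O c).

Let d0 : 0 < d. Proof. by case/andP: d01. Qed.
Let c0 : 0 < c. Proof. exact: lt_le_trans c1. Qed.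
Let nd0 : 0 < n%:R + d. Proof. by rewrite ltr_wpDl. Qed.
Let n0 : (0 < n)%N. Proof. by case/andP: mn => _; apply: leq_trans. Qed.

Lemma smooth_class_size i C Lam F x y : (i <= m)%N -> 0 <= C -> 1 <= Lam ->
  smooth_class m d O i C Lam F -> O x -> O y -> x != y ->
  `|F (x, y)| <= C * 2 ^+ (n + m).+1 * `|x - y| `^ (m%:R - n%:R - i%:R).
Proof.
move=> im C0 Lam1 HF Ox Oy xy.
have [t0 /andP[t00 _] H] := smooth_class_local mn d01 oO C0 Lam1 HF Ox Oy xy.
have := H 0%N [::] (x, y) t0; rewrite /= subrr normr0 => {}H.
apply: le_trans (H _ t00 (lexx _) erefl _ (ltW t00)) _ => //.
  by rewrite add0n; apply: leq_trans im _.
rewrite phi_low // expr0 mulr1 add0n; apply: ler_wpM2r; first exact: powR_ge0.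
by apply: ler_wpM2l => //; apply: ler_weXn2l; rewrite ?ler1n // ltnS leq_add2l.
Qed.

Lemma smooth_class_continuous i C Lam F x y : (i <= m)%N -> 0 <= C -> 1 <= Lam ->
  smooth_class m d O i C Lam F -> O x -> O y -> x != y -> {for (x, y), continuous F}.
Proof.
move=> im C0 Lam1 HF Ox Oy xy.
have [t0 /andP[t00 t01] H] := smooth_class_local mn d01 oO C0 Lam1 HF Ox Oy xy.
set rho := `|x - y| in H.
pose M := C * 2 ^+ (n + (1 + i)).+1 * (rho `^ (m%:R - n%:R - (1 + i)%:R) + rho `^ (- (n%:R + d))).
have M0 : 0 <= M by rewrite !mulr_ge0 ?addr_ge0 ?exprn_ge0 ?powR_ge0.
have step h p' s : 0 < s -> s <= t0 -> isdir h -> `|h| <= s -> `|p' - (x, y)| <= s ->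
    `|F (p' + h) - F p'| <= M * s `^ d.
  move=> s0 st dh hs hp; have := H 1%N [:: h] p' s; rewrite /= => H'.
  apply: le_trans (H' _ s0 st erefl _ hp) _ => //.
  - by move=> k; rewrite inE => /eqP->.
  rewrite /M -[leRHS]mulrA; apply: ler_wpM2l; first by rewrite mulr_ge0 ?exprn_ge0.
  have sd0 := powR_ge0 s d.
  have [h1|h1] := leqP (1 + i) m.
    rewrite phi_low // mulrDl expr1.
    apply: (@le_trans _ _ (rho `^ (m%:R - n%:R - (1 + i)%:R) * s `^ d)).
      apply: ler_wpM2l; first exact: powR_ge0.
      rewrite -[leLHS]powRr1 ?(ltW s0) //; apply: ger_powR; first by rewrite s0 (le_trans st).
      by case/andP: d01 => _ /ltW.
    by rewrite lerDl mulr_ge0 ?powR_ge0.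
  have hm : (0 + i)%N = m by apply/eqP; rewrite eqn_leq im -ltnS.
  by rewrite (@phi_high _ n m d 0%N) // expr0 mul1r mulrDl lerDr mulr_ge0 ?powR_ge0.
apply/cvgrPdist_le => e e0.
pose t := Num.min t0 ((e / (2 * M + 1)) `^ (d^-1)).
have M20 : 0 < 2 * M + 1 by rewrite ltr_wpDl // mulr_ge0.
have tpos : 0 < t by rewrite lt_min t00 powR_gt0 // divr_gt0.
have tt0 : t <= t0 by rewrite ge_min lexx.
have td : 2 * M * t `^ d <= e.
  apply: (@le_trans _ _ ((2 * M + 1) * t `^ d)); first by rewrite [leRHS]mulrDl lerDl mul1r powR_ge0.
  rewrite mulrC -ler_pdivlMr //; apply: (@le_trans _ _ (((e / (2 * M + 1)) `^ (d^-1)) `^ d)).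
    by apply: ge0_ler_powR; rewrite ?nnegrE ?powR_ge0 ?(ltW tpos) ?(ltW d0) // ge_min lexx orbT.
  by rewrite -powRrM mulVf ?gt_eqF // powRr1 // divr_ge0 ?(ltW e0) ?(ltW M20).
have near_p : nbhs ((x, y) : E) (ball ((x, y) : E) t) by exact: nbhsx_ballx.
apply: filterS near_p => -[x' y'] [] /=; rewrite -!ball_normE /= [`|x - _|]distrC [`|y - _|]distrC.
move=> /ltW hx /ltW hy.
have e1 : (x', y) + (0, y' - y) = (x', y') :> E.
  by congr (_, _); rewrite /= ?addr0 // addrC subrK.
have e2 : (x, y) + (x' - x, 0) = (x', y) :> E.
  by congr (_, _); rewrite /= ?addr0 // addrC subrK.
have H1 : `|F (x', y') - F (x', y)| <= M * t `^ d.
  rewrite -e1; apply: step => //; rewrite ?isdir_inr ?norm_inr //.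
  by rewrite dist_prod subrr normr0 ge_max hx ltW.
have H2 : `|F (x', y) - F (x, y)| <= M * t `^ d.
  rewrite -e2; apply: step => //; rewrite ?isdir_inl ?norm_inl //.
  by rewrite subrr normr0 ltW.
rewrite distrC; apply: le_trans (ler_distD (F (x', y)) _ _) _; apply: le_trans td.
by rewrite -mulrA mulr2n mulrDl mul1r; apply: lerD.
Qed.

(** Away from the boundary at scale r: first z, then w is moved along a chain with links r / (Lam
    c), and each link is a first difference. *)
Lemma compare_pairs C Lam M : 0 <= C -> 1 <= Lam -> 0 < M ->
  exists2 C', 0 <= C' & forall F, smooth_class m d O m C Lam F -> forall z w z' w' r, 0 < r ->
    room O z r -> room O w r -> room O z' r -> room O w' r ->
    `|z' - z| <= M * r -> `|w' - w| <= M * r -> 4 * ((c * M + 1) * r) <= `|z - w| ->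
    `|F (z', w') - F (z, w)| <= C' * (`|z - w| `^ (- (n%:R + d)) * r `^ d).
Proof.
move=> C0 Lam1 M0; have Lam0 := lt_le_trans ltr01 Lam1; have [_ G2] := chO.
have lam0 : 0 < (Lam * c)^-1 by rewrite invr_gt0 mulr_gt0.
have [N HN] := G2 M (Lam * c)^-1 M0 lam0.
exists (2 * N%:R * (C * 2 `^ (n%:R + d))); first by rewrite !mulr_ge0 ?powR_ge0.
move=> F HF z w z' w' r r0 rz rw rz' rw' hz hw hr.
pose t := (Lam * c)^-1 * r.
have t0 : 0 < t by exact: mulr_gt0.
have Lt : Lam * t = r / c by rewrite /t; field; rewrite !gt_eqF.
have rcr : r / c <= r by rewrite ler_pdivrMr // ler_peMr // ltW.
have tr : t <= r.
  by apply: le_trans rcr; rewrite -Lt ler_peMl // ltW.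
have cM : M * r <= c * M * r by rewrite -mulrA ler_peMl // mulr_ge0 // ltW.
have Mr0 : 0 <= M * r by rewrite mulr_ge0 // ltW.
pose rho := `|z - w|; pose X := rho `^ (- (n%:R + d)) * r `^ d.
have rho0 : 0 < rho by apply: lt_le_trans hr; rewrite !mulr_gt0 // ltr_wpDl // mulr_ge0 // ltW.
rewrite -/rho in hr *; rewrite -/X.
have hr2 : 4 * (c * M * r) + 4 * r <= rho by apply: le_trans hr; rewrite le_eqVlt; apply/orP; left; apply/eqP; ring.
pose B := C * 2 `^ (n%:R + d) * X.
have X0 : 0 <= X by rewrite mulr_ge0 ?powR_ge0.
have B0 : 0 <= B by rewrite !mulr_ge0 ?powR_ge0.
have step a b h : isdir h -> `|h| <= t -> room O a (r / c) -> room O b (r / c) ->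
    rho / 2 <= `|a - b| -> `|F ((a, b) + h) - F (a, b)| <= B.
  move=> dh ht ra rb hab.
  have := HF 1%N _ a b t [:: h] t0; rewrite Lt /= => H.
  apply: le_trans (H _ ra rb _ erefl _) _; first by rewrite add1n.
  - by apply: le_trans hab; apply: le_trans rcr _; lra.
  - by move=> k; rewrite inE => /eqP->.
  rewrite (@phi_high _ n m d 0%N) // expr0 mul1r /B -[leRHS]mulrA; apply: ler_wpM2l => //.
  rewrite /X mulrA; apply: ler_pM; rewrite ?powR_ge0 //; first exact: powR_half_le.
  by apply: ge0_ler_powR; rewrite ?nnegrE ?(ltW t0) ?(ltW r0) ?(ltW d0).
have cMr0 : 0 <= c * M * r by exact: le_trans cM.
have chz := HN z z' r r0 rz rz' hz; have chw := HN w w' r r0 rw rw' hw.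
have H1 : `|F (z', w) - F (z, w)| <= N%:R * B.
  apply: (chain_bound (g := fun a => F (a, w)) B0 cMr0 _ chz); first exact: room_le rz rcr.
  move=> a b ra haz hab.
  have -> : (b, w) = (a, w) + (b - a, 0) :> E by congr (_, _); rewrite /= ?addr0 // addrC subrK.
  apply: step => //; rewrite ?isdir_inl ?norm_inl //; first exact: room_le rw rcr.
  apply: (@dist_shift _ _ z w a w (c * M * r) 0 _ haz); first by rewrite subrr normr0.
  by rewrite -/rho; lra.
have H2 : `|F (z', w') - F (z', w)| <= N%:R * B.
  apply: (chain_bound (g := fun a => F (z', a)) B0 cMr0 _ chw); first exact: room_le rw rcr.
  move=> a b ra haw hab.
  have -> : (z', b) = (z', a) + (0, b - a) :> E by congr (_, _); rewrite /= ?addr0 // addrC subrK.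
  apply: step => //; rewrite ?isdir_inr ?norm_inr //; first exact: room_le rz' rcr.
  apply: (@dist_shift _ _ z w z' a (M * r) (c * M * r) _ hz haw).
  by rewrite -/rho; lra.
apply: le_trans (ler_distD (F (z', w)) _ _) _; apply: le_trans (lerD H2 H1) _.
by rewrite le_eqVlt; apply/orP; left; apply/eqP; rewrite /B; ring.
Qed.

Lemma half_dist_ge (D D1 r s b : R) : 0 <= r -> r <= s -> s <= b -> 80 * b <= D -> D / 2 <= D1 ->
  20 * b + 4 * r <= D1.
Proof. by move=> *; lra. Qed.

(** The rooms of x and y can be arbitrarily small compared with r, and B must not depend on them.
    Halving r repeatedly gives increments proportional to (r / 2^j)^d, a convergent geometric
    series; it ends once r / 2^j is below the actual rooms of x and y. *)
Lemma approach_pair C Lam : 0 <= C -> 1 <= Lam ->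
  exists2 B, 0 <= B & forall F, smooth_class m d O m C Lam F -> forall x y r z w, O x -> O y -> 0 < r -> room O z r -> room O w r ->
    `|z - x| <= 2 * c * r -> `|w - y| <= 2 * c * r -> 40 * (c * c * r) <= `|x - y| ->
    `|F (z, w) - F (x, y)| <= B * (`|x - y| `^ (- (n%:R + d)) * r `^ d).
Proof.
(* Consecutive pairs are within 2 c (2 r') + c r' = 5 c r' of each other, where r' is the smaller
   room. *)
move=> C0 Lam1; have c50 : 0 < 5 * c by exact: mulr_gt0.
have [C' C'0 HC'] := compare_pairs C0 Lam1 c50; have [G1 _] := chO.
have pow2d : 0 < 2 `^ d - 1.
  rewrite subr_gt0; have : (1 : R) `^ d < 2 `^ d by apply: gt0_ltr_powR; rewrite ?nnegrE ?ltr1n.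
  by rewrite powR1.
pose X := C' * 2 `^ (n%:R + d); have X0 : 0 <= X by rewrite mulr_ge0 ?powR_ge0.
have p1 : 1 <= 2 `^ (n%:R + d).
  by have := @ler_powR _ (2 : R) _ 0 (n%:R + d) (ltW nd0); rewrite powRr0; apply; rewrite ler1n.
have CX : C' <= X by rewrite ler_peMr.
(* Then B >= X for the last comparison, and B 2^d >= X + B for the induction step. *)
pose B := X + X / (2 `^ d - 1).
have XB : X <= B by rewrite lerDl divr_ge0 // ltW.
have BE : B * (2 `^ d - 1) = X * (2 `^ d - 1) + X by rewrite /B mulrDl divfK // gt_eqF.
exists B; first by rewrite addr_ge0 // divr_ge0 // ltW.
move=> F HF x y r z w Ox Oy r0 rz rw hz hw hr; have {HC'} H := HC' F HF.
have [sx sx0 rx] := open_room oO Ox; have [sy sy0 ry] := open_room oO Oy.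
have [j hj] : exists j : nat, r / 2 ^+ j <= Num.min sx sy.
  have s0 : 0 < Num.min sx sy by rewrite lt_min sx0.
  exists (Num.truncn (r / Num.min sx sy)).+1; rewrite ler_pdivrMr ?exprn_gt0 // mulrC -ler_pdivrMr //.
  apply: (le_trans (ltW (truncnS_gt _))); rewrite -natrX ler_nat; exact/ltnW/ltn_expl.
have {}rx : room O x (r / 2 ^+ j) by apply: room_le rx _; apply: le_trans hj _; rewrite ge_min lexx.
have {}ry : room O y (r / 2 ^+ j) by apply: room_le ry _; apply: le_trans hj _; rewrite ge_min lexx orbT.
elim: j r z w r0 rz rw hz hw hr rx ry {hj} => [|j IH] r z w r0 rz rw hz hw hr rx ry;
  have cr : r <= c * r by (rewrite ler_peMl // ltW).
  1,2: have ccr : c * r <= c * c * r by rewrite -mulrA ler_peMl // mulr_ge0 // ltW.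
  rewrite expr0 divr1 in rx ry.
  apply: le_trans (H x y z w r r0 rx ry rz rw _ _ _) _.
  - by apply: le_trans hz _; rewrite ler_pM2r // ler_pM2r // ler_nat.
  - by apply: le_trans hw _; rewrite ler_pM2r // ler_pM2r // ler_nat.
  - have -> : 4 * ((c * (5 * c) + 1) * r) = 20 * (c * c * r) + 4 * r by ring.
    lra.
  by apply: ler_wpM2r; [rewrite mulr_ge0 ?powR_ge0|exact: le_trans XB].
pose r' := r / 2; have r'0 : 0 < r' by exact: divr_gt0.
have rE : r = 2 * r' by rewrite /r' mulrC divfK // pnatr_eq0.
rewrite rE in cr ccr hr hz hw rz rw rx ry *.
have r'r : r' <= 2 * r' by rewrite ler_peMl ?ler1n // ltW.
have cr' : r' <= c * r' by rewrite ler_peMl // ltW.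
have ccr' : c * r' <= c * c * r' by rewrite -mulrA ler_peMl // mulr_ge0 // ltW.
have s0 : 0 < c * r' by exact: mulr_gt0.
have hr' : 80 * (c * c * r') <= `|x - y|.
  by apply: le_trans hr; rewrite le_eqVlt; apply/orP; left; apply/eqP; ring.
have [|z' [zx rz']] := G1 x y (c * r') Ox Oy s0; first by lra.
have [|w' [wy rw']] := G1 y x (c * r') Oy Ox s0; first by rewrite distrC; lra.
have e1 : c * r' / c = r' by rewrite mulrAC divff ?mul1r // gt_eqF.
rewrite e1 in rz' rw'.
have e2 : 2 * r' / 2 ^+ j.+1 = r' / 2 ^+ j by rewrite exprS; field; rewrite expf_neq0.
have h2 : c * r' <= 2 * c * r' by rewrite -mulrA ler_peMl ?ler1n // ltW.
have := IH r' z' w' r'0 rz' rw' (le_trans zx h2) (le_trans wy h2).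
rewrite -e2 => {}IH.
have {}IH : `|F (z', w') - F (x, y)| <= B * (`|x - y| `^ (- (n%:R + d)) * r' `^ d).
  by apply: IH => //; apply: le_trans hr'; rewrite ler_pM2r ?ler_nat // !mulr_gt0.
have dzw : `|x - y| / 2 <= `|z' - w'|.
  by apply: (dist_shift zx wy); lra.
have := H z' w' z w r' r'0 rz' rw' (room_le rz r'r) (room_le rw r'r).
have e3 : 5 * c * r' = 2 * c * (2 * r') + c * r' by ring.
rewrite e3 => /(_ _ _ _) H1.
have {}H1 : `|F (z, w) - F (z', w')| <= X * (`|x - y| `^ (- (n%:R + d)) * r' `^ d).
  apply: le_trans (H1 _ _ _) _.
  - apply: le_trans (ler_distD x _ _) _; apply: lerD => //; by rewrite distrC.
  - apply: le_trans (ler_distD y _ _) _; apply: lerD => //; by rewrite distrC.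
  - have -> : 4 * ((c * (5 * c) + 1) * r') = 20 * (c * c * r') + 4 * r' by ring.
    exact: half_dist_ge (ltW r'0) cr' ccr' hr' dzw.
  rewrite /X -[leRHS]mulrA; apply: ler_wpM2l => //; rewrite mulrA.
  apply: ler_wpM2r; first exact: powR_ge0.
  by apply: powR_half_le => //; apply: lt_le_trans hr'; rewrite !mulr_gt0.
apply: le_trans (ler_distD (F (z', w')) _ _) _; apply: le_trans (lerD H1 IH) _.
rewrite -mulrDl [in leRHS]powRM ?(ltW r'0) //.
have -> : B * (`|x - y| `^ (- (n%:R + d)) * (2 `^ d * r' `^ d)) =
   (B * (2 `^ d - 1) + B) * (`|x - y| `^ (- (n%:R + d)) * r' `^ d) by ring.
apply: ler_wpM2r; first by rewrite mulr_ge0 ?powR_ge0.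
by rewrite BE lerD2r lerDr mulr_ge0 // ltW.
Qed.

(** Both pairs are compared with one pair (z, w) of room s, chosen within c s of (x, y) and hence
    within 2 c s of (x', y'). *)
Lemma smooth_class_holder C Lam : 0 <= C -> 1 <= Lam ->
  exists2 B, 0 <= B & forall F, smooth_class m d O m C Lam F -> forall x y x' y' s, O x -> O y -> O x' -> O y' -> 0 < s ->
    `|x' - x| <= s -> `|y' - y| <= s -> 100 * (c * c * s) <= `|x - y| ->
    `|F (x', y') - F (x, y)| <= B * (`|x - y| `^ (- (n%:R + d)) * s `^ d).
Proof.
move=> C0 Lam1; have [B B0 HB] := approach_pair C0 Lam1; have [G1 _] := chO.
exists (B * 2 `^ (n%:R + d) + B); first by rewrite addr_ge0 // mulr_ge0 ?powR_ge0.
move=> F HF x y x' y' s Ox Oy Ox' Oy' s0 hx hy hs; have {HB} H := HB F HF.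
have cs : s <= c * s by rewrite ler_peMl // ltW.
have ccs : c * s <= c * c * s by rewrite -mulrA ler_peMl // mulr_ge0 // ltW.
have cs0 : 0 < c * s by exact: mulr_gt0.
have e1 : c * s / c = s by rewrite mulrAC divff ?mul1r // gt_eqF.
have [|z [zx rz]] := G1 x y (c * s) Ox Oy cs0; first by lra.
have [|w [wy rw]] := G1 y x (c * s) Oy Ox cs0; first by rewrite distrC; lra.
rewrite e1 in rz rw.
have d' : `|x - y| / 2 <= `|x' - y'| by apply: (dist_shift hx hy); lra.
have H1 : `|F (z, w) - F (x, y)| <= B * (`|x - y| `^ (- (n%:R + d)) * s `^ d).
  by apply: H => //; rewrite -?mulrA; lra.
have H2 : `|F (z, w) - F (x', y')| <= B * 2 `^ (n%:R + d) * (`|x - y| `^ (- (n%:R + d)) * s `^ d).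
  apply: (@le_trans _ _ (B * (`|x' - y'| `^ (- (n%:R + d)) * s `^ d))).
    apply: H => //.
    - apply: le_trans (ler_distD x _ _) _; rewrite [`|x - _|]distrC -[X in _ <= X]mulrA; lra.
    - apply: le_trans (ler_distD y _ _) _; rewrite [`|y - _|]distrC -[X in _ <= X]mulrA; lra.
    - lra.
  rewrite -[leRHS]mulrA; apply: ler_wpM2l => //; rewrite mulrA.
  apply: ler_wpM2r; first exact: powR_ge0.
  by apply: powR_half_le => //; apply: lt_le_trans hs; rewrite !mulr_gt0.
rewrite mulrDl; apply: le_trans (ler_distD (F (z, w)) _ _) _.
by rewrite [`|F (x', y') - _|]distrC; apply: lerD.
Qed.

End HolderEstimates.

(** * Standard kernels are smooth *)

Section EuclideanHolder.
Variables (R : realType) (n m : nat) (d : R) (O : set 'rV[R]_n) (c : R).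
Local Notation V := 'rV[R]_n.
Local Notation W := 'rV[R]_2.
Local Notation E := (V * V)%type.
Hypotheses (mn : (0 < m < n)%N) (d01 : 0 < d < 1) (oO : open O).
Hypotheses (c1 : 1 <= c) (chO : chainable O c).

Let d0 : 0 < d. Proof. by case/andP: d01. Qed.
Let nd0 : 0 < n%:R + d. Proof. by rewrite ltr_wpDl. Qed.
Let n0 : (0 < n)%N. Proof. by case/andP: mn => _; apply: leq_trans. Qed.
Let nR0 : 0 < n%:R :> R. Proof. by rewrite ltr0n. Qed.

Lemma powR_div_le (a b k q : R) : 0 < a -> 0 < k -> 0 < q -> a / k <= b ->
  b `^ (- q) <= k `^ q * a `^ (- q).
Proof.
move=> a0 k0 q0 ab.
have -> : k `^ q * a `^ (- q) = (a / k) `^ (- q).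
  rewrite powRM ?invr_ge0 ?(ltW a0) ?(ltW k0) // mulrC; congr (_ * _).
  by rewrite -powR_inv1 ?(ltW k0) // -powRrM mulN1r opprK.
have ak : 0 < a / k by exact: divr_gt0.
rewrite !powRN lef_pV2 ?posrE ?powR_gt0 //; last exact: lt_le_trans ab.
by apply: ge0_ler_powR; rewrite ?nnegrE ?(ltW q0) ?(ltW ak) // (le_trans (ltW ak)).
Qed.

Lemma edist_div_le (x y : V) : edist x y / n%:R <= `|x - y|.
Proof. by rewrite ler_pdivrMr // mulrC; exact: enorm_le_norm. Qed.

Lemma enorm_eq0 (v : V) : enorm v = 0 -> v = 0.
Proof.
by move=> v0; apply/eqP; rewrite -[_ == _]negbK -enorm_gt0 v0 ltxx.
Qed.

Lemma edist_gt0 (x y : V) : (0 < edist x y) = (x != y).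
Proof. by rewrite enorm_gt0 subr_eq0. Qed.

Lemma smooth_class_size_enorm i C Lam (F : E -> W) x y : (i <= m)%N -> 0 <= C -> 1 <= Lam ->
  smooth_class m d O i C Lam F -> O x -> O y -> x != y ->
  enorm (F (x, y)) <= 2 * (C * 2 ^+ (n + m).+1 * n%:R ^+ (n + m)) *
    edist x y `^ (m%:R - n%:R - i%:R).
Proof.
move=> im C0 Lam1 HF Ox Oy xy; have exy : 0 < edist x y by rewrite edist_gt0.
case/andP: mn => m0 mltn.
apply: le_trans (enorm_le_norm _) _; rewrite -[leRHS]mulrA; apply: ler_wpM2l => //.
apply: le_trans (smooth_class_size mn d01 oO im C0 Lam1 HF Ox Oy xy) _.
rewrite -[leRHS]mulrA; apply: ler_wpM2l; first by rewrite mulr_ge0 ?exprn_ge0.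
have -> : m%:R - n%:R - i%:R = - (n%:R + i%:R - m%:R) :> R by ring.
have q0 : 0 < n%:R + i%:R - m%:R :> R.
  by rewrite subr_gt0 -natrD ltr_nat (leq_trans mltn) // leq_addr.
apply: le_trans (powR_div_le exy nR0 q0 (edist_div_le x y)) _.
apply: ler_wpM2r; first exact: powR_ge0.
rewrite -powR_mulrn ?(ltW nR0) //; apply: ler_powR; first by rewrite ler1n.
have : i%:R <= m%:R :> R by rewrite ler_nat.
have : 0 <= m%:R :> R by [].
rewrite natrD; lra.
Qed.

(** Increments that are small against |x - y| are handled by [smooth_class_holder]. For the others
    |x - y|^d is at most a multiple of e^d, and the size estimate at both pairs suffices. *)
Lemma smooth_class_holder_enorm C Lam : 0 <= C -> 1 <= Lam ->
  exists2 B, 0 <= B & forall F : E -> W, smooth_class m d O m C Lam F -> forall x y x' y' e, O x -> O y -> O x' -> O y' -> 0 < e ->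
    enorm (x' - x) <= e -> enorm (y' - y) <= e -> x != y ->
    edist x y <= 2 * edist x' y' ->
    enorm (F (x', y') - F (x, y)) <= B * e `^ d * edist x y `^ (- (n%:R + d)).
Proof.
move=> C0 Lam1; have [B B0 HB] := smooth_class_holder m d01 oO c1 chO C0 Lam1.
have c0 : 0 < c := lt_le_trans ltr01 c1.
pose S := 2 * (C * 2 ^+ (n + m).+1 * n%:R ^+ (n + m)).
have S0 : 0 <= S by rewrite !mulr_ge0 ?exprn_ge0.
pose k := n%:R * (100 * (c * c)).
have k0 : 0 < k by rewrite !mulr_gt0.
pose B1 := 2 * (B * n%:R `^ (n%:R + d)).
pose B2 := S * (1 + 2 `^ n%:R) * k `^ d.
have B10 : 0 <= B1 by rewrite !mulr_ge0 ?powR_ge0.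
have B20 : 0 <= B2 by rewrite !mulr_ge0 ?addr_ge0 ?powR_ge0.
exists (B1 + B2); first exact: addr_ge0.
move=> F HF x y x' y' e Ox Oy Ox' Oy' e0 hx hy xy hxy; have {}HB := HB F HF.
have exy : 0 < edist x y by rewrite edist_gt0.
have exy' : 0 < edist x' y' by rewrite -(pmulr_rgt0 _ (@ltr0Sn R 1)); exact: lt_le_trans hxy.
have xy' : x' != y' by rewrite -edist_gt0.
set rho := edist x y in exy hxy *.
rewrite -!mulrA; set X := e `^ d * _.
have X0 : 0 <= X by rewrite mulr_ge0 ?powR_ge0.
have [small|large] := leP (100 * (c * c * e)) `|x - y|.
  apply: (@le_trans _ _ (B1 * X)); last by rewrite ler_wpM2r // lerDl.
  apply: le_trans (enorm_le_norm _) _; rewrite /B1 -[leRHS]mulrA; apply: ler_wpM2l => //.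
  have hx' := le_trans (norm_le_enorm _) hx; have hy' := le_trans (norm_le_enorm _) hy.
  apply: le_trans (HB x y x' y' e Ox Oy Ox' Oy' e0 hx' hy' small) _.
  rewrite -[leRHS]mulrA; apply: ler_wpM2l => //.
  rewrite /X mulrCA [leLHS]mulrC.
  by apply: ler_wpM2l; [exact: powR_ge0|exact: powR_div_le (edist_div_le x y)].
apply: (@le_trans _ _ (B2 * X)); last by rewrite ler_wpM2r // lerDr.
have size z w : O z -> O w -> z != w -> enorm (F (z, w)) <= S * edist z w `^ (- n%:R).
  move=> Oz Ow zw.
  have := smooth_class_size_enorm (leqnn m) C0 Lam1 HF Oz Ow zw.
  by have -> : m%:R - n%:R - m%:R = - n%:R :> R by ring.
have rhon : edist x' y' `^ (- n%:R) <= 2 `^ n%:R * rho `^ (- n%:R).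
  by apply: powR_div_le => //; rewrite ler_pdivrMr // mulrC.
have rhoX : rho `^ (- n%:R) <= k `^ d * X.
  have -> : rho `^ (- n%:R) = rho `^ (- (n%:R + d)) * rho `^ d.
    rewrite -powRD ?(gt_eqF exy) ?implybT //; congr (_ `^ _); ring.
  rewrite /X mulrA mulrC; apply: ler_wpM2r; first exact: powR_ge0.
  rewrite -powRM ?(ltW k0) ?(ltW e0) //; apply: ge0_ler_powR; rewrite ?nnegrE ?(ltW d0) ?(ltW exy) //.
    by rewrite mulr_ge0 // ltW.
  apply: le_trans (enorm_le_norm _) _; rewrite /k -!mulrA ler_pM2l //.
  by rewrite -!mulrA in large; exact: ltW.
apply: le_trans (enormD _ _) _; rewrite enormN.
apply: le_trans (lerD (size _ _ Ox' Oy' xy') (size _ _ Ox Oy xy)) _.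
rewrite -mulrDr /B2 -2![leRHS]mulrA; apply: ler_wpM2l => //.
rewrite [leRHS]mulrDl mul1r addrC; apply: lerD => //.
by apply: le_trans rhon _; apply: ler_wpM2l; rewrite ?powR_ge0.
Qed.

End EuclideanHolder.

(** * Partial derivatives as directional derivatives on the product *)

Section Derivatives.
Variables (R : realType) (n : nat).
Local Notation V := 'rV[R]_n.
Local Notation W := 'rV[R]_2.
Local Notation E := (V * V)%type.
Implicit Types (G : V -> V -> W) (F : E -> W).

Definition unc G : E -> W := fun p => G p.1 p.2.

Lemma quotient_inr G (p : E) (v : V) :
  (fun h : R => h^-1 *: ((unc G \o shift p) (h *: ((0, v) : E)) - unc G p)) =
  (fun h : R => h^-1 *: ((G p.1 \o shift p.2) (h *: v) - G p.1 p.2)).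
Proof. by apply/funext => h; rewrite /unc /= scaler0 add0r. Qed.

Lemma quotient_inl G (p : E) (v : V) :
  (fun h : R => h^-1 *: ((unc G \o shift p) (h *: ((v, 0) : E)) - unc G p)) =
  (fun h : R => h^-1 *: (((G^~ p.2) \o shift p.1) (h *: v) - G p.1 p.2)).
Proof. by apply/funext => h; rewrite /unc /= scaler0 add0r. Qed.

Lemma unc_dY i G : unc (dY i G) = 'D_((0, unitv R i) : E) (unc G).
Proof. by apply/funext => p; rewrite [RHS]/derive quotient_inr. Qed.

Lemma unc_dX i G : unc (dX i G) = 'D_((unitv R i, 0) : E) (unc G).
Proof. by apply/funext => p; rewrite [RHS]/derive quotient_inl. Qed.

Lemma derivable_inr G (p : E) (v : V) :
  derivable (unc G) p ((0, v) : E) -> derivable (G p.1) p.2 v.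
Proof. by rewrite /derivable quotient_inr. Qed.

Lemma derivable_inl G (p : E) (v : V) :
  derivable (unc G) p ((v, 0) : E) -> derivable (G^~ p.2) p.1 v.
Proof. by rewrite /derivable quotient_inl. Qed.

Lemma norm_unitv (i : 'I_n) : `|unitv R i| <= 1.
Proof.
apply: norm_rV_le => // j; rewrite mxE eqxx /=.
by case: eqP; rewrite ?normr1 ?normr0 ?ler01.
Qed.

(** Covers all orders of differentiation at once, as needed both for [Ck_on] and for
    [dXa a (dYa b K)]. *)
Fixpoint iter_deriv (k : nat) F0 F : Prop :=
  if k is k'.+1 then exists (H : E -> W) (e : E), [/\ isdir e, `|e| <= 1, iter_deriv k' F0 H & F = 'D_e H]
  else F = F0.

Lemma iter_deriv_dY k i F0 G : iter_deriv k F0 (unc G) -> iter_deriv k.+1 F0 (unc (dY i G)).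
Proof.
move=> H; exists (unc G), (0, unitv R i).
by rewrite isdir_inr norm_inr norm_unitv unc_dY.
Qed.

Lemma iter_deriv_dX k i F0 G : iter_deriv k F0 (unc G) -> iter_deriv k.+1 F0 (unc (dX i G)).
Proof.
move=> H; exists (unc G), (unitv R i, 0).
by rewrite isdir_inl norm_inl norm_unitv unc_dX.
Qed.

Lemma iter_deriv_foldr (D : 'I_n -> (V -> V -> W) -> V -> V -> W) (a : 'I_n -> nat) k F0 G :
  (forall k i G, iter_deriv k F0 (unc G) -> iter_deriv k.+1 F0 (unc (D i G))) ->
  iter_deriv k F0 (unc G) ->
  iter_deriv (mabs a + k) F0 (unc (foldr (fun i K' => iter (a i) (D i) K') G (enum 'I_n))).
Proof.
move=> HD HG; rewrite /mabs -big_enum /=.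
elim: (enum 'I_n) => [|i s IH]; first by rewrite big_nil.
rewrite big_cons -addnA /=; elim: (a i) => [//|j IHj].
by rewrite addSn; exact: HD.
Qed.

Lemma iter_deriv_dXa_dYa (a b : 'I_n -> nat) F0 G : iter_deriv 0 F0 (unc G) ->
  iter_deriv (mabs a + mabs b) F0 (unc (dXa a (dYa b G))).
Proof.
move=> H; apply: iter_deriv_foldr; first by move=> *; exact: iter_deriv_dX.
rewrite -[mabs b]addn0; apply: iter_deriv_foldr => // *; exact: iter_deriv_dY.
Qed.

End Derivatives.

(** * Assembly of the first inclusion *)

Section StandardToSmooth.
Variables (R : realType) (n m : nat) (d : R) (O : set 'rV[R]_n).
Local Notation V := 'rV[R]_n.
Local Notation W := 'rV[R]_2.
Local Notation E := (V * V)%type.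
Hypotheses (mn : (0 < m < n)%N) (d01 : 0 < d < 1) (oO : open O).

Let d0 : 0 < d. Proof. by case/andP: d01. Qed.
Let n0 : (0 < n)%N. Proof. by case/andP: mn => _; apply: leq_trans. Qed.

Lemma open_offdiag : open (offdiag O).
Proof.
have -> : offdiag O = (fst @^-1` O) `&` (snd @^-1` O) `&` ((fun p : E => p.1 - p.2) @^-1` (~` [set 0])).
  apply/seteqP; split => [p [Op1 [Op2 p12]]|p [[Op1 Op2] p12]].
    by split=> //= /eqP; rewrite subr_eq0 (negbTE p12).
  by do 2?split => //; apply/eqP => p12'; apply: p12; rewrite /= p12' subrr.
apply: openI; first apply: openI.
- by apply: open_comp => // p _; exact: cvg_fst.
- by apply: open_comp => // p _; exact: cvg_snd.
apply: open_comp; last by apply: closed_openC; 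
  exact: (accessible_closed_set1 (hausdorff_accessible (@norm_hausdorff _ _))).
by move=> p _; apply: cvgB; [exact: cvg_fst|exact: cvg_snd].
Qed.

Lemma within_offdiag (G : V -> V -> W) :
  {within offdiag O, continuous (fun p : E => G p.1 p.2)} <->
  (forall x y, O x -> O y -> x != y -> {for (x, y), continuous (unc G)}).
Proof.
rewrite continuous_open_subspace; last exact: open_offdiag.
split=> [H x y Ox Oy xy|H [x y]]; first by apply: H; rewrite inE.
by rewrite inE => -[/= Ox [Oy xy]]; exact: H.
Qed.

Lemma offdiag_continuous (G : V -> V -> W) :
  {within offdiag O, continuous (fun p : E => G p.1 p.2)} ->
  forall x y, O x -> O y -> y != x -> {for y, continuous (G x)}.
Proof.
move=> /within_offdiag H x y Ox Oy yx.
rewrite eq_sym in yx; have {}H := H x y Ox Oy yx.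
apply: (@continuous_comp _ _ _ (fun y => (x, y) : E) (unc G)) => //.
apply: (@cvg_pair _ _ _ (nbhs y) (nbhs x) (nbhs y) _ _ _ (fun=> x) id); [exact: cvg_cst|exact: cvg_id].
Qed.

Lemma within_transpose (G : V -> V -> W) :
  {within offdiag O, continuous (fun p : E => G p.1 p.2)} ->
  {within offdiag O, continuous (fun p : E => G p.2 p.1)}.
Proof.
move=> /within_offdiag H; apply/(@within_offdiag (fun x y => G y x)) => x y Ox Oy xy.
rewrite eq_sym in xy; have {}H := H y x Oy Ox xy.
apply: (@continuous_comp _ _ _ (@swap R n) (unc G)) => //.
by apply: (@cvg_pair _ _ _ (nbhs ((x, y) : E)) (nbhs y) (nbhs x) _ _ _ snd fst); [exact: cvg_snd|exact: cvg_fst].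
Qed.

Lemma std_kernel_class K c : 1 <= c -> chainable O c -> std_kernel O m d K ->
  exists C Lam, [/\ 0 <= C, 1 <= Lam & smooth_class m d O 0 C Lam (unc K)].
Proof.
move=> c1 chO [cK [C [C1 [sK [bK bKt]]]]].
case/andP: (mn) => m0 mltn.
have C0 : 0 <= C by exact: le_trans C1.
have [A1 [L1 [A10 L10 H1]]] := pointwise_difference_bound n0 d0 C1 oO (offdiag_continuous cK) bK.
have [A2 [L2 [A20 L20 H2]]] := pointwise_difference_bound n0 d0 C1 oO
  (@offdiag_continuous (fun x y => K y x) (within_transpose cK)) bKt.
have [A [L [A0 L0 H]]] := diff_bound_base d01 A10 L10 A20 L20 H1 H2.
have sF x y : O x -> O y -> x != y -> `|unc K (x, y)| <= C * `|x - y| `^ (m%:R - n%:R).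
  move=> Ox Oy xy; apply: le_trans (norm_le_enorm _) _; apply: le_trans (sK _ _ Ox Oy xy) _.
  have xy0 : 0 < `|x - y| by rewrite normr_gt0 subr_eq0.
  apply: ler_wpM2l => //; rewrite -opprB !powRN lef_pV2 ?posrE ?powR_gt0 ?edist_gt0 //.
  apply: ge0_ler_powR; rewrite ?nnegrE ?enorm_ge0 ?norm_le_enorm //.
  by rewrite subr_ge0 ler_nat ltnW.
have [C' [Lam' [C'0 Lam'1 H']]] := diff_bound_all mn d01 c1 chO C0 sF A0 L0 H.
exists C', Lam'; split => // q qm x y t l t0 rx ry txy sl hl.
rewrite addn0 expr0 divr1; apply: (H' q) => //.
by rewrite addn0 in qm; apply: leq_trans qm _; rewrite ltnS leq_addr.
Qed.

Lemma iter_deriv_class F0 C0 Lam0 k : 0 <= C0 -> 1 <= Lam0 ->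
  smooth_class m d O 0 C0 Lam0 F0 -> (k <= m)%N ->
  exists C Lam, [/\ 0 <= C, 1 <= Lam &
    forall F, iter_deriv k F0 F -> smooth_class m d O k C Lam F].
Proof.
move=> C00 Lam01 HF0; elim: k => [_|k IH km].
  by exists C0, Lam0; split => // F ->.
have [C [Lam [C_ge0 Lam1 H]]] := IH (ltnW km).
have [C' [Lam' [C'0 Lam'1 H']]] := smooth_class_derive mn d01 oO km C_ge0 Lam1.
exists C', Lam'; split => // _ [G [e [de e1 HG ->]]].
by apply: H' => //; exact: H.
Qed.

Lemma iter_deriv_Ck F0 C0 Lam0 k j G : 0 <= C0 -> 1 <= Lam0 ->
  smooth_class m d O 0 C0 Lam0 F0 -> (j + k <= m)%N -> iter_deriv j F0 (unc G) ->
  Ck_on (offdiag O) k G.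
Proof.
move=> C00 Lam01 HF0; elim: k j G => [|k IH] j G jk HG.
  have jm : (j <= m)%N by apply: leq_trans jk; rewrite leq_addr.
  have [C [Lam [C_ge0 Lam1 H]]] := iter_deriv_class C00 Lam01 HF0 jm.
  split=> //; apply/within_offdiag => x y Ox Oy xy.
  exact: smooth_class_continuous (H _ HG) Ox Oy xy.
have jm : (j < m)%N by apply: leq_trans jk; rewrite addnS ltnS leq_addr.
have [C [Lam [C_ge0 Lam1 H]]] := iter_deriv_class C00 Lam01 HF0 (ltnW jm).
split; first apply/within_offdiag => x y Ox Oy xy.
  exact: smooth_class_continuous (ltnW jm) C_ge0 Lam1 (H _ HG) Ox Oy xy.
split=> [i [x y] [/= Ox [Oy xy]]|i].
  have HD e : isdir e -> `|e| <= 1 -> derivable (unc G) (x, y) e.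
    move=> de e1; exact: smooth_class_derivable jm C_ge0 Lam1 (H _ HG) de e1 Ox Oy xy.
  split.
    by apply: (@derivable_inl _ _ _ (x, y)); apply: HD; rewrite ?isdir_inl ?norm_inl ?norm_unitv.
  by apply: (@derivable_inr _ _ _ (x, y)); apply: HD; rewrite ?isdir_inr ?norm_inr ?norm_unitv.
rewrite -addSnnS in jk.
by split; apply: IH jk _; [exact: iter_deriv_dX|exact: iter_deriv_dY].
Qed.

(** A smooth kernel has one constant for all orders up to m. *)
Lemma uniform_bound (P : nat -> R -> Prop) (N : nat) :
  (forall k C C', C <= C' -> P k C -> P k C') ->
  (forall k, (k <= N)%N -> exists C, P k C) ->
  exists C, forall k, (k <= N)%N -> P k C.
Proof.
move=> mono; elim: N => [|N IH] H.
  by have [C HC] := H 0%N (leqnn _); exists C => k; rewrite leqn0 => /eqP->.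
have [C HC] := IH (fun k kN => H k (leqW kN)); have [C' HC'] := H N.+1 (leqnn _).
exists (Num.max C C') => k; rewrite leq_eqVlt ltnS => /orP[/eqP->|kN].
  by apply: mono HC'; rewrite le_max lexx orbT.
by apply: mono (HC k kN); rewrite le_max lexx.
Qed.

Lemma std_kernel_smooth K c : 1 <= c -> chainable O c -> std_kernel O m d K ->
  smooth_kernel O m d K.
Proof.
move=> c1 chO HK; have [C0 [Lam0 [C00 Lam01 H0]]] := std_kernel_class c1 chO HK.
split; first exact: (iter_deriv_Ck (j := 0%N) C00 Lam01 H0).
have [S HS] : exists S, forall k, (k <= m)%N -> 0 <= S /\ forall G, iter_deriv k (unc K) (unc G) ->
    forall x y, O x -> O y -> x != y -> enorm (G x y) <= S * edist x y `^ (m%:R - n%:R - k%:R).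
  apply: uniform_bound => [k C C' CC [C_ge0 H]|k km].
    split=> [|G HG x y Ox Oy xy]; first exact: le_trans CC.
    by apply: le_trans (H G HG x y Ox Oy xy) _; rewrite ler_wpM2r ?powR_ge0.
  have [C [Lam [C_ge0 Lam1 H]]] := iter_deriv_class C00 Lam01 H0 km.
  exists (2 * (C * 2 ^+ (n + m).+1 * n%:R ^+ (n + m))); split; first by rewrite !mulr_ge0 ?exprn_ge0.
  move=> G HG x y Ox Oy xy.
  exact: smooth_class_size_enorm km C_ge0 Lam1 (H _ HG) Ox Oy xy.
have [C [Lam [C_ge0 Lam1 H]]] := iter_deriv_class C00 Lam01 H0 (leqnn m).
have [B B0 HB] := smooth_class_holder_enorm mn d01 oO c1 chO C_ge0 Lam1.
have holder a b x y x' y' e : (mabs a + mabs b = m)%N -> O x -> O y -> O x' -> O y' ->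
    enorm (x' - x) <= e -> enorm (y' - y) <= e -> e <= edist x y / 2 ->
    edist x y <= edist x' y' + e -> (e = 0 -> x' = x /\ y' = y) ->
    enorm (dXa a (dYa b K) x' y' - dXa a (dYa b K) x y) <=
      Num.max B S * e `^ d * edist x y `^ (- (n%:R + d)).
  move=> ab Ox Oy Ox' Oy' hx hy he hxy e_eq0.
  have e_ge0 : 0 <= e by apply: le_trans hx; exact: enorm_ge0.
  have max0 : 0 <= Num.max B S by rewrite le_max B0.
  (* If x = y, the bound on the increment forces e = 0; then nothing moves and both sides can be
     read at 0. *)
  have [e0|e0] := ltP 0 e; last first.
    have [|-> ->] := e_eq0; first by apply/le_anti; rewrite e0.
    by rewrite subrr enorm0 !mulr_ge0 ?powR_ge0.
  have exy : 0 < edist x y by rewrite -(@pmulr_lgt0 _ 2^-1) ?invr_gt0 //; exact: lt_le_trans he.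
  have xy : x != y by rewrite -edist_gt0.
  have HG : smooth_class m d O m C Lam (unc (dXa a (dYa b K))).
    by apply: H; rewrite -ab; exact: iter_deriv_dXa_dYa.
  apply: le_trans (HB _ HG x y x' y' e Ox Oy Ox' Oy' e0 hx hy xy _) _; first by lra.
  by do 2 (apply: ler_wpM2r; first exact: powR_ge0); rewrite le_max lexx.
exists (Num.max B S); split=> [a b x y abm Ox Oy xy|].
  have [S0 HSk] := HS _ abm.
  apply: le_trans (HSk _ _ x y Ox Oy xy) _; first exact: iter_deriv_dXa_dYa.
  rewrite natrD opprD addrA; apply: ler_wpM2r; first exact: powR_ge0.
  by rewrite le_max lexx orbT.
split=> a b x y h abm.
  move=> Ox Oy Oyh hh; apply: holder => //; rewrite ?subrr ?enorm0 ?enorm_ge0 //.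
  - by rewrite addrAC subrr add0r.
  - have := edist_triangle (y + h) x y; rewrite /edist [y + h - y]addrAC subrr add0r; exact.
  - by move=> /enorm_eq0 ->; rewrite addr0.
move=> Ox Oxh Oy hh; apply: holder => //; rewrite ?subrr ?enorm0 ?enorm_ge0 //.
- by rewrite addrAC subrr add0r.
- have := edist_triangle (x + h) x y; rewrite [edist x (x + h)]edistC.
  rewrite [edist (x + h) x]/edist [x + h - x]addrAC subrr add0r [X in _ <= X -> _]addrC; exact.
- by move=> /enorm_eq0 ->; rewrite addr0.
Qed.

End StandardToSmooth.

(** * Smooth kernels are standard *)

Section MeanValue.
Variables (R : realType).

Lemma cvg_coordinate (T : Type) (Fi : set_system T) {FF : Filter Fi} (k : nat)
    (u : T -> 'rV[R]_k) (l : 'rV[R]_k) i :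
  u @ Fi --> l -> (fun t => u t 0 i) @ Fi --> l 0 i.
Proof.
move=> ul; apply/cvgrPdist_le => e e0; have /cvgrPdist_le/(_ e e0) := ul.
apply: filterS => t; apply: le_trans.
have -> : l 0 i - u t 0 i = (l - u t) 0 i by rewrite !mxE.
exact: norm_coord.
Qed.

(** The one-dimensional mean value theorem is applied to each coordinate; the sup norm combines them
    without loss. *)
Lemma mean_value_le (k : nat) (g dg : R -> 'rV[R]_k) (a B : R) :
  (forall s, `|s| <= `|a| -> (fun h => h^-1 *: (g (h + s) - g s)) @ 0^' --> dg s) ->
  (forall s, `|s| <= `|a| -> `|dg s| <= B) -> `|g a - g 0| <= `|a| * B.
Proof.
move=> gd dgB.
have B0 : 0 <= B by apply: le_trans (dgB 0 _); rewrite ?normr0.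
apply: norm_rV_le => [|i]; first by rewrite mulr_ge0.
pose f s : R := g s 0 i.
have fd s : `|s| <= `|a| -> is_derive s (1 : R) f (dg s 0 i).
  move=> sa; have := @cvg_coordinate _ _ (dnbhs_filter 0) _ _ _ i (gd s sa) => fc.
  have fE : (fun h : R => h^-1 *: ((f \o shift s) (h *: (1 : R)) - f s)) =
      (fun h => (h^-1 *: (g (h + s) - g s)) 0 i).
    by apply/funext => h; rewrite /f /= !mxE [h *: _]mulr1.
  apply: DeriveDef; first by rewrite /derivable fE; apply/cvg_ex; exists (dg s 0 i).
  rewrite /derive fE; exact: cvg_lim fc.
have main x y : x <= y -> (forall s, x <= s <= y -> `|s| <= `|a|) -> `|f y - f x| <= (y - x) * B.
  move=> xy sxy.
  have [c cxy ->] : exists2 c, c \in `[x, y] & f y - f x = dg c 0 i * (y - x).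
    apply: (@MVT_segment _ f (fun c => dg c 0 i)) => // [s /andP[]|].
      by rewrite !bnd_simp => xs sy; apply: fd; apply: sxy; rewrite !ltW.
    apply: derivable_within_continuous => s; rewrite in_itv /= => sI.
    by have [] := fd s (sxy s sI).
  rewrite normrM [`|y - x|]ger0_norm ?subr_ge0 // mulrC; apply: ler_wpM2l; first by rewrite subr_ge0.
  by apply: le_trans (norm_coord _ _) _; apply: dgB; apply: sxy; rewrite in_itv /= in cxy.
have -> : (g a - g 0) 0 i = f a - f 0 by rewrite !mxE.
have [a0|a0] := leP 0 a.
  rewrite [X in _ <= X * _]ger0_norm // -[X in _ <= X * _](subr0 a); apply: main => // s /andP[s0 sa].
  by rewrite !ger0_norm.
rewrite distrC [X in _ <= X * _]ltr0_norm // -[X in _ <= X * _]sub0r.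
apply: main => [|s /andP[sa s0]]; first exact: ltW.
by rewrite (ler0_norm s0) (ltr0_norm a0) lerN2.
Qed.

End MeanValue.

(** * Differences bounded by partial derivatives *)

Section CoordinateDifferences.
Variables (R : realType) (n : nat).
Local Notation V := 'rV[R]_n.
Local Notation W := 'rV[R]_2.
Local Notation u := (@unitv R n).

(** A word, unlike a multi-index, records the order in which the derivatives are taken. *)
Fixpoint Dw (w : seq 'I_n) (f : V -> W) : V -> W :=
  if w is i :: w' then Dw w' ('D_(u i) f) else f.

Lemma Dw_cat w1 w2 f : Dw (w1 ++ w2) f = Dw w2 (Dw w1 f).
Proof. by elim: w1 f => /=. Qed.

Lemma Dw_nseq k i f : Dw (nseq k i) f = iter k (fun g => 'D_(u i) g) f.
Proof. by elim: k f => //= k IH f; rewrite IH -iterSr. Qed.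

Definition pderiv (b : 'I_n -> nat) (f : V -> W) : V -> W :=
  foldr (fun i g => iter (b i) (fun g => 'D_(u i) g) g) f (enum 'I_n).

Definition coords (l : seq (R * 'I_n)) : seq V := [seq p.1 *: u p.2 | p <- l].

(** Differences commute exactly, so the steps may be arranged in whatever order makes the resulting
    word of derivatives equal to [pderiv b]. *)
Lemma sort_by_coord (l : seq (R * 'I_n)) : exists l' b,
  [/\ perm_eq l' l, mabs b = size l & forall f, Dw (map snd l') f = pderiv b f].
Proof.
pose b i := count (fun p : R * 'I_n => p.2 == i) l.
(* The block of i is put at the end because [pderiv] applies the derivatives of the earlier
   coordinates last, while [Dw] starts with the head. *)
pose srt := foldr (fun i (acc : seq (R * 'I_n)) => acc ++ [seq p <- l | p.2 == i]) [::].
exists (srt (enum 'I_n)), b; split.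
- have cnt p s : count_mem p (srt s) = (count_mem p l * count_mem p.2 s)%N.
    elim: s => [|i s IH] /=; first by rewrite muln0.
    rewrite count_cat IH mulnDr addnC; congr (_ + _)%N.
    rewrite count_filter; case: (eqVneq i p.2) => [->|ip]; rewrite ?muln1 ?muln0.
      by apply: eq_count => q /=; case: eqP => [->|]; rewrite ?eqxx.
    rewrite -(count_pred0 l); apply: eq_count => q /=.
    by case: eqP => [->|]; rewrite //= eq_sym (negbTE ip).
  apply/allP => p _ /=; rewrite cnt.
  by rewrite [count_mem p.2 _]count_uniq_mem ?enum_uniq // mem_enum muln1.
- rewrite /mabs /b; elim: l {b srt} => [|p l IH] /=; first by rewrite big1.
  rewrite big_split /= IH (bigD1 p.2) //= eqxx big1 // => i ip.
  by rewrite eq_sym (negbTE ip).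
move=> f; rewrite /pderiv; elim: (enum 'I_n) => //= i s IH.
rewrite map_cat Dw_cat IH -Dw_nseq; congr Dw.
rewrite /b; elim: l {IH b srt} => //= p l IH.
by case: eqP => [pi|_]; rewrite /= ?pi IH.
Qed.

Definition smooth_on (D : set V) (k : nat) (f : V -> W) : Prop :=
  forall w i z, (size w < k)%N -> D z -> derivable (Dw w f) z (u i).

(** Each coordinate step is traded for a derivative by [mean_value_le]. The difference with step h
    stays to the end, where it becomes the oscillation of the last derivative. *)
Lemma Dl_coords_le D l f z h t B : (forall p, p \in l -> `|p.1| <= t) ->
  smooth_on D (size l) f ->
  (forall z', `|z' - z| <= (size l)%:R * t ->
     [/\ D z', D (z' + h) & `|Dw (map snd l) f (z' + h) - Dw (map snd l) f z'| <= B]) ->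
  `|Dl (coords l) (D1 h f) z| <= \prod_(p <- l) `|p.1| * B.
Proof.
elim: l f z => [|[a i] l IH] f z hl sf H.
  rewrite big_nil mul1r /= /D1; have [|_ _] := H z; first by rewrite subrr normr0 mul0r.
  by [].
have at_ : `|a| <= t by apply: (hl (a, i)); rewrite mem_head.
have hl' p : p \in l -> `|p.1| <= t by move=> hp; apply: hl; rewrite inE hp orbT.
rewrite big_cons -mulrA /=.
pose L := coords l; pose g s := Dl L (D1 h f) (z + s *: u i).
have -> : Dl L (D1 h f) (z + a *: u i) - Dl L (D1 h f) z = g a - g 0.
  by rewrite /g scale0r addr0.
have au (s : R) : `|s| <= `|a| -> `|s *: u i| <= t.
  move=> sa; rewrite normrZ; apply: le_trans (le_trans sa at_).
  by rewrite -[leRHS]mulr1 ler_wpM2l // norm_unitv.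
have near_z s z' : `|s| <= `|a| -> `|z' - (z + s *: u i)| <= (size l)%:R * t ->
    `|z' - z| <= (size l).+1%:R * t.
  move=> sa hz; rewrite -natr1 mulrDl mul1r; apply: le_trans (ler_distD (z + s *: u i) _ _) _.
  by apply: lerD => //; rewrite addrAC subrr add0r au.
apply: (@mean_value_le _ _ g (fun s => Dl L (D1 h ('D_(u i) f)) (z + s *: u i))) => s sa.
  have -> : (fun e : R => e^-1 *: (g (e + s) - g s)) =
      (fun e => Dl L (quot (u i) (D1 h f) e) (z + s *: u i)).
    apply/funext => e; rewrite Dl_quot /g /= scalerDl; congr (_ *: (Dl _ _ _ - _)).
    by rewrite addrA addrAC.
  apply: (@Dl_cvg _ _ _ _ _ (dnbhs_filter 0) _ _ _ _ t).
    move=> k /mapP[[b j] /hl' /= bt ->]; rewrite normrZ; apply: le_trans bt.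
    by rewrite -[leRHS]mulr1 ler_wpM2l // norm_unitv.
  move=> z'; rewrite size_map => hz; have [Dz Dzh _] := H z' (near_z s z' sa hz).
  have -> : (fun e => quot (u i) (D1 h f) e z') = (fun e => quot (u i) f e (z' + h) - quot (u i) f e z').
    by apply/funext => e; rewrite /quot /D1 addrA; lmod R.
  apply: cvgB; [exact: (sf [::] i (z' + h))|exact: (sf [::] i z')].
apply: IH => //.
  by move=> w j z' wk; apply: (sf (i :: w)).
by move=> z' hz; exact: H (near_z s z' sa hz).
Qed.

(** The k-th vertex of the staircase from 0 to h along the coordinate axes. *)
Definition partial_row (h : V) (k : nat) : V := \row_j (if (j < k)%N then h 0 j else 0).

Lemma norm_partial_row h k : `|partial_row h k| <= `|h|.
Proof.
apply: norm_rV_le => // i; rewrite mxE; case: ifP => _; last by rewrite normr0.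
exact: norm_coord.
Qed.

Lemma D1_coords (h : V) (f : V -> W) z :
  D1 h f z = \sum_(i < n) D1 (h 0 i *: u i) f (z + partial_row h i).
Proof.
pose F k := f (z + partial_row h k).
have -> : D1 h f z = F n - F 0%N.
  rewrite /D1 /F; congr (f _ - f _); last first.
    by rewrite (_ : partial_row h 0 = 0) ?addr0 //; apply/rowP => j; rewrite !mxE.
  by congr (_ + _); apply/rowP => j; rewrite mxE ltn_ord.
rewrite -(@telescope_sumr _ 0 n F) // big_mkord; apply: eq_bigr => i _.
rewrite /D1 /F -addrA; congr (f (_ + _) - _).
apply/rowP => j; rewrite !mxE eqxx /= ltnS leq_eqVlt.
have -> : (j == i :> nat) = (j == i) by [].
case: eqVneq => [->|ji] /=; first by rewrite ltnn mulr1 add0r.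
by rewrite mulr0 addr0.
Qed.

Section Staircase.
Variables (D : set V) (m : nat) (f : V -> W) (h : V) (N : nat) (B : R).
Hypotheses (N0 : (0 < N)%N) (sf : smooth_on D m f).
Hypothesis fB : forall b z, mabs b = m -> D z -> D (z + h) ->
  `|pderiv b f (z + h) - pderiv b f z| <= B.

Let tau := `|h| / N%:R.
Let NR0 : 0 < N%:R :> R. Proof. by rewrite ltr0n. Qed.
Let tau0 : 0 <= tau. Proof. by rewrite divr_ge0. Qed.
Let S := \sum_(i < n) `|h 0 i|.
Let S0 : 0 <= S. Proof. by apply: sumr_ge0. Qed.

(* The room left around the segment while [j] of the steps [h] remain to be
   subdivided. *)
Definition tube (j : nat) (rho : R) (z : V) : Prop :=
  forall s : R, 0 <= s <= j.+1%:R -> room D (z + s *: h) rho.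

Lemma staircase_base l z : size l = m -> (forall p, p \in l -> `|p.1| <= tau) ->
  tube 0 (m%:R * tau) z ->
  `|Dl (coords l) (D1 h f) z| <= \prod_(p <- l) `|p.1| * B.
Proof.
move=> sl hl tz; have [l' [b [pl bl Db]]] := sort_by_coord l.
rewrite (Dl_perm _ _ (_ : perm_eq _ (coords l'))); last by rewrite perm_map // perm_sym.
rewrite -(perm_big _ pl) /=; have sl' := perm_size pl.
apply: (@Dl_coords_le D _ _ _ _ tau); first by move=> p; rewrite (perm_mem pl); exact: hl.
  by rewrite sl' sl.
move=> z'; rewrite sl' sl => hz.
have Dz : D z'.
  by have := tz 0; rewrite lexx ler01 scale0r addr0 => /(_ isT); exact.
have Dzh : D (z' + h).
  have := tz 1; rewrite lexx ler01 scale1r => /(_ isT); apply.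
  by rewrite opprD addrACA subrr addr0.
by split=> //; rewrite Db; apply: fB => //; rewrite bl.
Qed.

(** Each step h is cut into N pieces, and each piece into n coordinate steps. The lengths of these N
    n steps add up to S, so every resolved step contributes one factor S. *)
Lemma staircase j l z : (j + size l = m)%N -> (forall p, p \in l -> `|p.1| <= tau) ->
  tube j ((j + m)%:R * tau) z ->
  `|Dl (nseq j h ++ coords l) (D1 h f) z| <= S ^+ j * (\prod_(p <- l) `|p.1| * B).
Proof.
elim: j l z => [|j IH] l z jl hl tz.
  by rewrite expr0 mul1r; apply: staircase_base.
set L := nseq j h ++ coords l; set G := D1 h f; pose h' := N%:R^-1 *: h.
set P := \prod_(p <- l) _.
have hE : h = N%:R *: h' by rewrite scalerA divff ?scale1r // gt_eqF.
have -> : Dl (nseq j.+1 h ++ coords l) G z = D1 h (Dl L G) z by [].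
rewrite {1}hE D1_mul.
have h'i i : `|h' 0 i| = `|h 0 i| / N%:R by rewrite mxE normrM gtr0_norm ?invr_gt0 // mulrC.
have h't : `|h'| = tau by rewrite normrZ gtr0_norm ?invr_gt0 // mulrC.
have -> : S ^+ j.+1 * (P * B) = \sum_(k < N) \sum_(i < n) S ^+ j * (`|h' 0 i| * P * B).
  rewrite sumr_const card_ord -mulr_sumr.
  have -> : \sum_(i < n) `|h' 0 i| * P * B = S / N%:R * P * B.
    by rewrite -!mulr_suml; congr (_ * _ * _); rewrite /S mulr_suml; apply: eq_bigr => i _.
  by rewrite -mulr_natr exprS; field; rewrite gt_eqF.
apply: le_trans (ler_norm_sum _ _ _) _; apply: ler_sum => k _.
rewrite D1_coords; apply: le_trans (ler_norm_sum _ _ _) _; apply: ler_sum => i _.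
set z' := z + _ + _.
have -> : D1 (h' 0 i *: u i) (Dl L G) z' = Dl (nseq j h ++ coords ((h' 0 i, i) :: l)) G z'.
  transitivity (Dl (h' 0 i *: u i :: L) G z') => //; apply: Dl_perm.
  by rewrite /L /= -[_ :: coords l]cat1s -cat1s perm_catCA.
have := IH ((h' 0 i, i) :: l) z'; rewrite big_cons /= => {}IH; apply: IH.
- by rewrite addnS -addSn.
- move=> p; rewrite inE => /orP[/eqP->|/hl //] /=.
  by rewrite -h't; exact: norm_coord.
move=> s /andP[s0 sj] v hv.
have k1 : k%:R / N%:R <= 1 :> R by rewrite ler_pdivrMr // mul1r ler_nat ltnW.
have := tz (s + k%:R / N%:R); apply.
  by rewrite addr_ge0 ?divr_ge0 //= -[j.+2]addn1 natrD; exact: lerD.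
apply: le_trans (ler_distD (z' + s *: h) _ _) _.
rewrite addSn -natr1 mulrDl mul1r; apply: lerD => //.
have -> : z' + s *: h - (z + (s + k%:R / N%:R) *: h) = partial_row h' i.
  by rewrite /z' /h'; lmod R.
by rewrite -h't norm_partial_row.
Qed.

End Staircase.

(** By convexity, the smaller of the rooms at the two ends is available around the whole segment,
    and a fine enough staircase stays inside; B is unaffected by the fineness N. *)
Lemma Dl_nseq_le (D : set V) (m : nat) (f : V -> W) (y h : V) (B : R) : open D ->
  (forall a b s, 0 <= s <= 1 -> D a -> D b -> D ((1 - s) *: a + s *: b)) ->
  smooth_on D m f ->
  (forall b z, mabs b = m -> D z -> D (z + h) -> `|pderiv b f (z + h) - pderiv b f z| <= B) ->
  D y -> D (y + m.+1%:R *: h) ->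
  `|Dl (nseq m.+1 h) f y| <= (\sum_(i < n) `|h 0 i|) ^+ m * B.
Proof.
move=> oD cD sf fB Dy Dyh.
have [r r0 ry] := open_room oD Dy; have [r' r'0 ry'] := open_room oD Dyh.
pose rho := Num.min r r'; have rho0 : 0 < rho by rewrite lt_min r0.
(* Up to m subdivisions and m coordinate steps, each of size at most [|h| / N], deviate from the
   segment. *)
pose N := (Num.truncn ((m + m)%:R * `|h| / rho)).+1.
have tau_le : (m + m)%:R * (`|h| / N%:R) <= rho.
  rewrite mulrA ler_pdivrMr ?ltr0n // [leRHS]mulrC -ler_pdivrMr //; exact/ltW/truncnS_gt.
have := @staircase D m f h N B isT sf fB m [::] y; rewrite big_nil mul1r cats0 addn0 => H.
rewrite -[nseq m.+1 h]/(h :: nseq m h) Dl_consr; apply: H => // s /andP[s0 sm] v hv.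
have m0 : 0 < m.+1%:R :> R by rewrite ltr0n.
pose s' := s / m.+1%:R; pose w := v - (y + s *: h).
have wr : `|w| <= rho by apply: le_trans hv _.
have -> : v = (1 - s') *: (y + w) + s' *: (y + m.+1%:R *: h + w).
  have -> : s' *: (y + m.+1%:R *: h + w) = s' *: (y + w) + s *: h.
    have -> : s *: h = s' *: (m.+1%:R *: h) by rewrite scalerA /s' divfK // gt_eqF.
    by lmod R.
  by rewrite /w; lmod R.
apply: cD.
- by rewrite divr_ge0 //= /s' ler_pdivrMr // mul1r.
- by apply: ry; rewrite addrAC subrr add0r (le_trans wr) // ge_min lexx.
- by apply: ry'; rewrite addrAC subrr add0r (le_trans wr) // ge_min lexx orbT.
Qed.

End CoordinateDifferences.

(** * The second inclusion *)

Section SmoothToStandard.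
Variables (R : realType) (n m : nat) (d : R) (O : set 'rV[R]_n).
Local Notation V := 'rV[R]_n.
Local Notation W := 'rV[R]_2.
Hypotheses (n0 : (0 < n)%N) (d0 : 0 < d).

Let nR0 : 0 < n%:R :> R. Proof. by rewrite ltr0n. Qed.
Let nd0 : 0 < n%:R + d. Proof. by rewrite ltr_wpDl. Qed.

Lemma open_eball (c : V) (r : R) : open (eball c r).
Proof.
rewrite openE => y hy; have e0 : 0 < (r - edist y c) / n%:R by rewrite divr_gt0 // subr_gt0.
apply: filterS (nbhsx_ballx y _ e0) => z; rewrite -ball_normE /= => hz.
apply: (le_lt_trans (edist_triangle y z c)).
rewrite -ltrBrDr; apply: le_lt_trans (enorm_le_norm _) _.
by rewrite distrC mulrC -ltr_pdivlMr.
Qed.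

Lemma convex_eball (c : V) (r : R) (a b : V) (s : R) : 0 <= s <= 1 ->
  eball c r a -> eball c r b -> eball c r ((1 - s) *: a + s *: b).
Proof.
move=> /andP[s0 s1]; rewrite /eball /= /edist => ha hb.
have -> : (1 - s) *: a + s *: b - c = (1 - s) *: (a - c) + s *: (b - c) by lmod R.
apply: le_lt_trans (enormD _ _) _; rewrite !enormZ !ger0_norm ?subr_ge0 //.
have [->|s_neq0] := eqVneq s 0; first by rewrite subr0 mul1r mul0r addr0.
have s_gt0 : 0 < s by rewrite lt_def s_neq0.
have h1 : (1 - s) * enorm (a - c) <= (1 - s) * r by rewrite ler_wpM2l ?subr_ge0 // ltW.
have h2 : s * enorm (b - c) < s * r by rewrite ltr_pM2l.
by have := ler_ltD h1 h2; rewrite -mulrDl subrK mul1r.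
Qed.

Lemma enorm_unitv (i : 'I_n) : enorm (unitv R i) = 1.
Proof.
rewrite /enorm (bigD1 i) //= big1 => [|j ji]; first by rewrite mxE !eqxx addr0 expr1n sqrtr1.
by rewrite mxE (negbTE ji) andbF expr0n.
Qed.

Lemma diam_eball_ge (c : V) (r : R) : 0 < r -> ((r / 2)%:E <= diam (eball c r))%E.
Proof.
move=> r0; have i : 'I_n by exact: Ordinal n0.
have := @le_diam_eball _ _ c ((r / 2) *: unitv R i) r.
rewrite enormZ enorm_unitv mulr1 ger0_norm ?divr_ge0 ?(ltW r0) //; apply.
by rewrite ltr_pdivrMr // ltr_pMr // ltr1n.
Qed.

(** The factor 2 comes from the norm of values, n^m from the sum of |h_i|, 2^(n+d) from replacing |x
    - z| by |x - c|, and the last power from (2r)^(n+m+d) divided by (r/n)^(n+m+d), the lower bound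
    for the power of the volume. *)
Definition ball_cst : R :=
  2 * n%:R ^+ m * 2 `^ (n%:R + d) * (2 * n%:R) `^ (n%:R + (m%:R + d)).

Lemma ball_cst_ge0 : 0 <= ball_cst.
Proof. by rewrite !mulr_ge0 ?exprn_ge0 ?powR_ge0. Qed.

(** The difference is bounded pointwise on the ball, which is convex as [Dl_nseq_le] requires; the
    integral is then at most this bound times the volume of a cube. *)
Lemma smooth_ball_bound (f : V -> W) (x c h : V) (r C : R) : 0 <= C ->
  smooth_on (fun z => O z /\ x != z) m f ->
  (forall b z h, mabs b = m -> O z -> O (z + h) -> enorm h <= edist x z / 2 ->
     enorm (pderiv b f (z + h) - pderiv b f z)
       <= C * enorm h `^ d * edist x z `^ (- (n%:R + d))) ->
  0 < r -> eball c r `<=` O -> 8 * r <= edist x c -> enorm h <= 2 * r ->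
  (((fine (volume (eball c r)) `^ (1 + (m%:R + d) / n%:R))^-1)%:E *
     Rn_integral_on (eball c r) (fun y => (enorm (Delta m.+1 h f (eball c r) y))%:E)
   <= (C * ball_cst * edist x c `^ (- (n%:R + d)))%:E)%E.
Proof.
move=> C0 sf hf r0 BO hr hh.
set e := edist x c in hr *; have e0 : 0 < e by apply: lt_le_trans hr; exact: mulr_gt0.
have r20 : 0 < 2 * r by exact: mulr_gt0.
(* Then |h| <= 2 r <= e / 4 is below half of |x - z|, so the Hoelder estimate applies throughout the
   ball. *)
have far z : eball c r z -> 7 * (e / 8) <= edist x z.
  move=> hz; have := edist_triangle z x c; rewrite -/e; rewrite /eball /= in hz; lra.
pose X := e `^ (- (n%:R + d)); have X0 : 0 <= X by exact: powR_ge0.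
have h0 := enorm_ge0 h.
pose B := C * enorm h `^ d * (2 `^ (n%:R + d) * X).
pose k := 2 * ((n%:R * (2 * r)) ^+ m * (C * (2 * r) `^ d * (2 `^ (n%:R + d) * X))).
have k0 : 0 <= k by rewrite !mulr_ge0 ?exprn_ge0 ?mulr_ge0 ?powR_ge0 // ltW.
have pointwise y : eball c r y -> enorm (Delta m.+1 h f (eball c r) y) <= k.
  move=> hy; have [hD|hD] := pselect (forall j : nat, (j <= m.+1)%N -> eball c r (y + j%:R *: h)); last first.
    by rewrite /Delta asboolF // enorm0.
  rewrite Delta_in //; apply: le_trans (enorm_le_norm _) _; rewrite /k; apply: ler_wpM2l => //.
  apply: (@le_trans _ _ ((\sum_(i < n) `|h 0 i|) ^+ m * B)).
    apply: (@Dl_nseq_le _ _ (eball c r)).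
    - exact: open_eball.
    - by move=> a b s; exact: convex_eball.
    - move=> w i z wm hz; apply: sf => //; split; first exact: BO.
      rewrite -edist_gt0; apply: lt_le_trans (far z hz); rewrite mulr_gt0 // divr_gt0 //.
    - move=> b z bm hz hzh; apply: le_trans (norm_le_enorm _) _.
      have fz := far z hz.
      apply: le_trans (hf b z h bm (BO _ hz) (BO _ hzh) _) _; first by lra.
      apply: ler_wpM2l; first by rewrite mulr_ge0 ?powR_ge0.
      by apply: powR_half_le => //; apply: le_trans fz; lra.
    - exact: hy.
    - exact: hD.
  have S0 : 0 <= \sum_(i < n) `|h 0 i| by exact: sumr_ge0.
  apply: ler_pM; rewrite ?exprn_ge0 ?mulr_ge0 ?powR_ge0 //.
    rewrite lerXn2r ?nnegrE ?mulr_ge0 ?(ltW r0) //.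
    apply: (@le_trans _ _ (\sum_(i < n) (2 * r))).
      apply: ler_sum => i _; apply: le_trans (norm_coord _ _) _.
      exact: le_trans (norm_le_enorm _) hh.
    by rewrite sumr_const card_ord -[_ *+ n]mulr_natl.
  apply: ler_wpM2r; first by rewrite mulr_ge0 ?powR_ge0.
  apply: ler_wpM2l => //; apply: ge0_ler_powR; rewrite ?nnegrE // ltW //.
have /andP[v1 _] := fine_volume_eball c n0 r0; set v := fine _ in v1 *.
set p := 1 + _.
have rn0 : 0 < r / n%:R by exact: divr_gt0.
have vp : (r / n%:R) `^ (n%:R + (m%:R + d)) <= v `^ p.
  have -> : n%:R + (m%:R + d) = n%:R * p by rewrite /p; field; rewrite gt_eqF.
  rewrite powRrM powR_mulrn ?(ltW rn0) //; apply: ge0_ler_powR; rewrite ?nnegrE //.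
  - by rewrite /p addr_ge0 // divr_ge0 // addr_ge0 // ltW.
  - by rewrite exprn_ge0 // ltW.
  - by apply: le_trans v1; rewrite exprn_ge0 // ltW.
have P0 : 0 < (r / n%:R) `^ (n%:R + (m%:R + d)) by exact: powR_gt0.
have vp0 : 0 < v `^ p := lt_le_trans P0 vp.
apply: (@le_trans _ _ (((v `^ p)^-1)%:E * (k * (2 * r) ^+ n)%:E)%E).
  apply: lee_wpmul2l; first by rewrite lee_fin invr_ge0 ltW.
  apply: (Rn_integral_on_le (c := c)) => // [y hy|y hy].
    by rewrite !lee_fin enorm_ge0 pointwise.
  by apply: le_trans (norm_le_enorm _) _; exact: ltW.
rewrite -EFinM lee_fin mulrC ler_pdivrMr //.
apply: (@le_trans _ _ (C * ball_cst * X * (r / n%:R) `^ (n%:R + (m%:R + d)))); last first.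
  by apply: ler_wpM2l => //; rewrite !mulr_ge0 ?ball_cst_ge0.
rewrite le_eqVlt; apply/orP; left; apply/eqP.
have -> : C * ball_cst * X * (r / n%:R) `^ (n%:R + (m%:R + d)) =
   2 * n%:R ^+ m * 2 `^ (n%:R + d) * C * X *
   ((2 * n%:R) `^ (n%:R + (m%:R + d)) * (r / n%:R) `^ (n%:R + (m%:R + d))) by rewrite /ball_cst; ring.
rewrite -powRM ?(ltW rn0) ?mulr_ge0 //.
have -> : 2 * n%:R * (r / n%:R) = 2 * r by field; rewrite gt_eqF.
have -> : (2 * r) `^ (n%:R + (m%:R + d)) = (2 * r) ^+ n * ((2 * r) ^+ m * (2 * r) `^ d).
  by rewrite 2?powRD ?(gt_eqF r20) ?implybT // !powR_mulrn // ltW.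
by rewrite /k [(n%:R * _) ^+ m]exprMn; ring.
Qed.

Lemma dYa_pderiv (b : 'I_n -> nat) (K : V -> V -> W) x : dYa b K x = pderiv b (K x).
Proof.
rewrite /dYa /pderiv; elim: (enum 'I_n) => //= i s IH.
by elim: (b i) => //= j IHj; apply/funext => y; rewrite /dY IHj.
Qed.

Lemma dXa_pderiv (a : 'I_n -> nat) (K : V -> V -> W) y : (dXa a K)^~ y = pderiv a (K^~ y).
Proof.
rewrite /dXa /pderiv; elim: (enum 'I_n) => //= i s IH.
by elim: (a i) => //= j IHj; apply/funext => x; rewrite /dX -IHj.
Qed.

Lemma dYa0 (K : V -> V -> W) : dYa (fun=> 0%N) K = K.
Proof. by rewrite /dYa; elim: (enum 'I_n) => //= i s ->. Qed.

Lemma dXa0 (K : V -> V -> W) : dXa (fun=> 0%N) K = K.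
Proof. by rewrite /dXa; elim: (enum 'I_n) => //= i s ->. Qed.

Lemma mabs0 : mabs (fun _ : 'I_n => 0%N) = 0%N.
Proof. by rewrite /mabs big1. Qed.

Lemma Ck_on_dY U k (K : V -> V -> W) x : Ck_on U k K -> smooth_on (fun z => U (x, z)) k (K x).
Proof.
elim: k K => [|k IH] K //= [_ [HD HC]] [|i w] j z /= wk Uz.
  exact: (HD j (x, z) Uz).2.
exact: (IH (dY i K) (HC i).2 w j z wk Uz).
Qed.

Lemma Ck_on_dX U k (K : V -> V -> W) y : Ck_on U k K -> smooth_on (fun z => U (z, y)) k (K^~ y).
Proof.
elim: k K => [|k IH] K //= [_ [HD HC]] [|i w] j z /= wk Uz.
  exact: (HD j (z, y) Uz).1.
exact: (IH (dX i K) (HC i).1 w j z wk Uz).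
Qed.

Lemma smooth_kernel_std K : smooth_kernel O m d K -> std_kernel O m d K.
Proof.
move=> [cK [C [sizeK [holdY holdX]]]].
split; first by case: (m) cK => [|?] [].
pose C1 := Num.max C 0; have C10 : 0 <= C1 by rewrite le_max lexx orbT.
have CC1 : C <= C1 by rewrite le_max lexx.
(* With diam(B) >= r / 2, the value 16 turns C' diam(B) <= |x - c| into 8 r <= |x - c|. *)
pose C' := Num.max 16 (Num.max C (C1 * ball_cst)).
exists C'; split; first by rewrite le_max ler1n.
split=> [x y Ox Oy xy|].
  have := sizeK (fun=> 0%N) (fun=> 0%N) x y; rewrite !mabs0 dXa0 dYa0 !subr0 => H.
  apply: le_trans (H isT Ox Oy xy) _; apply: ler_wpM2r; first exact: powR_ge0.
  by rewrite !le_max lexx orbT.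
have ball (G : V -> V -> W) :
    (forall x, O x -> smooth_on (fun z => O z /\ x != z) m (G x)) ->
    (forall b x z h, mabs b = m -> O x -> O z -> O (z + h) -> enorm h <= edist x z / 2 ->
       enorm (pderiv b (G x) (z + h) - pderiv b (G x) z)
         <= C * enorm h `^ d * edist x z `^ (- (n%:R + d))) ->
    ball_est O m d C' G.
  move=> sG hG x c r Ox r0 [_ cO] hdiam; apply: ge_ereal_sup => _ [h [hh ->]].
  have r2 : ((16 * (r / 2))%:E <= (edist x c)%:E)%E.
    apply: le_trans hdiam; rewrite EFinM; apply: (@le_trans _ _ (16%:E * diam (eball c r))%E).
      by apply: lee_wpmul2l; rewrite ?lee_fin ?diam_eball_ge.
    apply: lee_wpmul2r; last by rewrite lee_fin le_max lexx.
    by apply: le_trans (diam_eball_ge c r0); rewrite lee_fin divr_ge0 // ltW.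
  apply: le_trans (smooth_ball_bound C10 (sG x Ox) _ r0 _ _ _) _.
  - move=> b z k bm Oz Ozk hk; apply: le_trans (hG b x z k bm Ox Oz Ozk hk) _.
    by do 2 (apply: ler_wpM2r; first exact: powR_ge0).
  - by apply: subset_trans cO; exact: subset_closure.
  - by move: r2; rewrite lee_fin; lra.
  - by rewrite -lee_fin; apply: le_trans hh _; exact: diam_eball_le.
  rewrite lee_fin; apply: ler_wpM2r; first exact: powR_ge0.
  by rewrite !le_max lexx !orbT.
split; apply: ball.
- move=> x Ox w i z wm [Oz xz]; apply: (Ck_on_dY (U := offdiag O) cK) => //.
- move=> b x z h bm Ox Oz Ozh hh; have := holdY (fun=> 0%N) b x z h.
  by rewrite mabs0 dXa0 dYa_pderiv; apply.
- move=> x Ox w i z wm [Oz xz]; apply: (Ck_on_dX (U := offdiag O) cK) => //.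
  by split=> //; split=> //=; rewrite eq_sym.
- move=> b x z h bm Ox Oz Ozh hh; have := holdX b (fun=> 0%N) z x h.
  have dE w : dXa b (dYa (fun=> 0%N) K) w x = pderiv b (K^~ x) w.
    by rewrite dYa0 -dXa_pderiv.
  by rewrite mabs0 addn0 !dE [edist z x]edistC; apply.
Qed.

End SmoothToStandard.

Theorem theorem2p9 (R : realType) (n m : nat) (O : set 'rV[R]_n) (d : R) :
  (2 <= n)%N -> (0 < m < n)%N -> uniform_domain O -> 0 < d < 1 ->
  (forall K : 'rV[R]_n -> 'rV[R]_n -> 'rV[R]_2,
      std_kernel O m d K <-> smooth_kernel O m d K) /\
  (forall K : 'rV[R]_n -> 'rV[R]_n -> 'rV[R]_2,
      std_kernel setT m d K ->
      forall a b : 'I_n -> nat, (mabs a + mabs b)%N = m ->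
        CZ_kernel (dXa a (dYa b K))).
Proof.
move=> n2 mn uO d01; have n0 : (0 < n)%N := ltnW n2.
have /andP[d0 d1] := d01.
have std_smooth (U : set 'rV[R]_n) K : uniform_domain U -> std_kernel U m d K ->
    smooth_kernel U m d K.
  move=> uU; have [c c1 chU] := uniform_chainable n0 uU.
  have [? [_ [[oU _] _]]] := uU; move=> HK; exact: (std_kernel_smooth mn d01 oU c1 chU HK).
split=> K.
  by split; [exact: std_smooth|exact: smooth_kernel_std].
move=> /(std_smooth _ _ (setT_uniform R n)) [_ [C [sizeK [holdY holdX]]]] a b abm.
have C0 : C <= Num.max C 0 by rewrite le_max lexx.
have size_le x y : x != y -> enorm (dXa a (dYa b K) x y) <= C * edist x y `^ (- n%:R).
  move=> xy; have := sizeK a b x y; rewrite abm leqnn => /(_ isT I I xy).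
  by have -> : m%:R - n%:R - (mabs a)%:R - (mabs b)%:R = - n%:R :> R
    by rewrite -abm natrD; ring.
exists d, C; split; first by rewrite d0 ltW.
split; split=> [x y xy|x y h xy hh].
- exact: size_le.
- exact: holdY.
- by rewrite edistC; apply: size_le; rewrite eq_sym.
- rewrite edistC; rewrite edistC in hh; exact: holdX.
Qed.
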